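(* Let $F\in M_d(\mathbb C)$ be a numerical contraction (not necessarily strict), and let $$\mathcal W_F=\{(s,p)\in\mathbb C^2:\det(F^*+pF-sI)=0\}.$$ Then $\mathcal W_F$ is a distinguished variety if and only if $F$ is completely non-unitary. Moreover, each irreducible component of $\mathcal W_F$ intersects $\mathbb G$ when $F$ is a completely non-unitary numerical contraction. Conversely, every distinguished variety with each irreducible component intersecting $\mathbb G$ is of the form $\mathcal W_F$ for some completely non-unitary numerical contraction $F$ (a square complex matrix of some size).
   Context: $M_d(\mathbb C)$ is the algebra of $d\times d$ complex matrices. $F$ is a numerical contraction if its numerical radius $\nu(F)=\sup\{|\langle Fh,h\rangle|:\|h\|=1\}$ is at most $1$. A matrix (operator) is completely non-unitary (c.n.u.) if it has no nonzero reducing subspace on which it is unitary. $\mathbb D$ is the open unit disk and $\mathbb T$ the unit circle; $\mathbb G=\{(z_1+z_2,z_1z_2):z_1,z_2\in\mathbb D\}$ is the symmetrized bidisk, with topological boundary $\partial\mathbb G$ and distinguished boundary $b\mathbb G=\{(z_1+z_2,z_1z_2):z_1,z_2\in\mathbb T\}$. A distinguished variety is the zero set $Z(\xi)\subset\mathbb C^2$ of a polynomial $\xi$ in two variables such that $Z(\xi)\cap\mathbb G\neq\emptyset$ and $Z(\xi)\cap\partial\mathbb G=Z(\xi)\cap b\mathbb G$. *)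

(* Defs.v *)
From HB Require Import structures.
From mathcomp Require Import all_boot all_order all_algebra.
From mathcomp Require Import complex spectral sesquilinear.
From mathcomp Require Import all_classical all_reals all_analysis.

Set Implicit Arguments.
Unset Strict Implicit.
Unset Printing Implicit Defensive.

Import Order.TTheory GRing.Theory Num.Theory.
Import numFieldNormedType.Exports.

Local Open Scope classical_set_scope.
Local Open Scope complex_scope.
Local Open Scope sesquilinear_scope.
Local Open Scope ring_scope.

(* <h, k> = \sum_i h_i * conj k_i, for column vectors ([dotmx] is the library's
   Hermitian product, which takes row vectors). *)
Definition cdot (R : realType) (d : nat) (h k : 'cV[R[i]]_d) : R[i] :=
  dotmx h^T k^T.

(* [`|z|] has type R[i]; [normc z] is the same modulus as an element of R. *)
Definition numerical_radius (R : realType) (d : nat) (F : 'M[R[i]]_d) : R :=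
  sup [set ComplexField.Normc.normc (cdot (F *m h) h) |
        h in [set h : 'cV[R[i]]_d | cdot h h = 1]].

Definition numerical_contraction (R : realType) (d : nat) (F : 'M[R[i]]_d) :
  Prop := numerical_radius F <= 1.

Definition reducing (R : realType) (d : nat) (F : 'M[R[i]]_d)
    (U : {vspace 'cV[R[i]]_d}) : Prop :=
  forall h, h \in U -> F *m h \in U /\ F^t* *m h \in U.

(* h |-> F h restricts to a unitary operator of U: inner products are preserved
   and every vector of U is attained. *)
Definition unitary_on (R : realType) (d : nat) (F : 'M[R[i]]_d)
    (U : {vspace 'cV[R[i]]_d}) : Prop :=
  (forall h k, h \in U -> k \in U -> cdot (F *m h) (F *m k) = cdot h k) /\
  (forall k, k \in U -> exists2 h, h \in U & F *m h = k).

Definition completely_nonunitary (R : realType) (d : nat) (F : 'M[R[i]]_d) :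
  Prop :=
  ~ exists U : {vspace 'cV[R[i]]_d},
      [/\ U != 0%VS, reducing F U & unitary_on F U].

Definition symmetrized_bidisk (R : realType) : set (R[i] * R[i]) :=
  [set z | exists z1 z2 : R[i],
             [/\ `|z1| < 1, `|z2| < 1 & z = (z1 + z2, z1 * z2)]].

Definition distinguished_boundary (R : realType) : set (R[i] * R[i]) :=
  [set z | exists z1 z2 : R[i],
             [/\ `|z1| = 1, `|z2| = 1 & z = (z1 + z2, z1 * z2)]].

Arguments symmetrized_bidisk R : clear implicits.
Arguments distinguished_boundary R : clear implicits.

(* The topology of R[i] is declared by the library on the alias R[i]^o;
   C^2 carries the product topology. *)
Definition topological_boundary (R : realType) (A : set (R[i] * R[i])) :
  set (R[i] * R[i]) :=
  let A' : set (R[i]^o * R[i]^o) := A in closure A' `\` interior A'.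

(* A polynomial in two variables (s, p) is a polynomial in s whose coefficients
   are polynomials in p. *)
Definition zero_set (R : realType) (xi : {poly {poly R[i]}}) :
  set (R[i] * R[i]) := [set z | xi.[z.1%:P].[z.2] = 0].

Definition distinguished_variety (R : realType) (V : set (R[i] * R[i])) : Prop :=
  exists xi : {poly {poly R[i]}},
    [/\ V = zero_set xi,
        V `&` symmetrized_bidisk R !=set0 &
        V `&` topological_boundary (symmetrized_bidisk R)
          = V `&` distinguished_boundary R].

Definition algebraic_set (R : realType) (V : set (R[i] * R[i])) : Prop :=
  exists S : set {poly {poly R[i]}}, V = \bigcap_(xi in S) zero_set xi.

Definition irreducible_set (R : realType) (V : set (R[i] * R[i])) : Prop :=
  V !=set0 /\
  forall A B : set (R[i] * R[i]), algebraic_set A -> algebraic_set B ->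
    V `<=` A `|` B -> V `<=` A \/ V `<=` B.

(* [Y] is a maximal irreducible algebraic subset of [V]. *)
Definition irreducible_component (R : realType) (V Y : set (R[i] * R[i])) :
  Prop :=
  [/\ algebraic_set Y, irreducible_set Y, Y `<=` V &
      forall Y' : set (R[i] * R[i]), algebraic_set Y' -> irreducible_set Y' ->
        Y `<=` Y' -> Y' `<=` V -> Y' = Y].

Definition determinantal_variety (R : realType) (d : nat) (F : 'M[R[i]]_d) :
  set (R[i] * R[i]) :=
  [set z | \det (F^t* + z.2 *: F - z.1%:M) = 0].

(* Main.v *)
Require Import Defs.
From HB Require Import structures.
From mathcomp Require Import all_boot all_order all_algebra.
From mathcomp Require Import complex spectral sesquilinear.
From mathcomp Require Import all_classical all_reals topology.
From mathcomp Require Import perm cyclic separable cyclotomic.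
From mathcomp Require Import ring zify.

(** An eigenvector [h] of [F^* + p F] has eigenvalue [s = conj a + p a] with
    [a = <F h, h> / <h, h>].  If [|a| < 1] then [(s, p)] lies in [G] for [|p| < 1];
    if [|a| = 1], positivity of [2 - conj a F - a F^*] makes [h] a joint eigenvector of
    [F] and [F^*], contradicting complete non-unitarity.  The variety is the zero set of
    the characteristic polynomial, monic in [s], so each component is again the zero set
    of a monic polynomial and has a point over [p = 0].

    Conversely let [V = Z(xi)] be distinguished.  Over [|p| < 1] no root of [xi(., p)]
    crosses the boundary of [G], so the power sums of the roots in [G] are holomorphic
    in [p]; their symmetry on the circle makes them polynomials, and Newton's
    identities give a monic factor [q] of [xi] with [V = Z(q)].  On [|p| = 1] the roots
    satisfy [s = p conj s], so the Hermite form of [q] is a positive form, polynomial in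
    [p] up to a power of [p], for which the companion matrix [C] satisfies
    [C^* = p^-1 C].  Dividing out the zeros of its determinant and then
    column-reducing turns it into a constant form, with respect to which the matrix
    becomes [F^* + p F].  Its eigenvalues on the circle are bounded by [2], which says
    that the numerical radius of [F] is at most [1]. *)

Set Implicit Arguments.
Unset Strict Implicit.
Unset Printing Implicit Defensive.

Import Order.TTheory GRing.Theory Num.Theory.

Local Open Scope sesquilinear_scope.
Local Open Scope ring_scope.

(** * Polynomials on the unit circle *)

Section Circle.
Variable K : numClosedFieldType.
Implicit Types (f g w : {poly K}) (a p z : K).

(** Most of the argument runs over an arbitrary algebraically closed field [K] with a norm, where
    neither completeness nor compactness is at hand. Holomorphy is therefore replaced by uniform
    polynomial approximation on smaller discs, contour integrals by averages over roots of unity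
    with geometrically small error, and compactness by explicit lower bounds and Lipschitz
    constants. Membership in G is tested by the inequality |s - conj s p| < 1 - |p|^2 with |p| < 1,
    which does not mention z1 and z2 and whose limit at |p| = 1 is s = p conj s.

    Two obstacles shape the realization. The Hermite form degenerates identically when [q] has a
    repeated factor, so such a [q] is split and the pencils of the factors are added as diagonal
    blocks. And making the form constant is a spectral factorization, done algebraically: a zero a
    of the determinant is removed together with its mirror image 1 / conj a, after which a degree
    count forces all column degrees to be equal. *)

Lemma prim_root_exists n : (n > 0)%N -> exists z : K, n.-primitive_root z.
Proof.
move=> n_gt0; have [r Dp] := closed_field_poly_normal ('X^n - 1 : {poly K}).
rewrite (monicP _) ?monicXnsubC // scale1r in Dp.
have rn1 : all n.-unity_root r by apply/allP=> z; rewrite -root_prod_XsubC -Dp.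
have sz_r : (n < (size r).+1)%N.
  by rewrite -(size_prod_XsubC r id) -Dp size_XnsubC.
have [|z] := hasP (has_prim_root n_gt0 rn1 _ sz_r); last by exists z.
by rewrite -separable_prod_XsubC -Dp separable_Xn_sub_1 // pnatr_eq0 -lt0n.
Qed.

Lemma conj_circle p : `|p| = 1 -> p^* = p^-1.
Proof. by move=> p1; rewrite invC_norm p1 expr1n invr1 mul1r. Qed.

Lemma circle_neq0 p : `|p| = 1 -> p != 0.
Proof. by move=> p1; rewrite -normr_gt0 p1 ltr01. Qed.

Lemma root_of_unity_norm n z : n.-primitive_root z -> `|z| = 1.
Proof.
move=> zP; have n0 := prim_order_gt0 zP.
have := congr1 Num.norm (prim_expr_order zP); rewrite normrX normr1.
by move/eqP; rewrite pexpr_eq1 // => /eqP.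
Qed.

Lemma circle_nonroot f : f != 0 -> exists2 p, `|p| = 1 & f.[p] != 0.
Proof.
move=> f0; pose n := (size f).
have n0 : (0 < n)%N by rewrite lt0n size_poly_eq0.
have [z zP] := prim_root_exists n0.
pose rs := [seq z ^+ i | i <- iota 0 n].
have urs : uniq rs.
  rewrite map_inj_in_uniq ?iota_uniq // => i j; rewrite !mem_iota /= !add0n => ni nj /eqP.
  by rewrite (eq_prim_root_expr zP) !modn_small // => /eqP.
have : ~~ all (root f) rs.
  by apply/negP => /max_poly_roots - /(_ f0 urs); rewrite size_map size_iota ltnn.
case/allPn=> x /mapP[i _ ->] fx; exists (z ^+ i) => //.
by rewrite normrX (root_of_unity_norm zP) expr1n.
Qed.

(** The zeros of [w] are exceptional points where nothing has to be checked; later [w] is the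
    determinant of a change of basis. *)
Lemma circle_poly_eq f g w : w != 0 ->
  (forall p, `|p| = 1 -> w.[p] != 0 -> f.[p] = g.[p]) -> f = g.
Proof.
move=> w0 fg; apply/eqP; rewrite -subr_eq0; apply/negPn/negP => fg0.
have [p p1] := circle_nonroot (mulf_neq0 w0 fg0).
by rewrite hornerM mulf_eq0 negb_or !hornerE => /andP[wp]; rewrite fg ?subrr ?eqxx.
Qed.

(** The reciprocal polynomial z^n conj(f(1 / conj z)), which turns conjugation on the circle into an
    operation on polynomials of degree at most [n]. *)
Definition conj_rev n f : {poly K} := \poly_(i < n.+1) (f`_(n - i))^*.

Lemma size_conj_rev n f : (size (conj_rev n f) <= n.+1)%N.
Proof. exact: size_poly. Qed.

Lemma horner_conj_rev n f z : (size f <= n.+1)%N -> z != 0 ->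
  (conj_rev n f).[z] = z ^+ n * (f.[z^*^-1])^*.
Proof.
move=> sf z0; rewrite horner_poly (horner_coef_wide _ sf) rmorph_sum mulr_sumr.
rewrite [RHS](reindex_inj rev_ord_inj) /=; apply: eq_bigr => i _.
rewrite rmorphM rmorphXn fmorphV /= conjCK subSS mulrCA; congr (_ * _).
have le_in : (i <= n)%N by rewrite -ltnS.
by rewrite -{2}(subnK le_in) exprD -mulrA mulrCA exprVn mulfV ?mulr1 ?expf_neq0.
Qed.

(* An identity [f = p^e conj g] on the circle persists on the punctured plane after
   reflecting [p] to [1 / conj p]. *)
Lemma circle_reflect f g w e : w != 0 ->
  (forall p, `|p| = 1 -> w.[p] != 0 -> f.[p] = p ^+ e * (g.[p])^*) ->
  forall a, a != 0 -> f.[a] = a ^+ e * (g.[a^*^-1])^*.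
Proof.
move=> w0 fg a a0; pose n := (size g).
have sg : (size g <= n.+1)%N by [].
have E : 'X^n * f = 'X^e * conj_rev n g.
  apply: (circle_poly_eq w0) => p p1 wp; have p0 := circle_neq0 p1.
  rewrite !hornerE (horner_conj_rev sg p0) ?hornerXn fg // (conj_circle p1) invrK.
  by rewrite mulrCA.
have := congr1 (horner^~ a) E; rewrite !hornerE ?hornerXn (horner_conj_rev sg a0).
by rewrite mulrCA; apply: mulfI; rewrite expf_neq0.
Qed.

Lemma circle_reflect_on f g w e : w != 0 ->
  (forall p, `|p| = 1 -> w.[p] != 0 -> f.[p] = p ^+ e * (g.[p])^*) ->
  forall p, `|p| = 1 -> f.[p] = p ^+ e * (g.[p])^*.
Proof.
move=> w0 fg p p1; rewrite (circle_reflect w0 fg (circle_neq0 p1)).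
by rewrite (conj_circle p1) invrK.
Qed.

(** On the circle conj g involves only non-positive powers of p, so p^e conj g cannot have degree
    above e. *)
Lemma circle_size f g e :
  (forall p, `|p| = 1 -> f.[p] = p ^+ e * (g.[p])^*) -> (size f <= e.+1)%N.
Proof.
move=> fg; have [->|f0] := eqVneq f 0; first by rewrite size_poly0.
pose n := (size g).-1.
have sg : (size g <= n.+1)%N by exact: leqSpred.
have E : 'X^n * f = 'X^e * conj_rev n g.
  apply: (@circle_poly_eq _ _ 1) => [|p p1 _]; first exact: oner_neq0.
  have p0 := circle_neq0 p1; rewrite !hornerE (horner_conj_rev sg p0) ?hornerXn fg //.
  by rewrite (conj_circle p1) invrK mulrCA.
have : (n + size f <= e + n.+1)%N.
  have E1 : size ('X^n * f) = (n + size f)%N.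
    by rewrite size_monicM ?monicXn // size_polyXn.
  rewrite -E1 E; apply: leq_trans (size_polyMleq _ _) _.
  by rewrite size_polyXn /= leq_add2l size_conj_rev.
by rewrite addnS -addSn addnC leq_add2r.
Qed.

Lemma poly_lipschitz f (B : K) : 0 <= B -> exists2 L : K, 0 <= L &
  forall x y, `|x| <= B -> `|y| <= B -> `|f.[x] - f.[y]| <= L * `|x - y|.
Proof.
move=> B0; elim/poly_ind: f => [|f c [L L0 HL]].
  by exists 0 => // x y _ _; rewrite !horner0 subrr normr0 mul0r.
exists (L * B + `|f.[0]| + L * B).
  by rewrite !addr_ge0 ?mulr_ge0.
move=> x y xB yB; rewrite !hornerE.
have -> : f.[x] * x + c - (f.[y] * y + c) = (f.[x] - f.[y]) * x + f.[y] * (x - y) by ring.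
apply: le_trans (ler_normD _ _) _; rewrite !normrM -addrA mulrDl; apply: lerD.
  rewrite mulrAC; apply: ler_pM => //; exact: HL.
apply: ler_wpM2r => //; rewrite -[f.[y]](subrK f.[0]) addrC.
apply: le_trans (ler_normD _ _) _; apply: lerD => //.
apply: le_trans (HL _ _ yB _) _; first by rewrite normr0.
by apply: ler_wpM2l => //; rewrite subr0.
Qed.

(** The points are Cayley transforms (1 + it) / (1 - it) of small real t, rotated by [a]. Roots of
    unity need not come close to 1 in a field that is not Archimedean. *)
Lemma circle_dense_nonroot w a (e : K) : w != 0 -> `|a| = 1 -> 0 < e ->
  exists p, [/\ `|p| = 1, `|p - a| <= e & w.[p] != 0].
Proof.
move=> w0 a1 e0; pose n := size w.
pose t (k : nat) : K := (e / 2) / k.+1%:R.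
have t_gt0 k : 0 < t k by rewrite !divr_gt0 ?ltr0n.
have t_le k : t k <= e / 2.
  by rewrite ler_pdivrMr ?ltr0n // ler_peMr ?divr_ge0 ?ler0n ?(ltW e0) // ler1n.
have t_real k : (t k)^* = t k by apply/CrealP/gtr0_real.
have sq k : (1 - 'i * t k) * (1 + 'i * t k) = 1 + t k ^+ 2.
  by rewrite -subr_sqr expr1n exprMn sqrCi mulN1r opprK.
have sq_gt1 k : 1 < 1 + t k ^+ 2 by rewrite ltrDl exprn_gt0.
have den k : 1 - 'i * t k != 0.
  by apply: contraTneq (sq_gt1 k) => E; rewrite -sq E mul0r ltr10.
have conj_den k : (1 - 'i * t k)^* = 1 + 'i * t k.
  by rewrite rmorphB rmorphM /= conjC1 conjCi t_real mulNr opprK.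
have norm_den k : `|1 - 'i * t k| ^+ 2 = 1 + t k ^+ 2 by rewrite normCK conj_den sq.
have norm_num k : `|1 + 'i * t k| = `|1 - 'i * t k| by rewrite -conj_den norm_conjC.
have den_ge1 k : 1 <= `|1 - 'i * t k|.
  by rewrite -(@ler_pXn2r _ 2) ?nnegrE // expr1n norm_den ltW.
pose p k : K := a * ((1 + 'i * t k) / (1 - 'i * t k)).
have p1 k : `|p k| = 1 by rewrite normrM normf_div norm_num divff ?mulr1 // normr_eq0.
have p_close k : `|p k - a| <= e.
  have -> : p k - a = a * ('i * (t k *+ 2) / (1 - 'i * t k)).
    by rewrite /p; field.
  rewrite !normrM a1 mul1r normCi mul1r normfV normrMn (gtr0_norm (t_gt0 k)).
  rewrite ler_pdivrMr; last exact: lt_le_trans ltr01 (den_ge1 k).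
  apply: le_trans (_ : e * 1 <= _); last by rewrite ler_wpM2l ?(ltW e0).
  by rewrite mulr1 -mulr_natr -ler_pdivlMr.
have p_inj : injective p.
  have a0 := circle_neq0 a1; move=> k l /(mulfI a0) E.
  suff Et : t k = t l.
    have e20 : e / 2 != 0 by rewrite mulf_neq0 ?invr_eq0 ?pnatr_eq0 // gt_eqF.
    by move/(mulfI e20)/invr_inj: Et => /eqP; rewrite eqr_nat eqSS => /eqP.
  have E2 : (1 + 'i * t k) * (1 - 'i * t l) = (1 + 'i * t l) * (1 - 'i * t k).
      by apply/eqP; rewrite -eqr_div // E.
  have E3 : 'i * (t k) *+ 2 = 'i * (t l) *+ 2.
      have -> : 'i * (t k) *+ 2 = (1 + 'i * t k) * (1 - 'i * t l) - (1 + 'i * t l) * (1 - 'i * t k) + 'i * (t l) *+ 2 by ring.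
      by rewrite E2 subrr add0r.
  by move/eqP: E3; rewrite eqrMn2r // => /eqP /(mulfI (neq0Ci _)).
pose rs := [seq p k | k <- iota 0 n].
have urs : uniq rs by rewrite map_inj_uniq ?iota_uniq.
have : ~~ all (root w) rs.
  by apply/negP => /max_poly_roots - /(_ w0 urs); rewrite size_map size_iota ltnn.
by case/allPn=> x /mapP[k _ ->] wx; exists (p k).
Qed.

Lemma ge0_approx (y : K) : (forall e, 0 < e -> exists2 x, 0 <= x & `|x - y| <= e) -> 0 <= y.
Proof.
move=> H; pose r := `|y|; pose d := `|r - y|.
suff /eqP <- : r == y by exact: normr_ge0.
rewrite -subr_eq0 -normr_eq0 -/d; apply/negPn/negP => nd.
have d0 : 0 < d by rewrite lt_def nd normr_ge0.
have [x x0 xy] := H _ (divr_gt0 d0 (ltr0n K 3)).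
have : d <= d / 3 + d / 3.
  rewrite {1}/d; have -> : r - y = (r - x) + (x - y) by ring.
  apply: le_trans (ler_normD _ _) _.
  apply: lerD => //; rewrite /r -{1}(ger0_norm x0) -opprB normrN.
  by apply: le_trans (ler_dist_dist _ _) xy.
have -> : d / 3 + d / 3 = d * (2 / 3) by field.
by rewrite ler_pMr // ler_pdivlMr ?ltr0n // mul1r ler_nat.
Qed.

Lemma circle_ge0 w f m : w != 0 ->
  (forall p, `|p| = 1 -> w.[p] != 0 -> 0 <= p ^- m * f.[p]) ->
  forall p, `|p| = 1 -> 0 <= p ^- m * f.[p].
Proof.
move=> w0 Hf p p1; apply: ge0_approx => e e0.
have [L L0 HL] := poly_lipschitz f (@ler01 K).
have [M M0 HM] := poly_lipschitz ('X^m) (@ler01 K).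
have d0 : 0 < e / (L + M * `|f.[p]| + 1).
  by rewrite divr_gt0 // ltr_wpDl // addr_ge0 ?mulr_ge0.
have [z [z1 zp wz]] := circle_dense_nonroot w0 p1 d0.
exists (z ^- m * f.[z]); first exact: Hf.
have -> : z ^- m * f.[z] - p ^- m * f.[p] =
  z ^- m * (f.[z] - f.[p]) + (z ^- m - p ^- m) * f.[p] by ring.
have -> : z ^- m - p ^- m = (z ^+ m - p ^+ m)^*.
  by rewrite rmorphB !rmorphXn /= !conj_circle // !exprVn.
apply: le_trans (ler_normD _ _) _; rewrite !normrM normfV normrX z1 expr1n invr1 mul1r norm_conjC.
have := HL z p; have := HM z p; rewrite z1 p1 lexx ?hornerXn => /(_ isT isT) h1 /(_ isT isT) h2.
apply: le_trans (_ : (L + M * `|f.[p]| + 1) * `|z - p| <= _); last first.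
  by rewrite mulrC -ler_pdivlMr // ltr_wpDl // addr_ge0 ?mulr_ge0.
rewrite mulrDl mul1r; apply: ler_wpDr => //; rewrite mulrDl.
by apply: lerD => //; rewrite mulrAC; apply: ler_wpM2r.
Qed.

(* Comparing the values at the two points [a u] and [a / u], with [u] near 1, shows
   that the first derivative vanishes. *)
Lemma circle_double_root f m a : `|a| = 1 ->
  (forall p, `|p| = 1 -> 0 <= p ^- m * f.[p]) -> root f a -> ('X - a%:P) ^+ 2 %| f.
Proof.
move=> a1 Hf /factor_theorem[g Ef]; have a0 := circle_neq0 a1.
suff /factor_theorem[h Eh] : root g a by rewrite Ef Eh -mulrA -expr2 dvdp_mulIr.
rewrite /root; apply/negPn/negP => ga.
have [L L0 HL] := poly_lipschitz g (@ler01 K).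
have [M M0 HM] := poly_lipschitz ('X^m) (@ler01 K).
(* c (z / a - 1) is the linear part of z^-m f(z) at [a]; the remainder is of second order in z -
   a. *)
pose c := a ^- m * a * g.[a].
have c0 : c != 0 by rewrite !mulf_neq0 ?invr_eq0 ?expf_neq0.
have est z : `|z| = 1 -> `|z ^- m * f.[z] - c * (z / a - 1)| <= (L + M * `|g.[a]|) * `|z - a| ^+ 2.
  move=> z1; have z0 := circle_neq0 z1.
  have -> : z ^- m * f.[z] - c * (z / a - 1) =
     (z ^- m * (g.[z] - g.[a]) + (z ^- m - a ^- m) * g.[a]) * (z - a).
    by rewrite Ef hornerM hornerXsubC /c; move: (z ^- m) (a ^- m) => u v; field.
  rewrite normrM expr2 mulrA; apply: ler_wpM2r => //.
  have -> : z ^- m - a ^- m = (z ^+ m - a ^+ m)^*.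
    by rewrite rmorphB !rmorphXn /= !conj_circle // !exprVn.
  apply: le_trans (ler_normD _ _) _.
  rewrite !normrM normfV normrX z1 expr1n invr1 mul1r norm_conjC.
  have := HL z a; have := HM z a; rewrite z1 a1 lexx ?hornerXn => /(_ isT isT) h1 /(_ isT isT) h2.
  by rewrite mulrDl; apply: lerD => //; rewrite mulrAC; apply: ler_wpM2r.
pose B := L + M * `|g.[a]|; have B0 : 0 <= B by rewrite addr_ge0 ?mulr_ge0.
have S0 : 0 < B *+ 3 + `|c| + 1 by rewrite ltr_wpDl // addr_ge0 ?mulrn_wge0.
(* Multiplied by 3 B + |c| this stays below |c|, which gives the contradiction at the end. *)
have e0 : 0 < `|c| / (B *+ 3 + `|c| + 1) by rewrite divr_gt0 ?normr_gt0.
have Xa0 : 'X - a%:P != 0 by rewrite polyXsubC_eq0.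
have [z [z1 za]] := circle_dense_nonroot Xa0 a1 e0.
rewrite !hornerE subr_eq0 => z_neq_a; have z0 := circle_neq0 z1.
(* With z = a u one has y = a / u, so the linear terms at z and y are c d and c conj d; their sum is
   of second order because d + conj d = -|d|^2. *)
pose d := z / a - 1; pose y := a ^+ 2 / z.
have y1 : `|y| = 1 by rewrite normf_div normrX a1 z1 expr1n divr1.
have dc : y / a - 1 = d^*.
  by rewrite /d rmorphB rmorphM fmorphV /= conjC1 !conj_circle // /y; field; rewrite a0 z0.
have nd : `|d| = `|z - a|.
  have -> : d = (z - a) / a by rewrite /d; field.
  by rewrite normf_div a1 divr1.
have nd' : `|y - a| = `|z - a|.
  have -> : y - a = (y / a - 1) * a by field.
  by rewrite normrM dc norm_conjC a1 mulr1.
have dd : d + d^* = - `|z - a| ^+ 2.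
  rewrite -nd normCK -dc /d /y; field; by rewrite a0 z0.
have h1 := est z z1; have h2 := est y y1.
rewrite -/d in h1; rewrite dc nd' in h2.
set D := `|z - a| in za nd nd' dd h1 h2; have D0 : 0 < D by rewrite normr_gt0 subr_eq0.
set X := z ^- m * f.[z] in h1; set Y := y ^- m * f.[y] in h2.
have X0 : 0 <= X by exact: Hf.
have Y0 : 0 <= Y by exact: Hf.
rewrite -/B in h1 h2.
have XY : X <= (B *+ 2 + `|c|) * D ^+ 2.
  apply: le_trans (_ : X + Y <= _); first by rewrite lerDl.
  rewrite -(ger0_norm (addr_ge0 X0 Y0)).
  have -> : X + Y = (X - c * d) + (Y - c * d^*) + c * (d + d^*) by ring.
  apply: le_trans (ler_normD _ _) _; rewrite mulrDl; apply: lerD.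
    by apply: le_trans (ler_normD _ _) _; rewrite mulr2n mulrDl; apply: lerD.
  by rewrite dd normrM normrN normrX (gtr0_norm D0).
have : `|c| * D <= (B *+ 3 + `|c|) * D ^+ 2.
  rewrite -nd -normrM nd; have -> : c * d = X - (X - c * d) by ring.
  apply: le_trans (ler_normB _ _) _; rewrite (ger0_norm X0) mulrSr addrAC mulrDl.
  exact: lerD.
rewrite expr2 mulrA ler_pM2r // => cD.
have SD : (B *+ 3 + `|c|) * D <= (B *+ 3 + `|c|) * (`|c| / (B *+ 3 + `|c| + 1)).
  by apply: ler_wpM2l => //; rewrite addr_ge0 ?mulrn_wge0.
have lt_c : (B *+ 3 + `|c|) * (`|c| / (B *+ 3 + `|c| + 1)) < `|c|.
  by rewrite mulrA ltr_pdivrMr // [X in _ < X]mulrDr mulr1 mulrC ltrDl normr_gt0.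
by have := le_lt_trans (le_trans cD SD) lt_c; rewrite ltxx.
Qed.

End Circle.

(** * Hermitian forms *)

Section PSD.
Variable K : numClosedFieldType.

Lemma ctmxM m n p (A : 'M[K]_(m, n)) (B : 'M[K]_(n, p)) :
  (A *m B)^t* = B^t* *m A^t*.
Proof. by rewrite trmx_mul map_mxM. Qed.

Lemma ctmxD m n (A B : 'M[K]_(m, n)) : (A + B)^t* = A^t* + B^t*.
Proof. by rewrite linearD map_mxD. Qed.

Lemma ctmxZ m n (c : K) (A : 'M[K]_(m, n)) : (c *: A)^t* = c^* *: A^t*.
Proof. by rewrite linearZ map_mxZ. Qed.

Lemma ctmx_unit n (A : 'M[K]_n) : (A^t* \in unitmx) = (A \in unitmx).
Proof. by rewrite map_unitmx unitmx_tr. Qed.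

Definition herm_form n (A : 'M[K]_n) (u v : 'cV[K]_n) : K := (u^t* *m A *m v) 0 0.

Lemma herm_formDl n (A : 'M[K]_n) u1 u2 v :
  herm_form A (u1 + u2) v = herm_form A u1 v + herm_form A u2 v.
Proof. by rewrite /herm_form ctmxD !mulmxDl mxE. Qed.

Lemma herm_formDr n (A : 'M[K]_n) u v1 v2 :
  herm_form A u (v1 + v2) = herm_form A u v1 + herm_form A u v2.
Proof. by rewrite /herm_form mulmxDr mxE. Qed.

Lemma herm_formZl n (A : 'M[K]_n) c u v :
  herm_form A (c *: u) v = c^* * herm_form A u v.
Proof. by rewrite /herm_form ctmxZ -!scalemxAl mxE. Qed.

Lemma herm_formZr n (A : 'M[K]_n) c u v :
  herm_form A u (c *: v) = c * herm_form A u v.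
Proof. by rewrite /herm_form -scalemxAr mxE. Qed.

Lemma herm_form_adj n (A : 'M[K]_n) u v :
  (herm_form A u v)^* = herm_form (A^t*) v u.
Proof.
by rewrite /herm_form -{2}[u]trmxCK -!ctmxM mulmxA !mxE.
Qed.

Lemma herm_form_delta n (A : 'M[K]_n) i j :
  herm_form A (delta_mx i 0) (delta_mx j 0) = A i j.
Proof.
rewrite /herm_form trmx_delta map_delta_mx -rowE -colE !mxE //.
Qed.

Lemma herm_form1_eq0 n (v : 'cV[K]_n) : herm_form 1%:M v v = 0 -> v = 0.
Proof.
rewrite /herm_form mulmx1 mxE => /eqP; rewrite psumr_eq0 => [/allP H|i _].
  apply/matrixP=> i j; rewrite !mxE ord1; apply/eqP.
  by have := H i (mem_index_enum _); rewrite !mxE mulrC -normCK sqrf_eq0 normr_eq0.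
by rewrite !mxE mulrC -normCK exprn_ge0.
Qed.

Lemma herm_form1_ge0 n (v : 'cV[K]_n) : 0 <= herm_form 1%:M v v.
Proof.
by rewrite /herm_form mulmx1 mxE sumr_ge0 // => i _; rewrite !mxE mulrC -normCK exprn_ge0.
Qed.

Lemma herm_form1_gt0 n (v : 'cV[K]_n) : v != 0 -> 0 < herm_form 1%:M v v.
Proof.
by move=> v0; rewrite lt_def herm_form1_ge0 andbT; apply: contra_neq v0 => /herm_form1_eq0.
Qed.

Lemma herm_form_eq0 n (A : 'M[K]_n) : (forall v, herm_form A v v = 0) -> A = 0.
Proof.
move=> H.
have pol u v : herm_form A u v = 0.
  have := H (u + v); rewrite herm_formDl !herm_formDr !H add0r addr0 => E1.
  have := H (u + 'i *: v); rewrite herm_formDl !herm_formDr !H add0r addr0 herm_formZl herm_formZr.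
  rewrite conjCi mulNr -mulrBr => /eqP.
  rewrite mulf_eq0 (negPf (neq0Ci _)) /= subr_eq0 => /eqP E2.
  by move: E1; rewrite E2 -mulr2n => /eqP; rewrite mulrn_eq0 /= => /eqP.
by apply/matrixP=> i j; rewrite mxE -herm_form_delta pol.
Qed.

Definition psd n (A : 'M[K]_n) := forall v, 0 <= herm_form A v v.

Lemma psd_herm n (A : 'M[K]_n) : psd A -> A^t* = A.
Proof.
move=> pA; apply/eqP; rewrite -subr_eq0; apply/eqP/herm_form_eq0 => v.
have -> : herm_form (A^t* - A) v v = herm_form (A^t*) v v - herm_form A v v.
  by rewrite /herm_form mulmxBr mulmxBl mxE [X in _ + X]mxE.
by rewrite -herm_form_adj; have /ger0_real/CrealP -> := pA v; rewrite subrr.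
Qed.

Lemma psd_ker n (A : 'M[K]_n) v : psd A -> herm_form A v v = 0 -> A *m v = 0.
Proof.
move=> pA Av0; have hA := psd_herm pA; set w := A *m v.
apply: herm_form1_eq0; set N := herm_form _ _ _; have N0 : 0 <= N by exact: herm_form1_ge0.
have wAv : herm_form A w v = N by rewrite /N /herm_form mulmx1 -mulmxA.
have vAw : herm_form A v w = N by rewrite /N /herm_form -{1}hA -ctmxM mulmx1.
set c := herm_form A w w; have c0 : 0 <= c by exact: pA.
have c1 : 0 < c + 1 by rewrite ltr_wpDl.
(* The quadratic in t is minimal at N / c; the added 1 covers c = 0. *)
pose t := N / (c + 1).
have t_ge0 : 0 <= t by rewrite divr_ge0 // ltW.
have tC : (- t)^* = - t by apply/CrealP; rewrite realN ger0_real.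
have := pA (v + (- t) *: w); rewrite herm_formDl !herm_formDr !herm_formZl !herm_formZr.
rewrite Av0 wAv vAw -/c tC.
have -> : 0 + - t * N + (- t * N + - t * (- t * c)) = - (N ^+ 2 * ((c + 2) / (c + 1) ^+ 2)).
  by rewrite /t; field; rewrite gt_eqF.
rewrite oppr_ge0 => h; apply/eqP; rewrite -(sqrf_eq0 N) eq_le exprn_ge0 // andbT.
move: h; rewrite pmulr_lle0 // divr_gt0 ?exprn_gt0 //.
by rewrite ltr_wpDl // ltr0n.
Qed.

Lemma psd_congr n (A : 'M[K]_n) (D : 'M[K]_n) : psd A -> psd (D^t* *m A *m D).
Proof.
move=> pA v; have -> : herm_form (D^t* *m A *m D) v v = herm_form A (D *m v) (D *m v).
  by rewrite /herm_form ctmxM !mulmxA.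
exact: pA.
Qed.

Lemma psd_congr_inv n (A : 'M[K]_n) (D : 'M[K]_n) :
  D \in unitmx -> psd (D^t* *m A *m D) -> psd A.
Proof.
move=> uD /(@psd_congr _ _ (invmx D)); rewrite !mulmxA -ctmxM mulmxV // -mulmxA mulmxV //.
by rewrite mulmx1 trmx1 map_mx1 mul1mx.
Qed.

Lemma psd_sqrt n (A : 'M[K]_n) : psd A -> exists S : 'M[K]_n, A = S^t* *m S.
Proof.
move=> pA; have hA : A \is hermsymmx.
  by apply/is_hermitianmxP; rewrite expr0 scale1r (psd_herm pA).
have /hermitian_normalmx/orthomx_spectralP E := hA.
set P := spectralmx A in E; set d := spectral_diag A in E.
have PU : P \is unitarymx := spectral_unitarymx A.
have dg0 i : 0 <= d 0 i.
  have := pA (P^t* *m delta_mx i 0).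
  have -> : herm_form A (P^t* *m delta_mx i 0) (P^t* *m delta_mx i 0) = herm_form (diag_mx d) (delta_mx i 0) (delta_mx i 0).
    rewrite /herm_form ctmxM trmxCK E invmx_unitary // !mulmxA.
    rewrite -(mulmxA _ P (P^t*)) (unitarymxP PU) mulmx1.
    rewrite -(mulmxA _ P (P^t*)) (unitarymxP PU) mulmx1.
    by [].
  by rewrite herm_form_delta mxE eqxx mulr1n.
exists (diag_mx (\row_i sqrtC (d 0 i)) *m P).
rewrite ctmxM mulmxA -(mulmxA (P^t*)) tr_diag_mx map_diag_mx mulmx_diag.
rewrite {1}E invmx_unitary //; congr (_ *m diag_mx _ *m _).
apply/rowP=> i; rewrite !mxE.
rewrite -[RHS]/((sqrtC (d 0 i))^* * sqrtC (d 0 i)).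
have /ger0_real/CrealP -> : 0 <= sqrtC (d 0 i) by rewrite sqrtC_ge0.
by rewrite -expr2 sqrtCK.
Qed.

End PSD.

(** * Positive forms on the circle and their changes of basis *)

Section Pencil.
Variables (K : numClosedFieldType).

Definition evmx (p : K) m n (A : 'M[{poly K}]_(m, n)) : 'M[K]_(m, n) :=
  map_mx (horner_eval p) A.

Lemma evmxE p m n (A : 'M[{poly K}]_(m, n)) i j : evmx p A i j = (A i j).[p].
Proof. by rewrite mxE. Qed.

Lemma evmxM p m n k (A : 'M[{poly K}]_(m, n)) (B : 'M[{poly K}]_(n, k)) :
  evmx p (A *m B) = evmx p A *m evmx p B.
Proof. exact: map_mxM. Qed.

Lemma evmxC p m n (A : 'M[K]_(m, n)) : evmx p (map_mx polyC A) = A.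
Proof. by apply/matrixP=> i j; rewrite !mxE /horner_eval hornerC. Qed.

Lemma det_evmx p n (A : 'M[{poly K}]_n) : \det (evmx p A) = (\det A).[p].
Proof. by rewrite -[LHS]/(\det (map_mx _ A)) det_map_mx. Qed.

Lemma evmx_unit p n (A : 'M[{poly K}]_n) : (evmx p A \in unitmx) = ((\det A).[p] != 0).
Proof. by rewrite unitmxE det_evmx unitfE. Qed.

Lemma ctmxE m n (A : 'M[K]_(m, n)) i j : (A^t*) i j = (A j i)^*.
Proof. by rewrite !mxE. Qed.

(* On the circle, [p^-m H(p)] is a positive Hermitian form for which multiplication
   by [C(p)] satisfies [C* = p^-1 C]. *)
Record admissible n (m : nat) (C H : 'M[{poly K}]_n) : Prop := Admissible {
  adm_psd : forall p, `|p| = 1 -> psd (p ^- m *: evmx p H);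
  adm_comm : forall p, `|p| = 1 ->
    evmx p (H *m C) = p ^+ (m + m).+1 *: (evmx p (H *m C))^t*;
  adm_det : \det H != 0 }.

Lemma adm_herm n m (C H : 'M[{poly K}]_n) : admissible m C H -> forall p, `|p| = 1 ->
  evmx p H = p ^+ (m + m) *: (evmx p H)^t*.
Proof.
move=> adm p p1; have p0 := circle_neq0 p1.
have := psd_herm (adm_psd adm p1); rewrite ctmxZ fmorphV rmorphXn /= conj_circle // exprVn invrK.
move/(congr1 (fun A => p ^+ m *: A)); rewrite !scalerA mulfV ?expf_neq0 // scale1r.
by rewrite -exprD => /esym.
Qed.

Lemma adm_reflect n m (C H : 'M[{poly K}]_n) : admissible m C H -> forall a, a != 0 ->
  evmx a H = a ^+ (m + m) *: (evmx a^*^-1 H)^t*.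
Proof.
move=> adm a a0; apply/matrixP=> i j; rewrite [RHS]mxE ctmxE !evmxE.
apply: (@circle_reflect _ _ _ 1) => //; first exact: oner_neq0.
move=> p p1 _; have /matrixP/(_ i j) := adm_herm adm p1.
by rewrite [in RHS]mxE ctmxE !evmxE.
Qed.

(** This is the relation between [C] and [H] away from the circle; it makes the kernel of [evmx a H]
    stable under [evmx a C]. *)
Lemma adm_reflectM n m (C H : 'M[{poly K}]_n) : admissible m C H -> forall a, a != 0 ->
  evmx a H *m evmx a C = a *: ((evmx a^*^-1 C)^t* *m evmx a H).
Proof.
move=> adm a a0; rewrite -evmxM.
transitivity (a ^+ (m + m).+1 *: (evmx a^*^-1 (H *m C))^t*).
  apply/matrixP=> i j; rewrite [RHS]mxE ctmxE !evmxE.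
  apply: (@circle_reflect _ _ _ 1) => //; first exact: oner_neq0.
  move=> p p1 _; have /matrixP/(_ i j) := adm_comm adm p1.
  by rewrite [in RHS]mxE ctmxE !evmxE.
rewrite evmxM ctmxM [in RHS](adm_reflect adm a0) -scalemxAr scalerA.
by rewrite exprS.
Qed.

(** [D] need only be invertible generically: at the zeros of its determinant positivity follows by
    density, and self-adjointness because a polynomial identity extends over the circle. So [D] may
    absorb zeros of det H. *)
Lemma adm_basis_change n m (C H C' H' D : 'M[{poly K}]_n) :
    admissible m C H -> \det D != 0 -> D *m C = C' *m D ->
    (forall p, `|p| = 1 -> (evmx p D)^t* *m evmx p H' *m evmx p D = evmx p H) ->
  admissible m C' H'.
Proof.
move=> adm D0 DC DH; split=> [p p1|p p1|].
- have Hv v : exists f : {poly K}, forall z, herm_form (z ^- m *: evmx z H') v v = z ^- m * f.[z].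
    exists ((map_mx polyC (v^t*) *m H' *m map_mx polyC v) 0 0) => z.
    rewrite -evmxE !evmxM !evmxC /herm_form -scalemxAr -scalemxAl mxE //.
  move=> v; have [f Hf] := Hv v; rewrite Hf.
  apply: (circle_ge0 D0 _ p1) => z z1 Dz; rewrite -Hf.
  apply: (@psd_congr_inv _ _ _ (evmx z D)); first by rewrite evmx_unit.
  rewrite -scalemxAr -scalemxAl DH //; exact: adm_psd adm _ z1.
- apply/matrixP=> i j; rewrite [RHS]mxE ctmxE !evmxE.
  apply: (circle_reflect_on D0 _ p1) => z z1 Dz.
  have uD : evmx z D \in unitmx by rewrite evmx_unit.
  suff E : evmx z (H' *m C') = z ^+ (m + m).+1 *: (evmx z (H' *m C'))^t*.
    by have /matrixP/(_ i j) := E; rewrite [in RHS]mxE ctmxE !evmxE.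
  have X : (evmx z D)^t* *m evmx z (H' *m C') *m evmx z D = evmx z (H *m C).
    by rewrite !evmxM -(DH _ z1) -!mulmxA -!evmxM DC !evmxM.
  have uD' : (evmx z D)^t* \in unitmx by rewrite ctmx_unit.
  apply: (can_inj (mulKmx uD')); apply: (can_inj (mulmxK uD)).
  rewrite -scalemxAr -scalemxAl X (adm_comm adm z1) -X; congr (_ *: _).
  by rewrite !ctmxM trmxCK mulmxA.
have := mulf_neq0 D0 (adm_det adm) => /circle_nonroot[p p1].
rewrite hornerM mulf_eq0 negb_or => /andP[_]; rewrite -det_evmx -(DH _ p1) !det_mulmx.
by rewrite !mulf_eq0 !negb_or det_evmx => /andP[/andP[_ h] _]; apply: contraNneq h => ->; rewrite horner0.
Qed.

Lemma char_poly_basis_change n (C C' D : 'M[{poly K}]_n) :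
  \det D != 0 -> D *m C = C' *m D -> char_poly C' = char_poly C.
Proof.
move=> D0 DC; pose P := map_mx polyC D.
have dP : \det P != 0 by rewrite det_map_mx polyC_eq0.
apply: (mulIf dP); rewrite [RHS]mulrC -!det_mulmx; congr (\det _).
rewrite /char_poly_mx mulmxBl mulmxBr -!map_mxM DC; congr (_ - _).
by rewrite mul_scalar_mx mul_mx_scalar.
Qed.

End Pencil.

(** * Reduction of a positive form to a constant one *)

Section Saturation.
Variables (K : numClosedFieldType).

(** [P] stands for membership in an invariant subspace. By Cayley-Hamilton a product of factors B -
    r kills [v]; its last nonzero partial product is an eigenvector. *)
Lemma stable_eigenvector n (B : 'M[K]_n) (P : 'cV[K]_n -> Prop) v :
    (forall u c, P u -> P (B *m u - c *: u)) -> P v -> v != 0 ->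
  exists u c, [/\ P u, u != 0 & B *m u = c *: u].
Proof.
case: n B P v => [|n] B P v stP; first by rewrite flatmx0 eqxx.
have [rs Ers] := closed_field_poly_normal (char_poly B).
have: \prod_(r <- rs) (B - r%:M) *m v = 0.
  have := Cayley_Hamilton B; rewrite Ers (monicP (char_poly_monic _)) scale1r rmorph_prod.
  by under eq_bigr do rewrite rmorphB /= horner_mx_X horner_mx_C; move->; rewrite mul0mx.
elim: rs {Ers} => [|r rs IHrs]; first by rewrite big_nil mul1mx => ->; rewrite eqxx.
rewrite big_cons -mulmxA => E Pv v0.
have Pprod s : P (\prod_(t <- s) (B - t%:M) *m v).
  elim: s => [|t s IHs]; first by rewrite big_nil mul1mx.
  by rewrite big_cons -mulmxA mulmxBl mul_scalar_mx; apply: stP.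
have [w0|w0] := eqVneq (\prod_(t <- rs) (B - t%:M) *m v) 0; first exact: IHrs.
exists (\prod_(t <- rs) (B - t%:M) *m v), r; split=> //.
by apply/eqP; rewrite -subr_eq0 -mul_scalar_mx -mulmxBl E.
Qed.

Lemma det_eq0_kernel n (A : 'M[K]_n) : \det A = 0 -> exists2 v : 'cV[K]_n, v != 0 & A *m v = 0.
Proof.
rewrite -det_tr => /eqP/det0P[v v0 vA]; exists v^T; first by rewrite trmx_eq0.
by rewrite -[A]trmxK -trmx_mul vA trmx0.
Qed.

(** A rank-one update of the identity, 1 + (v - e) e^T, inverted by the Sherman-Morrison formula.
    The ring is general because the column will also have polynomial entries. *)
Lemma unitmx_with_column (R : comUnitRingType) n (v : 'cV[R]_n) i : v i 0 \is a GRing.unit ->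
  exists2 E : 'M[R]_n, E \in unitmx &
    E *m delta_mx i 0 = v /\ forall j, j != i -> E *m (delta_mx j 0 : 'cV_n) = delta_mx j 0.
Proof.
move=> vi; pose e : 'cV[R]_n := delta_mx i 0; pose u := v - e.
have ee : e^T *m e = 1%:M.
  by rewrite trmx_delta mul_delta_mx; apply/matrixP=> j k; rewrite !ord1 !mxE eqxx.
have ev : e^T *m v = (v i 0)%:M.
  by rewrite trmx_delta -rowE; apply/matrixP=> j k; rewrite !ord1 !mxE eqxx mulr1n.
have eu : e^T *m u = (v i 0 - 1)%:M by rewrite mulmxBr ev ee -raddfB.
exists (1%:M + u *m e^T); last first.
  split=> [|j ji]; first by rewrite mulmxDl mul1mx -mulmxA ee mulmx1 addrC subrK.
  rewrite mulmxDl mul1mx -mulmxA trmx_delta mul_delta_mx_cond eq_sym (negPf ji) mulr0n.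
  by rewrite mulmx0 addr0.
apply: (proj1 (@mulmx1_unit _ _ _ (1%:M - (v i 0)^-1 *: (u *m e^T)) _)).
rewrite mulmxDl mul1mx mulmxBr mulmx1 -scalemxAr -mulmxA (mulmxA e^T) eu mul_scalar_mx.
rewrite -scalemxAr.
set M := u *m e^T.
have -> : M - (v i 0)^-1 *: ((v i 0 - 1) *: M) = (v i 0)^-1 *: M.
  by rewrite scalerA -{1}[M]scale1r -scalerBl mulrBr mulVr // mulr1 subKr.
by rewrite subrK.
Qed.

Lemma det_diag_at n (i : 'I_n) (c : {poly K}) :
  \det (diag_mx (\row_j (if j == i then c else 1))) = c.
Proof.
rewrite det_diag (bigD1 i) //= mxE eqxx big1 ?mulr1 // => j ji.
by rewrite mxE (negPf ji).
Qed.

Lemma adm_const_change n m (C H : 'M[{poly K}]_n) (E : 'M[K]_n) : E \in unitmx ->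
  admissible m C H ->
  admissible m (map_mx polyC (invmx E) *m C *m map_mx polyC E)
    (map_mx polyC (E^t*) *m H *m map_mx polyC E).
Proof.
move=> uE adm; have uE' : (E^t*) \in unitmx by rewrite ctmx_unit.
apply: (adm_basis_change (D := map_mx polyC (invmx E)) adm).
- by rewrite det_map_mx polyC_eq0 -unitfE -unitmxE unitmx_inv.
- by rewrite -!mulmxA -map_mxM mulmxV // map_mx1 mulmx1.
move=> p p1; rewrite !evmxM !evmxC -!mulmxA mulmxV // mulmx1 mulmxA -ctmxM mulmxV //.
by rewrite trmx1 map_mx1 mul1mx.
Qed.

Lemma char_poly_const_change n (C : 'M[{poly K}]_n) (E : 'M[K]_n) : E \in unitmx ->
  char_poly (map_mx polyC (invmx E) *m C *m map_mx polyC E) = char_poly C.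
Proof.
move=> uE; apply: (@char_poly_basis_change _ _ _ _ (map_mx polyC (invmx E))).
  by rewrite det_map_mx polyC_eq0 -unitfE -unitmxE unitmx_inv.
by rewrite -!mulmxA -map_mxM mulmxV // map_mx1 mulmx1.
Qed.

Lemma det_const_change n (H : 'M[{poly K}]_n) (E : 'M[K]_n) :
  E \in unitmx ->
  exists2 e : K, e != 0 & \det (map_mx polyC (E^t*) *m H *m map_mx polyC E) = e *: \det H.
Proof.
rewrite unitmxE unitfE => dE; exists (`|\det E| ^+ 2).
  by apply: expf_neq0; rewrite normr_eq0.
rewrite !det_mulmx !det_map_mx det_tr mulrAC -polyCM mul_polyC normCK mulrC.
by [].
Qed.

(** Column [i] of H vanishes at a, hence by reflection row [i] vanishes at 1 / conj a. Dividing the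
    column by X - a and the row by 1 - conj a X is a congruence, since 1 - conj a p = p conj(p - a)
    on the circle; the extra p is compensated by the X put into the row, which keeps [m]. The
    hypothesis on [C] keeps the conjugated matrix polynomial. In the determinant the two zeros are
    traded for one zero at 0. *)
Lemma adm_divide n m (C H : 'M[{poly K}]_n) (a : K) (i : 'I_n) :
    admissible m C H -> a != 0 ->
    (forall j, root (H j i) a) -> (forall j, j != i -> root (C j i) a) ->
  exists C' H' : 'M[{poly K}]_n, [/\ admissible m C' H', char_poly C' = char_poly C
    & ('X - a%:P) * (1 - a^* *: 'X) * \det H' = 'X * \det H].
Proof.
move=> adm a0 Ha Ca.
pose d : {poly K} := 'X - a%:P; pose r : {poly K} := 1 - a^* *: 'X.
have d0 : d != 0 by rewrite polyXsubC_eq0.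
have ac0 : a^* != 0 by rewrite conjC_eq0.
have Er : r = - a^* *: ('X - a^*^-1%:P).
  by rewrite scalerBr scaleNr addrC scaleNr opprK -mul_polyC -polyCM mulfV.
have r0 : r != 0 by rewrite Er scaler_eq0 oppr_eq0 (negPf ac0) polyXsubC_eq0.
have Hr k : r %| H i k.
  rewrite Er dvdpZl ?oppr_eq0 // dvdp_XsubCl /root.
  have /matrixP/(_ i k) := adm_reflect adm (invr_neq0 ac0).
  rewrite [RHS]mxE ctmxE !evmxE => ->; rewrite fmorphV /= conjCK invrK.
  by rewrite (rootP (Ha k)) conjC0 mulr0.
have Hd j : d %| H j i by rewrite dvdp_XsubCl.
have Cd j : j != i -> d %| C j i by move=> ji; rewrite dvdp_XsubCl Ca.
have Hdr : d * r %| H i i.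
  (* If |a| = 1 the two divisors agree up to a scalar, and positivity has to supply a double zero of
     the diagonal entry. *)
  have [a1|a1] := eqVneq `|a| 1.
    have -> : d * r = - a^* *: (d ^+ 2).
      by rewrite Er (conj_circle a1) invrK -scalerAr expr2.
    rewrite dvdpZl ?oppr_eq0 //; apply: (circle_double_root (m := m) a1) => // p p1.
    have := adm_psd adm p1 (delta_mx i 0); rewrite herm_form_delta mxE evmxE //.
  rewrite Gauss_dvdp ?Hd ?Hr // Er coprimepZr ?oppr_eq0 // coprimep_XsubC2 //.
  rewrite subr_eq0; apply: contra a1 => /eqP/(congr1 (fun x => x * a^*)).
  by rewrite mulVf // => E; rewrite -(@pexpr_eq1 _ _ 2) // normCK -E.
pose C' : 'M[{poly K}]_n := \matrix_(j, k) (if j == i then (if k == i then C i i else d * C i k)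
  else if k == i then C j i %/ d else C j k).
pose H' : 'M[{poly K}]_n := \matrix_(j, k) (if k == i then
    (if j == i then 'X * (H i i %/ (d * r)) else H j i %/ d)
  else if j == i then 'X * (H i k %/ r) else H j k).
pose D := diag_mx (\row_j (if j == i then d else 1)) : 'M[{poly K}]_n.
pose Dr := diag_mx (\row_j (if j == i then r else 1)) : 'M[{poly K}]_n.
pose DX := diag_mx (\row_j (if j == i then 'X else 1)) : 'M[{poly K}]_n.
have DC : D *m C = C' *m D.
  rewrite mul_diag_mx mul_mx_diag; apply/matrixP=> j k; rewrite !mxE.
  have [-> |ji] := eqVneq j i; have [-> |ki] := eqVneq k i; rewrite ?mul1r ?mulr1 //.
    by rewrite mulrC.
  by rewrite divpK // Cd.
have DH : Dr *m H' *m D = DX *m H.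
  rewrite mul_mx_diag !mul_diag_mx; apply/matrixP=> j k; rewrite !mxE.
  have [-> |ji] := eqVneq j i; have [-> |ki] := eqVneq k i; rewrite ?mul1r ?mulr1 //.
  - by rewrite -[in RHS](divpK Hdr); ring.
  - by rewrite -[in RHS](divpK (Hr k)); ring.
  - by rewrite divpK.
have detD : \det D = d by exact: det_diag_at.
have dD0 : \det D != 0 by rewrite detD.
exists C', H'; split.
- apply: (adm_basis_change adm dD0 DC) => p p1; have p0 := circle_neq0 p1.
  have EX : evmx p Dr = evmx p DX *m (evmx p D)^t*.
    apply/matrixP=> j k; rewrite evmxE [RHS]mxE (bigD1 j) //= big1 => [|l lj]; last first.
      by rewrite evmxE mxE [j == l]eq_sym (negPf lj) mulr0n horner0 mul0r.
    rewrite ctmxE !evmxE !mxE eqxx.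
    have [-> |jk] := eqVneq j k; last first.
      rewrite !mulr0n !horner0 conjC0 mulr0 addr0 //.
    rewrite !mulr1n addr0; have [_|_] := eqVneq k i; last by rewrite -polyC1 !hornerC conjC1 mulr1.
    by rewrite hornerX /r /d !hornerE rmorphB /= (conj_circle p1) mulrBr mulfV // mulrC.
  have uX : evmx p DX \in unitmx by rewrite evmx_unit det_diag_at hornerX.
  apply: (can_inj (mulKmx uX)); rewrite !mulmxA -EX -!evmxM DH //.
- exact: char_poly_basis_change dD0 DC.
have := congr1 determinant DH; rewrite !det_mulmx !det_diag_at => <-.
by rewrite -/d -/r; ring.
Qed.

Lemma adm_saturate n m (C H : 'M[{poly K}]_n) : admissible m C H ->
  exists C' H' : 'M[{poly K}]_n, [/\ admissible m C' H', char_poly C' = char_poly C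
    & exists c k, \det H' = c *: 'X^k].
Proof.
(* [r] carries the zeros still to be removed; a zero at 0 has no finite mirror image and moves into
   the power of X. *)
suff IH N : forall (C H : 'M[{poly K}]_n) k (r : {poly K}), (size r <= N)%N ->
    \det H = 'X^k * r -> admissible m C H ->
  exists C' H' : 'M[{poly K}]_n, [/\ admissible m C' H', char_poly C' = char_poly C
    & exists c k, \det H' = c *: 'X^k].
  by apply: (IH (size (\det H)) C H 0 (\det H)) => //; rewrite expr0 mul1r.
elim: N => [|N IHN] {}C {}H k r.
  rewrite leqn0 size_poly_eq0 => /eqP-> E adm; have := adm_det adm.
  by rewrite E mulr0 eqxx.
move=> szr Edet adm.
have [sr1|sr1] := eqVneq (size r) 1%N.
  exists C, H; split=> //; have /size_poly1P[c _ Ec] : size r == 1%N by rewrite sr1.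
  by exists c, k; rewrite Edet Ec mulrC mul_polyC.
have [a ra] := closed_rootP _ sr1.
have [a0|a0] := eqVneq a 0.
  have /factor_theorem[r' Er] := ra; rewrite a0 subr0 in Er.
  apply: (IHN C H k.+1 r') => //; last by rewrite Edet Er exprSr; ring.
  have r'0 : r' != 0.
    by apply: contraTneq (adm_det adm) => r'0; rewrite Edet Er r'0 mul0r mulr0 eqxx.
  by move: szr; rewrite Er size_mulX.
have dHa : \det (evmx a H) = 0 by rewrite det_evmx Edet hornerM (rootP ra) mulr0.
have [v0 v0_neq0 Hv0] := det_eq0_kernel dHa.
(* Choosing in the kernel of H(a) an eigenvector of C(a) makes column [i] of the new C vanish at a
   off the diagonal. *)
have [v [c [Hv v_neq0 Cv]]] := @stable_eigenvector _ (evmx a C) (fun u => evmx a H *m u = 0) v0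
  (ltac:(by move=> u c Hu /=; rewrite mulmxBr -scalemxAr Hu scaler0 subr0 mulmxA
           (adm_reflectM adm a0) -scalemxAl -mulmxA Hu mulmx0 scaler0)) Hv0 v0_neq0.
have /existsP[i vi] : [exists i, v i 0 != 0].
  apply: contraNT v_neq0; rewrite negb_exists => /forallP h.
  by apply/eqP/matrixP=> j k'; rewrite ord1 mxE; apply/eqP; rewrite -[_ == _]negbK h.
have uvi : v i 0 \is a GRing.unit by rewrite unitfE.
have [E uE [Ev _]] := unitmx_with_column uvi.
have adm1 := adm_const_change uE adm.
set C1 := (X in admissible m X) in adm1; set H1 := (X in admissible _ _ X) in adm1.
have H1a j : root (H1 j i) a.
  rewrite /root -evmxE; have -> : evmx a H1 j i = (evmx a H1 *m (delta_mx i 0 : 'cV_n)) j 0.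
    by rewrite -colE [RHS]mxE.
  by rewrite /H1 !evmxM !evmxC -!mulmxA Ev Hv mulmx0 mxE.
have C1a j : j != i -> root (C1 j i) a.
  move=> ji; rewrite /root -evmxE; have -> : evmx a C1 j i = (evmx a C1 *m (delta_mx i 0 : 'cV_n)) j 0.
    by rewrite -colE [RHS]mxE.
  rewrite /C1 !evmxM !evmxC -!mulmxA Ev Cv -scalemxAr -{1}Ev mulKmx // !mxE.
  by rewrite (negPf ji) mulr0.
have [C2 [H2 [adm2]]] := adm_divide adm1 a0 H1a C1a.
rewrite (char_poly_const_change C uE) => E2 D2; move: E2.
have [e e0 Ee] : exists2 e, e != 0 & \det H1 = e *: \det H := det_const_change H uE.
rewrite Ee Edet in D2.
have r_neq0 : r != 0.
  by apply: contraTneq (adm_det adm) => r0; rewrite Edet r0 mulr0 eqxx.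
have ac0 : a^* != 0 by rewrite conjC_eq0.
set q := 1 - a^* *: 'X in D2.
have Eq : q = - a^* *: ('X - a^*^-1%:P).
  by rewrite scalerBr scaleNr addrC scaleNr opprK -mul_polyC -polyCM mulfV.
have sq : size q = 2 by rewrite Eq size_scale ?oppr_eq0 // size_XsubC.
have dvdr : ('X - a%:P) * q %| r.
  have : ('X - a%:P) * q %| 'X^(k.+1) * r.
    rewrite -(@dvdpZr _ e) // exprS -mulrA scalerAr -D2 dvdp_mulIl //.
  rewrite Gauss_dvdpr //; apply: coprimep_expr.
  have -> : 'X = 'X - 0%:P :> {poly K} by rewrite subr0.
  rewrite coprimep_XsubC /root Eq hornerM hornerZ !hornerXsubC !sub0r !mulf_eq0 !oppr_eq0.
  by rewrite polyC0 subr0 hornerXsubC sub0r oppr_eq0 invr_eq0 (negPf a0) (negPf ac0).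
have [r' Er'] := dvdpP _ _ dvdr.
have Hdq : ('X - a%:P) * q != 0.
  by rewrite mulf_neq0 ?polyXsubC_eq0 // -size_poly_eq0 sq.
have Edet2 : \det H2 = 'X^(k.+1) * (e *: r').
  apply: (mulfI Hdq); rewrite D2 Er' exprS -!mul_polyC; ring.
move=> E2; suff szr' : (size (e *: r')%R <= N)%N.
  have [C3 [H3 [adm3 E3 D3]]] := IHN C2 H2 k.+1 (e *: r') szr' Edet2 adm2.
  by exists C3, H3; split; [exact: adm3 | rewrite E3 | exact: D3].
clear E2 Ee D2 Edet2 Edet dHa.
have r'0 : r' != 0 by apply: contraNneq r_neq0 => r'0; rewrite Er' r'0 mul0r.
rewrite size_scale // -ltnS; apply: leq_trans szr.
rewrite Er' size_mul // size_mul ?polyXsubC_eq0 //; last by rewrite -size_poly_eq0 sq.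
by rewrite size_XsubC sq /= addnS /= addnS ltnS leq_addr.
Qed.

End Saturation.

(** * Column reduction of polynomial matrices *)

Section ColumnReduction.
Variables (K : numClosedFieldType).

Lemma coef_prod_top (I : Type) (r : seq I) (f : I -> {poly K}) (d : I -> nat) :
    (forall i, (size (f i) <= (d i).+1)%N) ->
  (size (\prod_(i <- r) f i)%R <= (\sum_(i <- r) d i).+1)%N /\
  (\prod_(i <- r) f i)`_(\sum_(i <- r) d i) = \prod_(i <- r) (f i)`_(d i).
Proof.
move=> sf; elim: r => [|i r [IHs IHc]]; first by rewrite !big_nil size_poly1 coef1.
rewrite !big_cons; split.
  apply: leq_trans (size_polyMleq _ _) _; rewrite -ltnS.
  have := leq_add (sf i) IHs; rewrite addSn addnS.
  by case: (size _ + size _)%N.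
rewrite coefM (bigD1 (inord (d i))) //=.
rewrite inordK ?ltnS ?leq_addr // addKn IHc [X in _ + X]big1 ?addr0 // => j.
rewrite -val_eqE /= inordK ?ltnS ?leq_addr // => jd.
have [ltj|gej] := ltnP (d i) j.
  by rewrite nth_default ?mul0r //; apply: leq_trans (sf i) _.
rewrite [X in _ * X]nth_default ?mulr0 //; apply: leq_trans IHs _.
by rewrite ltn_subRL ltn_add2r ltn_neqAle jd gej.
Qed.

(** [k] only bounds the column degrees; the determinant of leading coefficients detects whether det
    A has the full degree. *)
Lemma det_top_coef n (A : 'M[{poly K}]_n) (k : 'I_n -> nat) :
    (forall i j, (size (A i j) <= (k j).+1)%N) ->
  (size (\det A) <= (\sum_j k j).+1)%N /\
  (\det A)`_(\sum_j k j) = \det (\matrix_(i, j) (A i j)`_(k j)).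
Proof.
move=> sA.
have Hs (s : {perm 'I_n}) : (size (\prod_i A i (s i))%R <= (\sum_j k j).+1)%N /\
    (\prod_i A i (s i))`_(\sum_j k j) = \prod_i (A i (s i))`_(k (s i)).
  have -> : (\sum_j k j = \sum_i k (s i))%N by exact: (reindex_inj (@perm_inj _ s)).
  exact: coef_prod_top.
split.
  apply: leq_trans (size_sum _ _ _) _; apply/bigmax_leqP => s _.
  by rewrite -signr_odd size_Msign; case: (Hs s).
rewrite /determinant coef_sum; apply: eq_bigr => s _.
have Es : \prod_i (A i (s i))`_(k (s i)) =
    \prod_i (\matrix_(i, j) (A i j)`_(k j)) i (s i) by apply: eq_bigr => i _; rewrite mxE.
rewrite -Es -(Hs s).2; case: (odd_perm s); first by rewrite expr1 !mulN1r coefN.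
by rewrite expr0 !mul1r.
Qed.

(** A kernel vector u of the leading matrix is a relation between top coefficients. Let j0 have the
    largest bound in the support of u: replacing column j0 by the sum of the columns weighted by u_j
    X^(k j0 - k j) cancels its top coefficients. The step is unimodular because u_j0 is a nonzero
    constant. *)
Lemma column_step n (A : 'M[{poly K}]_n) (k : 'I_n -> nat) : \det A != 0 ->
    (forall i j, (size (A i j) <= (k j).+1)%N) ->
    \det (\matrix_(i, j) (A i j)`_(k j)) = 0 ->
  exists2 E : 'M[{poly K}]_n, E \in unitmx & exists2 k' : 'I_n -> nat,
    (forall i j, (size ((A *m E) i j) <= (k' j).+1)%N) & (\sum_j k' j < \sum_j k j)%N.
Proof.
move=> dA sA /det_eq0_kernel[u u0 Lu].
have /existsP[j1 uj1] : [exists j, u j 0 != 0].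
  apply: contraNT u0; rewrite negb_exists => /forallP h.
  by apply/eqP/matrixP=> j l; rewrite ord1 mxE; apply/eqP; rewrite -[_ == _]negbK h.
have [j0 uj0 maxj0] := @arg_maxnP _ j1 (fun j => u j 0 != 0) k uj1.
have maxj j : u j 0 != 0 -> (k j <= k j0)%N := maxj0 j.
pose v : 'cV[{poly K}]_n := \col_i ((u i 0)%:P * 'X^(k j0 - k i)).
have vj0 : v j0 0 \is a GRing.unit.
  by rewrite mxE subnn expr0 mulr1 poly_unitE size_polyC uj0 coefC /= unitfE.
have [E uE [Ev Ej]] := unitmx_with_column vj0.
have colE' j : j != j0 -> forall i, (A *m E) i j = A i j.
  move=> jj i; have := congr1 (fun M => (A *m M) i 0) (Ej j jj).
  by rewrite mulmxA -!colE [LHS]mxE [RHS]mxE.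
have colv i : (A *m E) i j0 = (A *m v) i 0 by rewrite -Ev mulmxA -colE [RHS]mxE.
have szv i : (size ((A *m v) i ord0) <= k j0)%N.
  have : (size ((A *m v) i ord0) <= (k j0).+1)%N.
    rewrite mxE; apply: leq_trans (size_sum _ _ _) _; apply/bigmax_leqP => j _.
    rewrite mxE mulrCA; have [->|uj] := eqVneq (u j 0) 0; first by rewrite mul0r size_poly0.
    rewrite mul_polyC; apply: leq_trans (size_scale_leq _ _) _.
    apply: leq_trans (size_polyMleq _ _) _; rewrite size_polyXn addnS /=.
    have := leq_add (sA i j) (leqnn (k j0 - k j)).
    by rewrite addSn subnKC // maxj.
  rewrite leq_eqVlt => /orP[/eqP sz|//].
  have : (A *m v) i 0 != 0 by rewrite -size_poly_eq0 sz.
  rewrite -lead_coef_eq0 lead_coefE sz /= => /eqP; case.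
  have Lu0 : \sum_j (A i j)`_(k j) * u j 0 = 0.
    have /matrixP/(_ i ord0) := Lu; rewrite !mxE => Lu0; rewrite -[RHS]Lu0.
    by apply: eq_bigr => j _; rewrite mxE.
  rewrite -[RHS]Lu0 mxE coef_sum.
  apply: eq_bigr => j _; rewrite !mxE mulrCA coefCM mulrC.
  have [->|uj] := eqVneq (u j 0) 0; first by rewrite !mulr0.
  by rewrite coefMXn ltnNge leq_subr /= subKn // maxj.
have k0 : (0 < k j0)%N.
  rewrite lt0n; apply: contraNneq (mulf_neq0 dA (_ : \det E != 0)) => [kj0|]; last first.
    by apply: contraTneq uE => dE; rewrite unitmxE dE unitr0.
  rewrite -det_mulmx; apply/eqP.
  rewrite -det_tr; apply/eqP/det0P; exists (delta_mx 0 j0).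
    by apply/eqP => /matrixP/(_ 0 j0)/eqP; rewrite !mxE !eqxx oner_eq0.
  apply/rowP => i; rewrite -rowE !mxE; apply/eqP.
  by have := szv i; rewrite -colv kj0 leqn0 size_poly_eq0 mxE.
exists E => //; exists (fun j => if j == j0 then (k j0).-1 else k j) => [i j|].
  have [->|jj] := eqVneq j j0; last by rewrite colE'.
  by rewrite prednK // colv.
rewrite (bigD1 j0) //= [X in (_ < X)%N](bigD1 j0) //= eqxx.
rewrite (eq_bigr k) => [|j /negPf -> //].
by rewrite ltn_add2r prednK.
Qed.

(** Each column step lowers the sum of the bounds; when none is possible the leading matrix is
    invertible and the determinant has the full degree. *)
Lemma column_reduction n (A : 'M[{poly K}]_n) : \det A != 0 ->
  exists2 N : 'M[{poly K}]_n, N \in unitmx & exists k : 'I_n -> nat,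
    (forall i j, (size ((A *m N) i j) <= (k j).+1)%N) /\ size (\det A) = (\sum_j k j).+1.
Proof.
move=> dA; pose k0 (j : 'I_n) := \max_i size (A i j).
have sk0 i j : (size (A i j) <= (k0 j).+1)%N.
  by apply: leqW; exact: (@leq_bigmax _ (fun i => size (A i j))).
have [s Es] : exists s, (\sum_j k0 j < s)%N by eexists; exact: leqnn.
elim: s A k0 dA sk0 Es => [//|s IHs] A k dA sk Es.
have [szd cd] := det_top_coef sk.
have [L0|L0] := eqVneq (\det (\matrix_(i, j) (A i j)`_(k j))) 0; last first.
  exists 1%:M; [exact: unitmx1 | exists k; split; first by move=> i j; rewrite mulmx1].
  apply/eqP; rewrite eqn_leq szd /= ltnNge; move: L0; rewrite -cd; apply: contra => le_s.
  by rewrite nth_default.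
have [E uE [k' sk' lt_k']] := column_step dA sk L0.
have dAE : \det (A *m E) != 0.
  rewrite det_mulmx mulf_neq0 //.
  by apply: contraTneq uE => dE; rewrite unitmxE dE unitr0.
have [N uN [k'' [sk'' sd]]] := IHs _ _ dAE sk' (leq_trans lt_k' Es).
exists (E *m N); first by rewrite unitmx_mul uE.
exists k''; split; first by move=> i j; rewrite mulmxA.
rewrite -sd det_mulmx; move: uE; rewrite unitmxE poly_unitE => /andP[/eqP].
by move/eqP/size_poly1P => [c c0 ->] _; rewrite mulrC mul_polyC size_scale.
Qed.

End ColumnReduction.

(** * From a positive form with monomial determinant to a linear pencil *)

Section Realization.
Variables (K : numClosedFieldType).

Definition pencil_mx n (F : 'M[K]_n) : 'M[{poly K}]_n :=
  map_mx polyC (F^t*) + 'X *: map_mx polyC F.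

Lemma det_ctmx n (A : 'M[K]_n) : \det (A^t*) = (\det A)^*.
Proof. by rewrite det_map_mx det_tr. Qed.

(** On the circle det H = p^(2 m n) conj(det H); for a monomial this reads 2 k = 2 m n. *)
Lemma adm_det_degree n m (C H : 'M[{poly K}]_n) c k :
  admissible m C H -> \det H = c *: 'X^k -> k = (m * n)%N.
Proof.
move=> adm Edet.
have c0 : c != 0.
  by have := adm_det adm; rewrite Edet scaler_eq0 negb_or => /andP[].
have E : c *: 'X^(k + k) = c^* *: 'X^((m + m) * n).
  apply: (@circle_poly_eq _ _ _ 1) => [|a a1 _]; first exact: oner_neq0.
  have a0 := circle_neq0 a1; rewrite !hornerZ !hornerXn exprD mulrA.
  have <- : (\det H).[a] = c * a ^+ k by rewrite Edet hornerZ hornerXn.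
  rewrite -det_evmx (adm_reflect adm a0) detZ det_ctmx det_evmx Edet hornerZ hornerXn.
  rewrite rmorphM rmorphXn fmorphV /= conjCK -exprM exprVn; field.
  by rewrite expf_neq0.
have := congr1 (fun p : {poly K} => size p) E.
rewrite /= !size_scale ?conjC_eq0 // !size_polyXn => -[].
by rewrite addnn mulnDl addnn => /double_inj.
Qed.

Lemma unit_poly_evmx n (N : 'M[{poly K}]_n) z : N \in unitmx -> evmx z N \in unitmx.
Proof.
rewrite evmx_unit unitmxE poly_unitE => /andP[/eqP s1].
have /size1_polyC -> : (size (\det N) <= 1)%N by rewrite s1.
by rewrite hornerC coefC /= unitfE.
Qed.

(** Let f be column j of N. If H f had degree below m, the real function p^-m f^t* H f would have as
    conjugate a polynomial divisible by X; a polynomial that is real on the circle is constant, so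
    it is 0. Where H is invertible, positivity then gives f = 0, against the invertibility of N. *)
Lemma adm_column_degree n m (C H N : 'M[{poly K}]_n) j : admissible m C H ->
  N \in unitmx -> ~ (forall i, (size ((H *m N) i j) <= m)%N).
Proof.
move=> adm uN szM; have [z1 z11 Hz1] := circle_nonroot (adm_det adm).
case: m adm szM => [|m] adm szM.
  suff : evmx z1 (H *m N) *m (delta_mx j 0 : 'cV_n) = 0.
    have uHN : evmx z1 (H *m N) \in unitmx.
      by rewrite evmxM unitmx_mul evmx_unit Hz1 unit_poly_evmx.
    move/(congr1 (mulmx (invmx (evmx z1 (H *m N))))); rewrite mulKmx // mulmx0.
    by move/matrixP/(_ j 0)/eqP; rewrite !mxE !eqxx oner_eq0.
  apply/matrixP=> i k; rewrite -colE mxE evmxE [RHS]mxE.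
  by have := szM i; rewrite leqn0 size_poly_eq0 => /eqP ->; rewrite horner0.
pose b := \sum_i N i j * conj_rev m ((H *m N) i j).
pose f z : 'cV_n := evmx z N *m delta_mx j 0.
have fE z i : f z i 0 = (N i j).[z] by rewrite /f -colE mxE evmxE.
have yb z : `|z| = 1 -> (herm_form (z ^- m.+1 *: evmx z H) (f z) (f z))^* = ('X * b).[z].
  move=> z1'; have z0 := circle_neq0 z1'.
  rewrite /herm_form -scalemxAr -scalemxAl mxE rmorphM fmorphV rmorphXn /= (conj_circle z1').
  rewrite exprVn invrK hornerM hornerX exprS -mulrA; congr (_ * _).
  rewrite -mulmxA {2}/f (mulmxA (evmx z H)) -evmxM mxE rmorph_sum horner_sum mulr_sumr /=.
  apply: eq_bigr => i _; rewrite rmorphM ctmxE /= conjCK fE hornerM mulrCA; congr (_ * _).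
  rewrite (horner_conj_rev (szM i) z0) (conj_circle z1') invrK.
  by rewrite -colE mxE evmxE.
have b_real z : `|z| = 1 -> ('X * b).[z] = z ^+ 0 * (('X * b).[z])^*.
  move=> z1'; rewrite expr0 mul1r -(yb _ z1') conjCK.
  by apply/CrealP/ger0_real/(adm_psd adm z1').
have b0 : b = 0.
  have := circle_size b_real; have [//|b0] := eqVneq b 0.
  by rewrite mulrC size_mulX // ltnS leqn0 size_poly_eq0 (negPf b0).
have := yb _ z11; rewrite b0 mulr0 horner0 => /eqP; rewrite conjC_eq0 => /eqP y0.
have := psd_ker (adm_psd adm z11) y0; rewrite -scalemxAl => /eqP; rewrite scaler_eq0.
rewrite invr_eq0 expf_eq0 (negPf (circle_neq0 z11)) andbF /= => /eqP.
have uH : evmx z1 H \in unitmx by rewrite evmx_unit.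
move/(congr1 (mulmx (invmx (evmx z1 H)))); rewrite mulKmx // mulmx0 /f.
move/(congr1 (mulmx (invmx (evmx z1 N)))); rewrite mulKmx ?unit_poly_evmx // mulmx0.
by move/matrixP/(_ j 0)/eqP; rewrite !mxE !eqxx oner_eq0.
Qed.

(** The column degrees are at least m and add up to m n, the degree of det H, so all equal m. Each
    entry of p^-m N^t* H N is then the conjugate of a polynomial and, by Hermitian symmetry, also a
    polynomial, hence constant. *)
Lemma adm_constant n m (C H : 'M[{poly K}]_n) c k :
    admissible m C H -> \det H = c *: 'X^k ->
  exists2 N : 'M[{poly K}]_n, N \in unitmx & exists2 G : 'M[K]_n, psd G &
    forall z, `|z| = 1 -> z ^- m *: ((evmx z N)^t* *m evmx z H *m evmx z N) = G.
Proof.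
move=> adm Edet; have Ek := adm_det_degree adm Edet.
have [N uN [k' [sk' sd]]] := column_reduction (adm_det adm).
have c0 : c != 0.
  by have := adm_det adm; rewrite Edet scaler_eq0 negb_or => /andP[].
have le_k' j : (m <= k' j)%N.
  rewrite leqNgt; apply/negP => lt_j; case: (adm_column_degree (j := j) adm uN) => i.
  exact: leq_trans (sk' i j) lt_j.
have k'E j : k' j = m.
  move: sd; rewrite Edet size_scale // size_polyXn Ek => -[].
  have -> : (\sum_j k' j = m * n + \sum_j (k' j - m))%N.
    have -> : (m * n = \sum_(j < n) m)%N by rewrite sum_nat_const card_ord mulnC.
    rewrite -big_split /=.
    by apply: eq_bigr => i _; rewrite subnKC.
  move/eqP; rewrite -{1}[(m * n)%N]addn0 eqn_add2l eq_sym sum_nat_eq0 => /forallP/(_ j) /=.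
  by move=> h; apply/eqP; rewrite eqn_leq le_k' andbT -subn_eq0.
have szM i j : (size ((H *m N) i j) <= m.+1)%N by rewrite -(k'E j).
pose B : 'M[{poly K}]_n := \matrix_(l, j) \sum_i N i l * conj_rev m ((H *m N) i j).
pose G z := z ^- m *: ((evmx z N)^t* *m evmx z H *m evmx z N).
have pG z : `|z| = 1 -> psd (G z).
  by move=> z1; rewrite /G scalemxAl scalemxAr; apply/psd_congr/(adm_psd adm z1).
have GB z l j : `|z| = 1 -> (G z l j)^* = (B l j).[z].
  move=> z1; have z0 := circle_neq0 z1.
  rewrite /G mxE rmorphM fmorphV rmorphXn /= (conj_circle z1) exprVn invrK.
  rewrite -mulmxA -evmxM !mxE rmorph_sum horner_sum mulr_sumr /=.
  apply: eq_bigr => i _; rewrite rmorphM ctmxE /= conjCK evmxE hornerM mulrCA; congr (_ * _).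
  rewrite (horner_conj_rev (szM i j) z0) (conj_circle z1) invrK.
  by rewrite evmxE.
have GB' z l j : `|z| = 1 -> G z l j = (B j l).[z].
  by move=> z1; rewrite -(GB _ _ _ z1) -[in LHS](psd_herm (pG z z1)) ctmxE.
have szB l j : (size (B l j) <= 1)%N.
  apply: (@circle_size _ _ (B j l)) => z z1.
  by rewrite expr0 mul1r -(GB _ _ _ z1) (GB' _ _ _ z1) .
exists N => //; exists (G 1); first by apply: pG; rewrite normr1.
move=> z z1; rewrite -/(G z); apply/matrixP=> l j; rewrite !GB' ?normr1 //.
by rewrite (size1_polyC (szB _ _)) !hornerC.
Qed.

(** For the constant form G the relation says that G C' is p times its adjoint on the circle. This
    leaves only degrees 0 and 1, G C' = B^t* + X B; writing G = S^t* S and changing basis by S gives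
    F^t* + X F. *)
Lemma adm_pencil n m (C H : 'M[{poly K}]_n) c k :
    admissible m C H -> \det H = c *: 'X^k ->
  exists F : 'M[K]_n, char_poly (pencil_mx F) = char_poly C.
Proof.
move=> adm Edet; have [N uN [G pG GE]] := adm_constant adm Edet.
have [S ES] := psd_sqrt pG; have hG := psd_herm pG.
have uG : G \in unitmx.
  have [z z1 Hz] := circle_nonroot (adm_det adm).
  rewrite -(GE _ z1) unitmxZ ?unitfE ?invr_eq0 ?expf_neq0 ?circle_neq0 //.
  by rewrite !unitmx_mul ctmx_unit unit_poly_evmx // evmx_unit Hz.
have uS : S \in unitmx by move: uG; rewrite ES unitmx_mul => /andP[].
have uS' : S^t* \in unitmx by rewrite ctmx_unit.
pose C' := invmx N *m C *m N.
have NC : invmx N *m C = C' *m invmx N by rewrite /C' -mulmxA mulmxV // mulmx1.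
have CN : N *m C' = C *m N by rewrite /C' !mulmxA mulmxV // mul1mx.
have self z : `|z| = 1 -> G *m evmx z C' = z *: ((G *m evmx z C')^t*).
  move=> z1; have z0 := circle_neq0 z1.
  have E : z ^+ m *: (G *m evmx z C') = (evmx z N)^t* *m evmx z (H *m C) *m evmx z N.
    rewrite -(GE _ z1) -scalemxAl scalerA mulfV ?expf_neq0 // scale1r.
    by rewrite -!mulmxA -!evmxM -!mulmxA -CN !mulmxA.
  have := E; rewrite (adm_comm adm z1) -scalemxAr -scalemxAl.
  have -> : (evmx z N)^t* *m (evmx z (H *m C))^t* *m evmx z N = (z ^+ m *: (G *m evmx z C'))^t*.
    by rewrite E !ctmxM trmxCK mulmxA.
  rewrite ctmxZ rmorphXn /= (conj_circle z1) exprVn scalerA.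
  move/(congr1 (fun A => z ^- m *: A)); rewrite !scalerA mulVf ?expf_neq0 // scale1r => E2; rewrite {1}E2.
  by congr (_ *: _); rewrite exprS exprD; field; rewrite expf_neq0.
pose P := map_mx polyC G *m C'.
have PE z : evmx z P = G *m evmx z C' by rewrite evmxM evmxC.
have selfP i j z : `|z| = 1 -> (P i j).[z] = z ^+ 1 * ((P j i).[z])^*.
  move=> z1; have /matrixP/(_ i j) := self z z1.
  by rewrite -PE [RHS]mxE ctmxE !evmxE expr1.
have szP i j : (size (P i j) <= 2)%N by exact: circle_size (selfP i j).
pose B : 'M[K]_n := \matrix_(i, j) (P i j)`_1.
have PB : P = map_mx polyC (B^t*) + 'X *: map_mx polyC B.
  apply/matrixP=> i j; apply: (@circle_poly_eq _ _ _ 1) => [|z z1 _]; first exact: oner_neq0.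
  have P2 l t : (P l t).[z] = (P l t)`_0 + (P l t)`_1 * z.
    by rewrite (horner_coef_wide _ (szP l t)) !big_ord_recl big_ord0 /= mulr1 addr0 expr1.
  have coef_self l t : (P l t)`_0 = ((P t l)`_1)^*.
    suff /(congr1 (fun p : {poly K} => p`_0)) :
        P l t = (((P t l)`_1)^*)%:P + (((P t l)`_0)^*)%:P * 'X.
      by rewrite coefD coefC coefMX addr0.
    apply: (@circle_poly_eq _ _ _ 1) => [|x x1 _]; first exact: oner_neq0.
    rewrite (selfP l t x x1) hornerD hornerM !hornerC hornerX.
    rewrite (horner_coef_wide _ (szP t l)) !big_ord_recl big_ord0 /= mulr1 addr0 expr1.
    rewrite rmorphD rmorphM /= (conj_circle x1); field; exact: circle_neq0.
  have BE l t : (P l t)`_1 = B l t by rewrite [RHS]mxE.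
  rewrite P2 coef_self !BE.
  rewrite [X in _ = X.[z]]mxE [X in _ = (X + _).[z]]mxE ctmxE.
  by rewrite [X in _ = (_ + X).[z]]mxE [X in _ = (_ + _ * X).[z]]mxE hornerD hornerC hornerM hornerX hornerC mulrC.
exists (invmx (S^t*) *m B *m invmx S).
have D0 : \det (map_mx polyC S) != 0 by rewrite det_map_mx polyC_eq0 -unitfE -unitmxE.
have dN : \det (invmx N) != 0.
  by apply: contraTneq uN => dN; rewrite -unitmx_inv unitmxE dN unitr0.
transitivity (char_poly C'); last by apply: char_poly_basis_change dN NC.
apply: (char_poly_basis_change D0); rewrite /pencil_mx !ctmxM.
have -> : (invmx (S^t*))^t* = invmx S.
  apply: (can_inj (mulKmx uS)); rewrite mulmxV //.
  by rewrite -{1}[S]trmxCK -ctmxM mulVmx // trmx1 map_mx1.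
have -> : (invmx S)^t* = invmx (S^t*).
  by apply: (can_inj (mulKmx uS')); rewrite mulmxV // -ctmxM mulVmx // trmx1 map_mx1.
rewrite !mulmxA !(map_mxM polyC).
rewrite scalemxAl scalemxAr -mulmxDl -mulmxDr -PB.
rewrite -(mulmxA _ (map_mx polyC (invmx S))) -map_mxM mulVmx // map_mx1 mulmx1.
rewrite /P (mulmxA (map_mx polyC (invmx (S^t*)))) -map_mxM ES mulKmx //.
by rewrite /C' !mulmxA.
Qed.

End Realization.

(** * Power sums and polynomials in two variables *)

Section Newton.
Variable K : fieldType.
Implicit Types (r : seq K) (x z : K).

Lemma deriv_prod_XsubC r :
  (\prod_(x <- r) ('X - x%:P))^`() = \sum_(x <- r) (\prod_(y <- r) ('X - y%:P)) %/ ('X - x%:P).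
Proof.
elim: r => [|y r IHr]; first by rewrite !big_nil derivC.
rewrite !big_cons derivM derivXsubC mul1r [X in X %/ _]mulrC mulpK ?polyXsubC_eq0 //.
congr (_ + _); rewrite IHr mulr_sumr big_seq [RHS]big_seq; apply: eq_bigr => x xr.
by rewrite divp_mulA // dvdp_XsubCl root_prod_XsubC.
Qed.

Lemma log_deriv_prod_XsubC r z : z \notin r ->
  (\prod_(x <- r) ('X - x%:P))^`().[z] / (\prod_(x <- r) ('X - x%:P)).[z] =
  \sum_(x <- r) (z - x)^-1.
Proof.
move=> zr; rewrite deriv_prod_XsubC horner_sum mulr_suml big_seq [RHS]big_seq.
apply: eq_bigr => x xr; have zx : z - x != 0.
  by rewrite subr_eq0; apply: contraNneq zr => ->.
have P0 : (\prod_(y <- r) ('X - y%:P)).[z] != 0 by rewrite -/(root _ _) root_prod_XsubC.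
have dvdx : 'X - x%:P %| \prod_(y <- r) ('X - y%:P) by rewrite dvdp_XsubCl root_prod_XsubC.
move: P0; rewrite -{1 3}(divpK dvdx) hornerM hornerXsubC mulf_eq0 negb_or => /andP[h _].
by rewrite invfM mulrA mulfV // mul1r.
Qed.

Lemma coef_div_XsubC (p : {poly K}) x j N : root p x -> (size p <= N)%N ->
  (p %/ ('X - x%:P))`_j = \sum_(l < N) p`_(j + l).+1 * x ^+ l.
Proof.
move=> px sp; set q := p %/ _.
have Ep : p = q * ('X - x%:P) by rewrite divpK // dvdp_XsubCl.
have rec i : q`_i = p`_i.+1 + x * q`_i.+1.
  by rewrite Ep mulrBr coefB coefMX coefMC /= mulrC subrK.
have sum_rec M i : q`_i = \sum_(l < M) p`_(i + l).+1 * x ^+ l + x ^+ M * q`_(i + M).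
  elim: M => [|M IHM]; first by rewrite big_ord0 addn0 expr0 mul1r add0r.
  by rewrite IHM big_ord_recr /= rec addnS exprSr; ring.
rewrite (sum_rec N) [q`__]nth_default ?mulr0 ?addr0 //.
apply: leq_trans (leq_trans _ sp) (leq_addl _ _).
by rewrite size_divp ?polyXsubC_eq0 // leq_subr.
Qed.

(** Coefficient j - 1 of P' = sum_x P / (X - x); for j = 0 it says that P vanishes at its roots. The
    term l = 0 carries the number of roots. *)
Lemma newton_identity r j N : let P := \prod_(x <- r) ('X - x%:P) in (size P <= N)%N ->
  P`_j *+ j = \sum_(l < N) P`_(j + l) * \sum_(x <- r) x ^+ l.
Proof.
move=> P sP; case: j => [|j].
  rewrite mulr0n; under eq_bigr do rewrite mulr_sumr.
  rewrite exchange_big /= big_seq big1 // => x xr.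
  by rewrite -(horner_coef_wide x sP); apply/rootP; rewrite root_prod_XsubC.
rewrite -coef_deriv deriv_prod_XsubC coef_sum.
under [RHS]eq_bigr do rewrite mulr_sumr.
rewrite exchange_big /= big_seq [RHS]big_seq; apply: eq_bigr => x xr.
by rewrite (@coef_div_XsubC _ _ _ N) ?root_prod_XsubC.
Qed.

End Newton.

(** * Passing between coefficients and power sums in families *)

Section PowerSums.
Variable K : numClosedFieldType.
Implicit Types (q : {poly {poly K}}) (p x : K) (r : seq K).

Local Notation ev p := (map_poly (horner_eval p)).

Lemma coef_ev p q j : (ev p q)`_j = (q`_j).[p].
Proof. by rewrite coef_map. Qed.

Lemma size_prod_XsubC_seq r : size (\prod_(x <- r) ('X - x%:P)) = (size r).+1.
Proof. exact: size_prod_XsubC. Qed.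

Lemma lead_prod_XsubC r : (\prod_(x <- r) ('X - x%:P))`_(size r) = 1.
Proof.
have := monic_prod_XsubC r xpredT id; rewrite monicE lead_coefE size_prod_XsubC_seq /=.
by move/eqP.
Qed.

Lemma size_ev_monic q p : q \is monic -> size (ev p q) = size q.
Proof.
move=> mq; rewrite size_map_poly_id0 // (monicP mq) /horner_eval hornerC oner_neq0 //.
Qed.

Lemma monic_ev q p : q \is monic -> ev p q \is monic.
Proof. exact: monic_map. Qed.

(** For k <= n Newton's identity of index n - k is solved for the power sum of order k, whose factor
    is the leading coefficient 1; for k > n the relation q(x) = 0 times x^(k - n) gives a
    recursion. *)
Lemma power_sum_poly q : q \is monic -> forall k, exists f : {poly K}, forall p r,
  ev p q = \prod_(x <- r) ('X - x%:P) -> f.[p] = \sum_(x <- r) x ^+ k.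
Proof.
move=> mq; pose n := (size q).-1.
have sq : size q = n.+1 by rewrite prednK // lt0n size_poly_eq0 monic_neq0.
have szr p r : ev p q = \prod_(x <- r) ('X - x%:P) -> size r = n.
  by move/(congr1 (fun P : {poly K} => size P)); rewrite size_ev_monic // sq size_prod_XsubC_seq => -[].
elim/ltn_ind => k IHk.
have /choice[pi piP] : forall i, exists f : {poly K}, (i < k)%N -> forall p r,
    ev p q = \prod_(x <- r) ('X - x%:P) -> f.[p] = \sum_(x <- r) x ^+ i.
  move=> i.
  by have [/IHk[f Hf]|] := boolP (i < k)%N; [exists f | exists 0].
have qn : q`_n = 1 by move: mq; rewrite monicE lead_coefE => /eqP.
have [le_kn|lt_nk] := leqP k n.
  exists (q`_(n - k) *+ (n - k) - \sum_(l < n.+1 | l != k :> nat) q`_(n - k + l) * pi l) => p r Er.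
  have := @newton_identity _ r (n - k) n.+1; cbv zeta; rewrite -Er size_ev_monic // sq => /(_ (leqnn _)).
  have lt_k : (k < n.+1)%N by [].
  rewrite (bigD1 (Ordinal lt_k)) //= subnK // !coef_ev qn hornerC mul1r.
  move/esym/(canRL (addrK _)) ->.
  rewrite hornerD hornerN hornerMn horner_sum; congr (_ - _).
  apply: eq_bigr => l lk; rewrite hornerM coef_ev.
  have [lt_lk|lt_kl|El] := ltngtP l k; last by rewrite El eqxx in lk.
    by rewrite (piP _ lt_lk _ _ Er).
  by rewrite [q`__]nth_default ?horner0 ?mul0r // sq; lia.
exists (- \sum_(l < n) q`_l * pi (l + (k - n))%N) => p r Er.
have : \sum_(x <- r) x ^+ (k - n) * (\prod_(y <- r) ('X - y%:P)).[x] = 0.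
  rewrite big_seq big1 // => x xr; have /rootP -> : root (\prod_(y <- r) ('X - y%:P)) x.
    by rewrite root_prod_XsubC.
  by rewrite mulr0.
rewrite -Er.
have szq : (size (ev p q) <= n.+1)%N by rewrite size_ev_monic // sq.
under eq_bigr do rewrite (horner_coef_wide _ szq) mulr_sumr.
rewrite exchange_big /= big_ord_recr /= => /eqP; rewrite addrC addr_eq0 => /eqP E.
rewrite hornerN horner_sum.
transitivity (\sum_(x <- r) x ^+ (k - n) * ((ev p q)`_n * x ^+ n)).
  rewrite E; congr (- _); apply: eq_bigr => l _; rewrite hornerM.
  have lt_l : (l + (k - n) < k)%N.
    by rewrite -{2}(subnK (ltnW lt_nk)) addnC ltn_add2l.
  rewrite (piP _ lt_l _ _ Er) mulr_sumr; apply: eq_bigr => x _.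
  by rewrite coef_ev exprD; ring.
apply: eq_bigr => x _; rewrite coef_ev qn hornerC mul1r -exprD subnK //.
exact: ltnW.
Qed.

(* Newton's identities solved for the coefficients, by division by [k] in the
   coefficient of degree [n - k]. *)
Lemma poly_of_power_sums (D : K -> Prop) (r : K -> seq K) n :
    (forall p, D p -> size (r p) = n) ->
    (forall k, exists f : {poly K}, forall p, D p -> f.[p] = \sum_(x <- r p) x ^+ k) ->
  exists q, [/\ q \is monic, size q = n.+1
    & forall p, D p -> ev p q = \prod_(x <- r p) ('X - x%:P)].
Proof.
move=> sr /choice[pi piP].
pose P p := \prod_(x <- r p) ('X - x%:P).
have szP p : D p -> size (P p) = n.+1 by move=> Dp; rewrite size_prod_XsubC_seq sr.
have Pn p : D p -> (P p)`_n = 1 by move=> Dp; rewrite -(sr p Dp) lead_prod_XsubC.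
have coefP k : exists c : {poly K}, (k <= n)%N -> forall p, D p -> c.[p] = (P p)`_(n - k).
  elim/ltn_ind: k => k IHk.
  have [k0|k0] := posnP k.
    by exists 1 => _ p Dp; rewrite k0 subn0 Pn // hornerC.
  have /choice[c cP] : forall i, exists f : {poly K}, (i < k)%N -> (i <= n)%N ->
      forall p, D p -> f.[p] = (P p)`_(n - i).
    move=> i.
    by have [/IHk[f Hf]|] := boolP (i < k)%N; [exists f | exists 0].
  exists (- (k%:R^-1 *: \sum_(l < n) if (l < k)%N then c (k - l.+1)%N * pi l.+1 else 0)) => le_kn p Dp.
  have := @newton_identity _ (r p) (n - k) n.+1; cbv zeta; rewrite -/(P p) szP // => /(_ (leqnn _)).
  rewrite big_ord_recl addn0 /=.
  under [X in _ + X]eq_bigr do rewrite /bump /= add1n.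
  have -> : \sum_(x <- r p) x ^+ 0 = n%:R.
    by rewrite -(sr p Dp) -sum1_size natr_sum; apply: eq_bigr.
  (* The part n - k cancels the left-hand side and leaves k times the unknown coefficient. *)
  have -> : n%:R = (n - k)%:R + k%:R :> K by rewrite -natrD subnK.
  rewrite mulrDr !mulr_natr -addrA => /eqP.
  rewrite -subr_eq0 opprD addrA subrr add0r oppr_eq0 addr_eq0 => /eqP E.
  have kR : k%:R != 0 :> K by rewrite pnatr_eq0 -lt0n.
  apply: (mulIf kR); rewrite [RHS]mulr_natr E hornerN hornerZ mulNr mulrAC mulVf // mul1r.
  congr (- _); rewrite horner_sum; apply: eq_bigr => l _.
  rewrite -(piP l.+1 p Dp); case: ifP => [lt_lk|/negbT].
    rewrite hornerM cP ?ltn_subrL ?k0 //; last by apply: leq_trans (leq_subr _ _) le_kn.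
    by congr (_`__ * _); lia.
  rewrite -leqNgt horner0 => le_kl; rewrite nth_default ?mul0r // szP //; lia.
have [c cP] := choice coefP.
pose q : {poly {poly K}} := \poly_(i < n.+1) (if i == n then 1 else c (n - i)%N).
have qn : q`_n = 1 by rewrite coef_poly ltnSn eqxx.
have sq : size q = n.+1.
  by apply/eqP; rewrite eqn_leq size_poly ltnNge; apply/negP => /leq_sizeP/(_ n (leqnn n))/eqP;
    rewrite qn oner_eq0.
exists q; split=> //; first by rewrite monicE lead_coefE sq qn.
move=> p Dp; apply/polyP => i; rewrite coef_ev coef_poly ltnS.
have [le_in|lt_ni] := leqP i n; last by rewrite horner0 nth_default // szP.
have [->|ni] := eqVneq i n; first by rewrite hornerC Pn.
by rewrite cP ?leq_subr // subKn.
Qed.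

End PowerSums.

(** * Factorization of polynomials monic in s *)

Section Bivariate.
Variable K : numClosedFieldType.
Implicit Types (q f g h : {poly {poly K}}) (c : {poly K}) (p a z : K).
Import Pdiv.Idomain.

Local Notation ev p := (map_poly (horner_eval p)).

Lemma ev_eq0_div f a : ev a f = 0 -> exists2 f1, f = ('X - a%:P) *: f1 & size f1 = size f.
Proof.
move=> fa; have Xa : 'X - a%:P != 0 :> {poly K} by rewrite polyXsubC_eq0.
have E : f = ('X - a%:P) *: map_poly (fun u => Pdiv.Field.divp u ('X - a%:P)) f.
  apply/polyP => i; rewrite coefZ coef_map_id0 ?div0p // mulrC.
  rewrite Pdiv.Field.divpK // dvdp_XsubCl /root -coef_ev fa coef0 //.
by eexists; first exact: E; rewrite [in RHS]E size_scale.
Qed.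

(* Gauss' lemma; the primes of [K[p]] are the [p - a]. *)
Lemma monic_gauss q f g c : q \is monic -> c != 0 -> c *: q = f * g ->
  exists f' g', [/\ f' \is monic, g' \is monic, q = f' * g', size f' = size f & size g' = size g].
Proof.
move=> mq; have [N] := ubnP (size c); elim: N c f g => // N IHN c f g szc c0 E.
have q0 := monic_neq0 mq.
have fg0 : f * g != 0 by rewrite -E -mul_polyC mulf_neq0 ?polyC_eq0.
have [f0 g0] : f != 0 /\ g != 0 by move: fg0; rewrite mulf_eq0 negb_or => /andP.
have [sc1|sc1] := eqVneq (size c) 1%N.
  have uc : c \is a GRing.unit.
    by have /size_poly1P[e e0 ->] : size c == 1%N by [rewrite sc1]; rewrite poly_unitE size_polyC e0 coefC unitfE.
  have lc : lead_coef f * lead_coef g = c.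
    by rewrite -lead_coefM -E lead_coefZ (monicP mq) mulr1.
  have /andP[uf ug] : (lead_coef f \is a GRing.unit) && (lead_coef g \is a GRing.unit).
    by rewrite -unitrM lc.
  exists ((lead_coef f)^-1 *: f), ((lead_coef g)^-1 *: g); split.
  - by rewrite monicE lead_coefZ mulVr.
  - by rewrite monicE lead_coefZ mulVr.
  - by rewrite -scalerAl -scalerAr -E !scalerA -lc mulrACA !mulVr // mulr1 scale1r.
  - by rewrite size_scale // invr_eq0 lead_coef_eq0.
  - by rewrite size_scale // invr_eq0 lead_coef_eq0.
have [a ca] := closed_rootP _ sc1.
have [c1 Ec] := factor_theorem _ _ ca.
have c10 : c1 != 0 by apply: contraNneq c0 => c10; rewrite Ec c10 mul0r.
have szc1 : (size c1 < N)%N by move: szc; rewrite Ec size_Mmonic ?monicXsubC // size_XsubC addn2.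
have Xa : 'X - a%:P != 0 :> {poly K} by rewrite polyXsubC_eq0.
have : ev a f * ev a g == 0.
  rewrite -rmorphM -E; apply/eqP/polyP => i.
  by rewrite coef_ev coefZ hornerM (rootP ca) mul0r coef0.
rewrite mulf_eq0 => /orP[/eqP/ev_eq0_div[f1 Ef <-]|/eqP/ev_eq0_div[g1 Eg <-]].
  apply: (IHN c1) => //; have Xa' : ('X - a%:P)%:P != 0 :> {poly {poly K}} by rewrite polyC_eq0.
  by apply: (mulfI Xa'); rewrite !mul_polyC scalerA mulrC -Ec E Ef scalerAl.
apply: (IHN c1) => //; have Xa' : ('X - a%:P)%:P != 0 :> {poly {poly K}} by rewrite polyC_eq0.
by apply: (mulfI Xa'); rewrite !mul_polyC scalerA mulrC -Ec E Eg scalerAr.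
Qed.

(** Divisibility and coprimality are up to nonzero factors in K[p], that is, over K(p). The gcd is a
    proper factor there, and Gauss' lemma makes the factorization monic over K[p]. *)
Lemma monic_split q f : q \is monic -> ~~ coprimep q f -> ~~ (q %| f) ->
  exists q1 q2, [/\ q1 \is monic, q2 \is monic, q = q1 * q2,
     (1 < size q1 < size q)%N & (1 < size q2 < size q)%N].
Proof.
move=> mq ncop ndvd; have q0 := monic_neq0 mq.
have /dvdpP[[c h] /= c0 E] : gcdp q f %| q := dvdp_gcdl q f.
have [q1 [q2 [m1 m2 Eq s1 s2]]] := monic_gauss mq c0 E.
have d0 : gcdp q f != 0 by rewrite gcdp_eq0 negb_and q0.
have sd1 : (1 < size (gcdp q f))%N.
  by rewrite ltn_neqAle eq_sym lt0n size_poly_eq0 d0 andbT.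
have sdq : (size (gcdp q f) < size q)%N.
  rewrite ltn_neqAle dvdp_leq ?dvdp_gcdl // andbT; apply: contra ndvd.
  by rewrite dvdp_size_eqp ?dvdp_gcdl // => /eqp_dvdl <-; apply: dvdp_gcdr.
have sq : (size q + 1 = size q1 + size q2)%N.
  have := size_monicM m1 (monic_neq0 m2); rewrite -Eq.
  have : (0 < size q1)%N by rewrite lt0n size_poly_eq0 monic_neq0.
  have : (0 < size q2)%N by rewrite lt0n size_poly_eq0 monic_neq0.
  by move=> h1 h2 ->; rewrite addn1 prednK // addn_gt0 h1 orbT.
exists q1, q2; split=> //; move: sq sd1 sdq; rewrite -s2;
  by move: (size q) (size q1) (size q2) => x y t; lia.
Qed.

(** [c] plays the part of a resultant: q and f can share a root only over its zeros. *)
Lemma coprimep_bezout q f : coprimep q f -> exists (u v : {poly {poly K}}) c,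
  c != 0 /\ u * q + v * f = c%:P.
Proof.
move=> /Bezout_coprimepP[[u v] /=]; rewrite /eqp => /andP[d1 _].
have /size_poly1P[c c0 Ec] : size (u * q + v * f) == 1%N by rewrite -dvdp1.
by exists u, v, c.
Qed.

End Bivariate.

(** * Realization of a polynomial with self-reflected roots *)

Section HermiteForm.
Variable K : numClosedFieldType.
Implicit Types (q : {poly {poly K}}) (p z : K).

Local Notation ev p := (map_poly (horner_eval p)).

(* Hermite's form [H_ij = p^(-i) sum_k s_k^(i+j)] of the roots [s_k], cleared of its
   denominator. *)
Lemma hermite_admissible q : q \is monic -> (1 < size q)%N -> coprimep q q^`() ->
    (forall p s, `|p| = 1 -> root (ev p q) s -> s = p * s^*) ->
  exists C H : 'M[{poly K}]_((size q).-1), admissible (size q).-2 C H /\ char_poly C = q.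
Proof.
move=> mq sq1 cop self.
have /choice[pi piP] := power_sum_poly mq.
set d := (size q).-1; have d0 : (0 < d)%N by rewrite /d; lia.
have sq : size q = d.+1 by rewrite /d; lia.
have qd : q`_d = 1 by move: mq; rewrite monicE lead_coefE => /eqP.
pose C : 'M[{poly K}]_d := (companionmx q)^T.
pose H : 'M[{poly K}]_d := \matrix_(i, j) ('X^(d.-1 - i) * pi (i + j)%N).
have rootsP p : exists r : d.-tuple K, ev p q = \prod_(x <- r) ('X - x%:P).
  have [r Er] := closed_field_poly_normal (ev p q).
  rewrite (monicP (monic_ev p mq)) scale1r in Er.
  have sr : size r == d.
    by rewrite -eqSS -size_prod_XsubC_seq -Er size_ev_monic // sq.
  by exists (Tuple sr).
(* The Vandermonde matrix of the roots diagonalizes C, and on the circle H = p^(d - 1) L^t* L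
   because conj s = s / p. Hence m = d - 1. *)
pose L (r : d.-tuple K) : 'M[K]_d := \matrix_(k, j) (tnth r k ^+ j).
have LH p (r : d.-tuple K) : `|p| = 1 -> ev p q = \prod_(x <- r) ('X - x%:P) ->
    evmx p H = p ^+ d.-1 *: ((L r)^t* *m L r).
  move=> p1 Er; have p0 := circle_neq0 p1; apply/matrixP=> i j.
  rewrite evmxE !mxE hornerM hornerXn (piP _ _ _ Er).
  rewrite big_tuple !mulr_sumr; apply: eq_bigr => k _; rewrite !mxE.
  have rk : root (ev p q) (tnth r k) by rewrite Er root_prod_XsubC mem_tnth.
  rewrite {1}(self _ _ p1 rk) exprD [LHS]mulrA [RHS]mulrA; congr (_ * _).
    rewrite exprMn mulrA -exprD subnK ?rmorphXn //.
    by rewrite -ltnS prednK.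
  by rewrite -(self _ _ p1 rk).
have LC p (r : d.-tuple K) : `|p| = 1 -> ev p q = \prod_(x <- r) ('X - x%:P) ->
    L r *m evmx p C = diag_mx (\row_k tnth r k) *m L r.
  move=> p1 Er; rewrite mul_diag_mx; apply/matrixP=> k j; rewrite !mxE.
  have rk : root (ev p q) (tnth r k) by rewrite Er root_prod_XsubC mem_tnth.
  rewrite -exprS; set s := tnth r k in rk *.
  have E l : L r k l * evmx p C l j = s ^+ l * (if j == d.-1 :> nat then - (q`_l).[p] else (j.+1 == l)%:R).
    rewrite mxE evmxE !mxE; case: ifP => _; rewrite ?hornerN //.
    by case: (_ == _); rewrite ?hornerC // horner0.
  under eq_bigr do rewrite E.
  have [Ej|Ej] := eqVneq (j : nat) d.-1.
    have szq : (size (ev p q) <= d.+1)%N by rewrite size_ev_monic // sq.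
    move/rootP: rk; rewrite (horner_coef_wide _ szq) big_ord_recr /= coef_ev qd hornerC mul1r.
    rewrite Ej prednK // addrC => /eqP; rewrite addr_eq0 => /eqP ->.
    by rewrite -sumrN; apply: eq_bigr => l _; rewrite coef_ev mulrN mulrC.
  have lt_j : (j.+1 < d)%N by have := ltn_ord j; move: Ej; lia.
  rewrite (bigD1 (Ordinal lt_j)) //= eqxx mulr1 big1 ?addr0 // => l.
  by rewrite -val_eqE /= eq_sym => /negPf ->; rewrite mulr0.
exists C, H; split; last first.
  by rewrite /C -[RHS](companionmxK mq) /char_poly -[in RHS]det_tr /char_poly_mx linearB /= tr_scalar_mx map_trmx.
split=> [p p1|p p1|].
- have [r Er] := rootsP p; rewrite (LH p r p1 Er) scalerA mulVf ?scale1r; last first.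
    by rewrite expf_neq0 ?circle_neq0.
  by have := psd_congr (L r) (herm_form1_ge0 (n := d) : psd 1%:M); rewrite mulmx1.
- have [r Er] := rootsP p; have p0 := circle_neq0 p1.
  rewrite evmxM (LH p r p1 Er) -scalemxAl -mulmxA (LC p r p1 Er).
  set D := diag_mx _; have Dself : D^t* = p^-1 *: D.
    apply/matrixP=> k l; rewrite ctmxE !mxE.
    have rk t : root (ev p q) (tnth r t) by rewrite Er root_prod_XsubC mem_tnth.
    have [->|kl] := eqVneq l k; last by rewrite !mulr0n conjC0 mulr0.
    by rewrite !mulr1n [in RHS](self _ _ p1 (rk k)) mulrA mulVf // mul1r.
  rewrite ctmxZ !ctmxM trmxCK Dself rmorphXn /= conj_circle // -scalemxAr -scalemxAl !scalerA mulmxA.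
  congr (_ *: _); rewrite exprS exprD exprVn; field.
  by rewrite p0 expf_neq0.
(* Where c does not vanish the roots are distinct, so the Vandermonde determinant is nonzero. *)
have [u [v [c [c0 Ebez]]]] := coprimep_bezout cop.
have [p p1 cp] := circle_nonroot c0; have [r Er] := rootsP p.
have ur : uniq r.
  rewrite -separable_prod_XsubC -Er separable_poly.unlock; apply/Pdiv.Idomain.Bezout_coprimepP.
  exists (ev p u, ev p v) => /=.
  have -> : (ev p q)^`() = ev p (q^`()) by rewrite -deriv_map.
  rewrite -!rmorphM -rmorphD Ebez /= map_polyC /=.
  by rewrite polyC_eqp1.
have dL : \det (L r) != 0.
  have -> : L r = (Vandermonde d (\row_k tnth r k))^T.
    by apply/matrixP=> k j; rewrite !mxE.
  rewrite det_tr det_Vandermonde; apply/prodf_neq0 => i _; apply/prodf_neq0 => j lt_ij.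
  rewrite !mxE subr_eq0; apply: contraTneq lt_ij => /(tuple_uniqP _ ur) ->.
  by rewrite ltnn.
have : \det (evmx p H) != 0.
  rewrite (LH p r p1 Er) detZ det_mulmx det_ctmx.
  by rewrite !mulf_neq0 ?conjC_eq0 // !expf_neq0 // circle_neq0.
by rewrite det_evmx; apply: contraNneq => ->; rewrite horner0.
Qed.

Lemma char_poly_block n1 n2 (A : 'M[{poly K}]_n1) (B : 'M[{poly K}]_n2) :
  char_poly (block_mx A 0 0 B) = char_poly A * char_poly B.
Proof.
rewrite /char_poly /char_poly_mx map_block_mx !raddf0 scalar_mx_block.
by rewrite opp_block_mx add_block_mx !oppr0 !addr0 det_ublock.
Qed.

Lemma pencil_block n1 n2 (A : 'M[K]_n1) (B : 'M[K]_n2) :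
  pencil_mx (block_mx A 0 0 B) = block_mx (pencil_mx A) 0 0 (pencil_mx B).
Proof.
rewrite /pencil_mx tr_block_mx !map_block_mx !trmx0 !map_mx0 scale_block_mx add_block_mx.
by rewrite !scaler0 !addr0.
Qed.

(** Strong induction on the degree: a factor shared with the derivative splits q into smaller monic
    factors, which inherit the condition on the circle, and characteristic polynomials of
    block-diagonal pencils multiply. *)
Theorem self_adjoint_pencil q : q \is monic -> (1 < size q)%N ->
    (forall p s, `|p| = 1 -> root (ev p q) s -> s = p * s^*) ->
  exists (n : nat) (F : 'M[K]_n), (0 < n)%N /\ char_poly (pencil_mx F) = q.
Proof.
have [N] := ubnP (size q); elim: N q => // N IHN q szN mq sq1 self.
have [cop|ncop] := boolP (coprimep q q^`()).
  have [C [H [adm charC]]] := hermite_admissible mq sq1 cop self.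
  have [C' [H' [adm' charC' [c [k dH']]]]] := adm_saturate adm.
  have [F charF] := adm_pencil adm' dH'.
  by exists (size q).-1, F; split; [lia | rewrite charF charC' charC].
have dq0 : q^`() != 0.
  apply/eqP => /(congr1 (fun f : {poly {poly K}} => f`_(size q).-2)); rewrite coef0 coef_deriv.
  have -> : (size q).-2.+1 = (size q).-1 by lia.
  rewrite -lead_coefE (monicP mq) => /(congr1 (horner^~ 0)); rewrite hornerMn hornerC horner0.
  by move/eqP; rewrite pnatr_eq0; lia.
have ndvd : ~~ (Pdiv.Idomain.dvdp q q^`()).
  by apply/negP => /(Pdiv.Idomain.dvdp_leq dq0); rewrite leqNgt lt_size_deriv // monic_neq0.
have [q1 [q2 [m1 m2 Eq s1 s2]]] := monic_split mq ncop ndvd.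
have sub (r : {poly {poly K}}) : (1 < size r < size q)%N -> r \is monic -> (forall p s, root (ev p r) s -> root (ev p q) s) ->
    exists (n : nat) (F : 'M[K]_n), (0 < n)%N /\ char_poly (pencil_mx F) = r.
  move=> /andP[sr lt_r] mr rq; apply: IHN => //; last by move=> p s p1 /rq; apply: self.
  by apply: leq_trans lt_r _; rewrite -ltnS.
have [n1 [F1 [n10 E1]]] : exists (n : nat) (F : 'M[K]_n), (0 < n)%N /\ char_poly (pencil_mx F) = q1.
  by apply: sub => // p s rs; rewrite Eq rmorphM rootM rs.
have [n2 [F2 [_ E2]]] : exists (n : nat) (F : 'M[K]_n), (0 < n)%N /\ char_poly (pencil_mx F) = q2.
  by apply: sub => // p s rs; rewrite Eq rmorphM rootM rs orbT.
exists (n1 + n2)%N, (block_mx F1 0 0 F2); split; first by rewrite addn_gt0 n10.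
by rewrite pencil_block char_poly_block Eq -E1 -E2.
Qed.

End HermiteForm.

(** * Analytic functions on the disc *)

Section DiscAnalytic.
Variable K : numClosedFieldType.
(* The Archimedean property of [K], in the form in which it is needed. *)
Hypothesis geometric : forall x e : K, 0 <= x -> x < 1 -> 0 < e ->
  exists N : nat, forall n, (N <= n)%N -> x ^+ n <= e.
Implicit Types (f g : K -> K) (p z r e : K).

(* By Runge's theorem this is holomorphy in the open unit disc. *)
Definition disc_analytic f := forall r e, 0 <= r -> r < 1 -> 0 < e ->
  exists g : {poly K}, forall p, `|p| <= r -> `|f p - g.[p]| <= e.

Lemma poly_bound (g : {poly K}) r : 0 <= r ->
  exists2 M, 0 < M & forall p, `|p| <= r -> `|g.[p]| <= M.
Proof.
move=> r0; have [L L0 HL] := poly_lipschitz g r0.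
exists (`|g.[0]| + L * r + 1); first by rewrite ltr_wpDl // addr_ge0 ?mulr_ge0.
move=> p pr; rewrite -[g.[p]](subrK g.[0]) addrC; apply: ler_wpDr => //.
apply: le_trans (ler_normD _ _) _; apply: lerD => //.
apply: le_trans (HL _ _ pr _) _; first by rewrite normr0.
by rewrite subr0; apply: ler_wpM2l.
Qed.

Lemma disc_analytic_bound f r : disc_analytic f -> 0 <= r -> r < 1 ->
  exists2 M, 0 < M & forall p, `|p| <= r -> `|f p| <= M.
Proof.
move=> af r0 r1; have [g gf] := af r 1 r0 r1 ltr01; have [M M0 HM] := poly_bound g r0.
exists (1 + M); first by rewrite addr_gt0.
move=> p pr; rewrite -[f p](subrK g.[p]); apply: le_trans (ler_normD _ _) _.
by apply: lerD; [apply: gf | apply: HM].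
Qed.

Lemma disc_analytic_lim f :
  (forall r e, 0 <= r -> r < 1 -> 0 < e ->
    exists2 g, disc_analytic g & forall p, `|p| <= r -> `|f p - g p| <= e) ->
  disc_analytic f.
Proof.
move=> H r e r0 r1 e0; have e20 : 0 < e / 2 by rewrite divr_gt0 ?ltr0n.
have [g ag gf] := H r _ r0 r1 e20; have [h hg] := ag r _ r0 r1 e20.
exists h => p pr; rewrite -(subrKA (g p)) [e](splitr e).
by apply: le_trans (ler_normD _ _) _; apply: lerD; [apply: gf | apply: hg].
Qed.

Lemma eq_disc_analytic f g : (forall p, `|p| < 1 -> f p = g p) ->
  disc_analytic f -> disc_analytic g.
Proof.
move=> fg af r e r0 r1 e0; have [h hf] := af r e r0 r1 e0.
by exists h => p pr; rewrite -fg ?hf //; apply: le_lt_trans pr r1.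
Qed.

Lemma disc_analytic_poly (h : {poly K}) : disc_analytic (fun p => h.[p]).
Proof. by move=> r e _ _ e0; exists h => p _; rewrite subrr normr0 ltW. Qed.

Lemma disc_analytic_add f g : disc_analytic f -> disc_analytic g ->
  disc_analytic (fun p => f p + g p).
Proof.
move=> af ag r e r0 r1 e0; have e20 : 0 < e / 2 by rewrite divr_gt0 ?ltr0n.
have [h hf] := af r _ r0 r1 e20; have [k kg] := ag r _ r0 r1 e20.
exists (h + k) => p pr; rewrite hornerD opprD addrACA [e](splitr e).
by apply: le_trans (ler_normD _ _) _; apply: lerD; [apply: hf | apply: kg].
Qed.

Lemma disc_analytic_mul f g : disc_analytic f -> disc_analytic g ->
  disc_analytic (fun p => f p * g p).
Proof.
move=> af ag r e r0 r1 e0.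
have [M M0 HM] := disc_analytic_bound ag r0 r1.
have eM : 0 < e / 2 / M by rewrite !divr_gt0 ?ltr0n.
have [h hf] := af r _ r0 r1 eM.
have [M' M'0 HM'] := poly_bound h r0.
have eM' : 0 < e / 2 / M' by rewrite !divr_gt0 ?ltr0n.
have [k kg] := ag r _ r0 r1 eM'.
exists (h * k) => p pr; rewrite hornerM.
have -> : f p * g p - h.[p] * k.[p] = (f p - h.[p]) * g p + h.[p] * (g p - k.[p]) by ring.
rewrite [e](splitr e); apply: le_trans (ler_normD _ _) _; rewrite !normrM; apply: lerD.
  by rewrite -[leRHS](divfK (lt0r_neq0 M0)) ler_pM ?hf ?HM.
by rewrite mulrC -[leRHS](divfK (lt0r_neq0 M'0)) ler_pM ?kg ?HM'.
Qed.

Lemma disc_analytic_sum (I : Type) (s : seq I) (F : I -> K -> K) :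
  (forall i, disc_analytic (F i)) -> disc_analytic (fun p => \sum_(i <- s) F i p).
Proof.
move=> aF; elim: s => [|i s IHs].
  by apply: (@eq_disc_analytic (fun p => (0 : {poly K}).[p])) => [p _|];
    [rewrite big_nil horner0 | apply: disc_analytic_poly].
apply: (@eq_disc_analytic (fun p => F i p + \sum_(i <- s) F i p)) => [p _|].
  by rewrite big_cons.
exact: disc_analytic_add.
Qed.

Lemma disc_analytic_inv_XsubC z : 1 <= `|z| -> disc_analytic (fun p => (p - z)^-1).
Proof.
move=> z1 r e r0 r1 e0; have z_gt0 : 0 < `|z| by exact: lt_le_trans ltr01 z1.
have z0 : z != 0 by rewrite -normr_gt0.
have d0 : 0 < 1 - r by rewrite subr_gt0.
have [N HN] := geometric r0 r1 (mulr_gt0 e0 d0).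
exists (- z^-1 *: \sum_(k < N) (z^-1 *: 'X) ^+ k) => p pr.
have pz : p - z != 0.
  rewrite subr_eq0; apply: contraTneq (le_lt_trans pr r1) => ->.
  by rewrite -real_leNgt ?normr_real ?real1.
have E : (p / z) ^+ N - 1 = (p / z - 1) * \sum_(k < N) (p / z) ^+ k by rewrite subrX1.
rewrite hornerZ horner_sum.
have -> : \sum_(k < N) ((z^-1 *: 'X) ^+ k).[p] = \sum_(k < N) (p / z) ^+ k.
  by apply: eq_bigr => k _; rewrite horner_exp hornerZ hornerX mulrC.
have -> : (p - z)^-1 - - z^-1 * \sum_(k < N) (p / z) ^+ k = (p / z) ^+ N / (p - z).
  have -> : (p / z) ^+ N = (p / z - 1) * (\sum_(k < N) (p / z) ^+ k) + 1 by rewrite -E subrK.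
  by field; rewrite z0 pz.
rewrite normf_div normrX normf_div ler_pdivrMr ?normr_gt0 //.
have dpz : 1 - r <= `|p - z|.
  by rewrite distrC; apply: le_trans (lerB_dist _ _); apply: lerB.
apply: le_trans (_ : e * (1 - r) <= _); last by apply: ler_wpM2l; first exact: ltW.
apply: le_trans (HN N (leqnn N)); apply: lerXn2r; rewrite ?nnegrE ?divr_ge0 //.
by rewrite ler_pdivrMr // -[`|p|]mulr1; apply: ler_pM.
Qed.

Lemma disc_analytic_inv (u : {poly K}) : (forall p, `|p| < 1 -> u.[p] != 0) ->
  disc_analytic (fun p => u.[p]^-1).
Proof.
move=> Hu; have [rs Eu] := closed_field_poly_normal u.
have u0 : lead_coef u != 0.
  rewrite lead_coef_eq0; apply: contraTneq (Hu 0 _) => [->|]; last by rewrite normr0 ltr01.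
  by rewrite horner0 eqxx.
have rs1 : forall z, z \in rs -> 1 <= `|z|.
  move=> z zrs; rewrite real_leNgt ?normr_real ?real1 //; apply/negP => /Hu.
  by rewrite Eu hornerZ mulf_eq0 (negPf u0) /= -/(root _ _) root_prod_XsubC zrs.
apply: (@eq_disc_analytic (fun p => ((lead_coef u)^-1)%:P.[p] * \prod_(z <- rs) (p - z)^-1)).
  move=> p _; rewrite hornerC [in RHS]Eu hornerZ invfM; congr (_ * _).
  by rewrite horner_prod prodfV; congr (_^-1); apply: eq_bigr => z _; rewrite hornerXsubC.
apply: disc_analytic_mul; first exact: disc_analytic_poly.
elim: rs rs1 {Eu} => [|z rs IHrs] rs1.
  by apply: (@eq_disc_analytic (fun p => (1 : {poly K}).[p])) => [p _|];
    [rewrite big_nil -polyC1 hornerC | apply: disc_analytic_poly].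
apply: (@eq_disc_analytic (fun p => (p - z)^-1 * \prod_(z <- rs) (p - z)^-1)) => [p _|].
  by rewrite big_cons.
apply: disc_analytic_mul; first by apply: disc_analytic_inv_XsubC; apply: rs1; rewrite mem_head.
by apply: IHrs => y yrs; apply: rs1; rewrite inE yrs orbT.
Qed.

Lemma sum_root_of_unity n z t : n.-primitive_root z ->
  \sum_(i < n) z ^+ (i * t) = if (n %| t)%N then n%:R else 0.
Proof.
move=> zP; under eq_bigr do rewrite mulnC exprM.
case: ifP => [nt|nt].
  rewrite (eq_bigr (fun _ => 1)) => [|i _]; first by rewrite sumr_const card_ord.
  by rewrite (eqP (_ : z ^+ t == 1)) ?expr1n // -(prim_order_dvd zP).
have zt : z ^+ t - 1 != 0 by rewrite subr_eq0 -(prim_order_dvd zP) nt.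
by apply: (mulfI zt); rewrite -subrX1 mulr0 -exprM mulnC exprM (prim_expr_order zP) expr1n subrr.
Qed.

Lemma sum_circle_bound (g : K -> K) n z r e t : n.-primitive_root z -> 0 <= r ->
  (forall p, `|p| = r -> `|g p| <= e) ->
  `|\sum_(i < n) g (r * z ^+ i) * z ^+ (i * t)| <= n%:R * e.
Proof.
move=> zP r0 ge; apply: le_trans (ler_norm_sum _ _ _) _.
apply: le_trans (ler_sum _ (G := fun _ : 'I_n => e) _) _; last first.
  by rewrite sumr_const card_ord mulr_natl.
move=> i _; rewrite normrM normrX (root_of_unity_norm zP) expr1n mulr1; apply: ge.
by rewrite normrM normrX (root_of_unity_norm zP) expr1n mulr1 ger0_norm.
Qed.

(** Discrete Cauchy formula for a coefficient. The exponent n - m stands for -m, and n above the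
    degree prevents aliasing. *)
Lemma sum_circle_poly (g : {poly K}) n z r m : n.-primitive_root z -> (m < n)%N ->
  (size g <= n)%N ->
  \sum_(i < n) g.[r * z ^+ i] * z ^+ (i * (n - m)) = n%:R * (g`_m * r ^+ m).
Proof.
move=> zP mn sg; under eq_bigr do rewrite (horner_coef_wide _ sg) mulr_suml.
rewrite exchange_big /= (bigD1 (Ordinal mn)) //= [X in _ + X]big1 ?addr0 => [|k km].
  under eq_bigr do rewrite exprMn -exprM -!mulrA -exprD -mulnDr subnKC ?(ltnW mn) //.
  rewrite -mulr_sumr -mulr_sumr sum_root_of_unity // dvdnn; ring.
under eq_bigr do rewrite exprMn -exprM -!mulrA -exprD -mulnDr.
rewrite -!mulr_sumr sum_root_of_unity //; case: ifP => [/dvdnP[l El]|_]; last by rewrite !mulr0.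
have kn := ltn_ord k; move: km; rewrite -val_eqE /= => /eqP km.
case: l El => [|[|l]]; rewrite ?mul0n ?mul1n ?mulSn => E; exfalso; [lia | lia |].
by move: E; move: (l * n)%N => w; lia.
Qed.

Lemma sum_circle_poly0 (g : {poly K}) n z r t : n.-primitive_root z -> (0 < t)%N ->
  (size g + t <= n)%N ->
  \sum_(i < n) g.[r * z ^+ i] * z ^+ (i * t) = 0.
Proof.
move=> zP t0 sg; under eq_bigr do rewrite (horner_coef_wide _ (leqnn _)) mulr_suml.
rewrite exchange_big /= big1 // => k _.
under eq_bigr do rewrite exprMn -exprM -!mulrA -exprD -mulnDr.
rewrite -!mulr_sumr sum_root_of_unity // ifN ?mulr0 //; apply/negP => /dvdn_leq.
rewrite addn_gt0 t0 orbT => /(_ isT) le_n; have := leq_trans sg le_n.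
by rewrite leq_add2r leqNgt ltn_ord.
Qed.

(* The reflected function [p^j conj g] has no Fourier coefficient of index [m > j]. *)
Lemma reflected_coef_bound (g : {poly K}) j m r B : (j < m)%N -> 0 <= r ->
  (forall p, `|p| = r -> `|g.[p] - p ^+ j * (g.[p])^*| <= B) -> `|g`_m| * r ^+ m <= B.
Proof.
move=> jm r0 gB; pose n := (size g + m).+1.
have [|z zP] := @prim_root_exists K n; first by [].
have n0 : 0 < n%:R :> K by rewrite ltr0n.
have z1 := root_of_unity_norm zP.
have := sum_circle_bound (n - m) zP r0 gB.
under eq_bigr do rewrite mulrBl; rewrite sumrB sum_circle_poly //; last 2 first.
- by rewrite ltnS leq_addl.
- by rewrite leqW // leq_addr.
have -> : \sum_(i < n) (r * z ^+ i) ^+ j * (g.[r * z ^+ i])^* * z ^+ (i * (n - m)) = 0.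
  transitivity (r ^+ j * (\sum_(i < n) g.[r * z ^+ i] * z ^+ (i * (m - j)))^*).
    rewrite rmorph_sum mulr_sumr /=; apply: eq_bigr => i _.
    rewrite rmorphM /= rmorphXn /= (conj_circle z1) exprMn -exprM exprVn.
    have zi : z ^+ (i * (m - j)) != 0 by rewrite expf_neq0 ?circle_neq0.
    have E : z ^+ (i * j) * z ^+ (i * (n - m)) * z ^+ (i * (m - j)) = 1.
      rewrite -!exprD -!mulnDr (_ : j + (n - m) + (m - j) = n)%N; last by rewrite /n; lia.
      by rewrite mulnC exprM (prim_expr_order zP) expr1n.
    have -> : (z ^+ (i * (m - j)))^-1 = z ^+ (i * j) * z ^+ (i * (n - m)).
      by apply: (mulIf zi); rewrite mulVf // E.
    ring.
  by rewrite sum_circle_poly0 ?conjC0 ?mulr0 // ?subn_gt0 // /n; lia.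
rewrite subr0 normrM normr_nat ler_pM2l // normrM normrX.
by rewrite (ger0_norm r0).
Qed.

Lemma geometric_sum_le (x : K) n : 0 <= x -> x < 1 -> \sum_(i < n) x ^+ i <= (1 - x)^-1.
Proof.
move=> x0 x1; have d0 : 0 < 1 - x by rewrite subr_gt0.
rewrite -[(1 - x)^-1]mul1r ler_pdivlMr //.
have -> : (\sum_(i < n) x ^+ i) * (1 - x) = 1 - x ^+ n.
  by rewrite -[RHS]opprB subrX1; ring.
by rewrite gerBl exprn_ge0.
Qed.

Section Reflection.
Variables (f : K -> K) (j : nat) (B : K).
Hypotheses (af : disc_analytic f) (B0 : 0 <= B).
Hypothesis fB : forall p, `|p| < 1 -> `|f p - p ^+ j * (f p)^*| <= B * (1 - `|p|).

(** On a circle of radius r close to 1 the approximant g nearly satisfies the reflection identity,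
    so its coefficients beyond j are small; on |p| <= rho truncating them costs only a geometric
    series. *)
Lemma reflected_approx rho eta : 0 <= rho -> rho < 1 -> 0 < eta ->
  exists2 T : {poly K}, (size T <= j.+1)%N &
    forall p, `|p| <= rho -> `|f p - T.[p]| <= eta.
Proof.
move=> rho0 rho1 eta0.
pose s := 1 - rho; have s0 : 0 < s by rewrite subr_gt0.
have s1 : s <= 1 by rewrite gerBl.
have eta4 : 0 < eta / 4 by rewrite divr_gt0 ?ltr0n.
pose t := (2 + (B + 1) / (eta / 4))^-1.
have B1 : 0 < B + 1 by rewrite ltr_wpDl.
have den0 : 0 < 2 + (B + 1) / (eta / 4) by rewrite addr_gt0 ?divr_gt0 ?ltr0n.
have t0 : 0 < t by rewrite invr_gt0.
have t2 : t <= 2^-1.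
  by rewrite lef_pV2 ?posrE ?ltr0n // lerDl divr_ge0 ?ltW.
have Bt : B * t <= eta / 4.
  rewrite ler_pdivrMr // mulrDr [X in _ + X]mulrC divfK ?lt0r_neq0 //.
  apply: le_trans (_ : B + 1 <= _); first by rewrite lerDl.
  by rewrite lerDr mulr_ge0 ?ltW ?ltr0n.
pose r := 1 - s * t.
have st : s * t <= s / 2 by apply: ler_wpM2l; first exact: ltW.
have st0 : 0 < s * t by rewrite mulr_gt0.
have r1 : r < 1 by rewrite gtrBl.
have r_rho : s / 2 <= r - rho.
  have -> : r - rho = s - s * t by rewrite /r /s; ring.
  by rewrite lerBrDl -lerBrDr; apply: le_trans st _; rewrite {2}(splitr s) addrK.
have r_gt_rho : rho < r by rewrite -subr_gt0; apply: lt_le_trans r_rho; rewrite divr_gt0 ?ltr0n.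
have r_gt0 : 0 < r by apply: le_lt_trans r_gt_rho.
have r0 := ltW r_gt0.
(* The errors add up to at most eta: eta / 10 for g itself, then 2 eta / 5 from e and eta / 2 from B
   t in the truncation. *)
pose e := eta * s / 10.
have e0 : 0 < e by rewrite divr_gt0 ?mulr_gt0 ?ltr0n.
have [g gf] := af r0 r1 e0.
pose d := e + e + B * (s * t).
have gd p : `|p| = r -> `|g.[p] - p ^+ j * (g.[p])^*| <= d.
  move=> pr; have -> : g.[p] - p ^+ j * (g.[p])^* =
      - (f p - g.[p]) + p ^+ j * ((f p - g.[p])^*) + (f p - p ^+ j * (f p)^*).
    by rewrite rmorphB; ring.
  have gp : `|f p - g.[p]| <= e by apply: gf; rewrite pr.
  apply: le_trans (ler_normD _ _) _; apply: lerD.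
    apply: le_trans (ler_normD _ _) _; apply: lerD; first by rewrite normrN.
    rewrite normrM norm_conjC normrX pr -[e]mul1r ler_pM ?exprn_ge0 //.
    by apply: exprn_ile1 => //; exact: ltW.
  apply: le_trans (fB _) _; first by rewrite pr.
  by rewrite pr /r subKr.
have cf m : (j < m)%N -> `|g`_m| * r ^+ m <= d by move=> jm; apply: reflected_coef_bound gd.
have d0 : 0 <= d by rewrite /d addr_ge0 ?(mulr_ge0 B0 (ltW st0)) // addr_ge0 ?(ltW e0).
exists (\poly_(i < j.+1) g`_i); first exact: size_poly.
move=> p pr; set T := \poly_(i < _) _.
have gT : `|g.[p] - T.[p]| <= d * (s / 2)^-1.
  pose x := rho / r; have x0 : 0 <= x by rewrite divr_ge0.
  have x1 : x < 1 by rewrite ltr_pdivrMr // mul1r.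
  pose n := maxn (size g) j.+1.
  have -> : g.[p] - T.[p] = (g - T).[p] by rewrite hornerD hornerN.
  have sgT : (size (g - T)%R <= n)%N.
    apply: leq_trans (size_polyD _ _) _; rewrite size_polyN geq_max leq_maxl /=.
    by apply: leq_trans (size_poly _ _) _; rewrite leq_maxr.
  rewrite (horner_coef_wide _ sgT); apply: le_trans (ler_norm_sum _ _ _) _.
  apply: le_trans (_ : \sum_(i < n) d * x ^+ i <= _).
    apply: ler_sum => i _; rewrite coefB coef_poly ltnS.
    case: leqP => [_|ji]; first by rewrite subrr mul0r normr0 mulr_ge0 ?exprn_ge0.
    rewrite subr0 normrM normrX.
    have -> : x ^+ i = rho ^+ i / r ^+ i by rewrite expr_div_n.
    rewrite mulrA ler_pdivlMr ?exprn_gt0 // mulrAC; apply: ler_pM; rewrite ?mulr_ge0 ?exprn_ge0 //.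
      exact: cf.
    by apply: lerXn2r; rewrite ?nnegrE.
  rewrite -mulr_sumr; apply: ler_wpM2l => //; apply: le_trans (geometric_sum_le _ x0 x1) _.
  rewrite lef_pV2 ?posrE ?subr_gt0 ?divr_gt0 ?ltr0n //.
  have -> : 1 - x = (r - rho) / r by rewrite /x mulrBl divff ?lt0r_neq0.
  rewrite ler_pdivlMr //; apply: le_trans r_rho; rewrite ger_pMr ?divr_gt0 ?ltr0n //.
  exact: ltW.
rewrite -(subrKA g.[p]); apply: le_trans (ler_normD _ _) _.
apply: le_trans (_ : e + d * (s / 2)^-1 <= _).
  by apply: lerD gT; apply: gf; apply: le_trans pr (ltW _).
have -> : d * (s / 2)^-1 = eta * (2 / 5) + 2 * (B * t).
  by rewrite /d /e; field; rewrite lt0r_neq0.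
apply: le_trans (_ : eta / 10 + (eta * (2 / 5) + 2 * (eta / 4)) <= _).
  apply: lerD; last by rewrite lerD2l ler_wpM2l ?ler0n.
  by rewrite /e ler_pM2r ?invr_gt0 ?ltr0n // ger_pMr.
suff -> : eta / 10 + (eta * (2 / 5) + 2 * (eta / 4)) = eta by [].
by field.
Qed.

(** The coefficients of c are read off from f at radius 1/2 by the discrete Cauchy formula. These j
    + 1 values determine a polynomial of degree at most j stably, so approximants of every precision
    are close to the same c and no limit has to be taken. *)
Lemma reflected_poly : exists2 c : {poly K}, (size c <= j.+1)%N &
  forall p, `|p| < 1 -> f p = c.[p].
Proof.
have [z zP] := @prim_root_exists K j.+1 isT.
have n0 : 0 < j.+1%:R :> K by rewrite ltr0n.
have h0 : 0 <= 2^-1 :> K by rewrite invr_ge0 ler0n.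
have h1 : 2^-1 < 1 :> K by rewrite invf_lt1 ?ltr0n // ltr1n.
pose co m := j.+1%:R^-1 * 2 ^+ m * \sum_(i < j.+1) f (2^-1 * z ^+ i) * z ^+ (i * (j.+1 - m)).
pose c := \poly_(m < j.+1) co m.
exists c; first exact: size_poly.
move=> p p1; apply/eqP; rewrite -subr_eq0 -normr_eq0; set D := `| _ |; apply/negPn/negP => D_neq0.
have D0 : 0 < D by rewrite lt_def D_neq0 normr_ge0.
pose M := 1 + \sum_(m < j.+1) 2 ^+ m : K.
have M0 : 0 < M by rewrite ltr_wpDr // sumr_ge0 // => m _; rewrite exprn_ge0.
pose rho := (1 + `|p|) / 2.
have p_rho : `|p| <= rho by rewrite ler_pdivlMr ?ltr0n // mulr_natr mulr2n lerD2r ltW.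
have half_rho : 2^-1 <= rho by rewrite ler_pdivlMr ?ltr0n // mulVf ?pnatr_eq0 // lerDl.
have rho1 : rho < 1 by rewrite ltr_pdivrMr ?ltr0n // mul1r ltrD2l.
have rho0 : 0 <= rho by apply: le_trans half_rho.
have eta0 : 0 < D / (M * 2) by rewrite divr_gt0 ?mulr_gt0 ?ltr0n.
have [T sT fT] := reflected_approx rho0 rho1 eta0; set eta := D / _ in eta0 fT.
have coT (m : 'I_j.+1) : `|co m - T`_m| <= 2 ^+ m * eta.
  have -> : T`_m = j.+1%:R^-1 * 2 ^+ m * \sum_(i < j.+1) T.[2^-1 * z ^+ i] * z ^+ (i * (j.+1 - m)).
    rewrite (sum_circle_poly _ zP (ltn_ord m) sT) exprVn; field.
    by rewrite expf_neq0 ?pnatr_eq0 //= addrC -mulrSr pnatr_eq0.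
  rewrite -mulrBr -sumrB; under eq_bigr do rewrite -mulrBl.
  rewrite normrM normrM normrX normfV !normr_nat mulrAC mulrC; apply: ler_wpM2l.
    by rewrite exprn_ge0.
  rewrite mulrC ler_pdivrMr // mulrC.
  apply: (@sum_circle_bound (fun x => f x - T.[x]) _ _ _ eta _ zP) => // x xr.
  by apply: fT; rewrite xr.
have cT : `|c.[p] - T.[p]| <= (\sum_(m < j.+1) 2 ^+ m) * eta.
  rewrite horner_poly (horner_coef_wide _ sT) -sumrB mulr_suml.
  apply: le_trans (ler_norm_sum _ _ _) _; apply: ler_sum => m _.
  rewrite -mulrBl normrM normrX -[leRHS]mulr1; apply: ler_pM; rewrite ?exprn_ge0 //.
  by apply: exprn_ile1 => //; exact: ltW.
have : D <= M * eta.
  rewrite /D -(subrKA T.[p]); apply: le_trans (ler_normD _ _) _; rewrite /M mulrDl mul1r.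
  by apply: lerD; [apply: fT | rewrite distrC].
have -> : M * eta = D / 2 by rewrite /eta; field; rewrite lt0r_neq0.
by rewrite ler_pdivlMr ?ltr0n // ger_pMr // (ler_nat K 2 1).
Qed.

End Reflection.

End DiscAnalytic.

(** * The symmetrized bidisk *)

Section Bidisk.
Variable K : numClosedFieldType.
Implicit Types (a b p s z w : K).

Definition in_G s p := exists z1 z2 : K, [/\ `|z1| < 1, `|z2| < 1, s = z1 + z2 & p = z1 * z2].

Lemma sum_product_roots s p : exists z1 z2 : K, s = z1 + z2 /\ p = z1 * z2.
Proof.
pose t := sqrtC (s ^+ 2 - 4 * p); have Et : t ^+ 2 = s ^+ 2 - 4 * p by exact: sqrtCK.
exists ((s + t) / 2), ((s - t) / 2); split; first by field.
have -> : (s + t) / 2 * ((s - t) / 2) = (s ^+ 2 - t ^+ 2) / 4 by field.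
by rewrite Et; field.
Qed.

Lemma symmetrized_defect a b : (a + b) - (a + b)^* * (a * b) =
  a * (1 - `|b| ^+ 2) + b * (1 - `|a| ^+ 2).
Proof. by rewrite rmorphD /= !normCK; ring. Qed.

(** The last inequality rests on 1 - x^2 y^2 - x (1 - y^2) - y (1 - x^2) = (1 - x) (1 - y) (1 - x y)
    for the moduli x and y. *)
Lemma in_G_lt s p : in_G s p ->
  [/\ `|p| < 1, `|s| <= 2 & `|s - s^* * p| < 1 - `|p| ^+ 2].
Proof.
move=> [a [b [a1 b1 -> ->]]]; split.
- by rewrite normrM mulr_ilt1.
- by apply: le_trans (ler_normD _ _) _; rewrite -[2]/(1 + 1) lerD // ltW.
rewrite symmetrized_defect normrM.
set x := `|a| in a1 *; set y := `|b| in b1 *.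
have x0 : 0 <= x := normr_ge0 a; have y0 : 0 <= y := normr_ge0 b.
have x2 : 0 <= 1 - x ^+ 2 by rewrite subr_ge0 exprn_ile1 // ltW.
have y2 : 0 <= 1 - y ^+ 2 by rewrite subr_ge0 exprn_ile1 // ltW.
apply: le_lt_trans (_ : x * (1 - y ^+ 2) + y * (1 - x ^+ 2) < _).
  by apply: le_trans (ler_normD _ _) _; rewrite !normrM (ger0_norm x2) (ger0_norm y2).
rewrite -subr_gt0.
have -> : 1 - (x * y) ^+ 2 - (x * (1 - y ^+ 2) + y * (1 - x ^+ 2)) =
  (1 - x) * (1 - y) * (1 - x * y) by ring.
by rewrite !mulr_gt0 ?subr_gt0 // mulr_ilt1.
Qed.

(** If |a| >= 1 then |b| <= 1, and the same product formula, its first factor now of the other sign,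
    contradicts the inequality. *)
Lemma in_G_of_lt s p : `|p| < 1 -> `|s - s^* * p| < 1 - `|p| ^+ 2 -> in_G s p.
Proof.
have [a [b [-> ->]]] := sum_product_roots s p; rewrite symmetrized_defect normrM.
move=> ab1 def.
have key (x y : K) : `|x| * `|y| < 1 ->
    `|x * (1 - `|y| ^+ 2) + y * (1 - `|x| ^+ 2)| < 1 - (`|x| * `|y|) ^+ 2 -> `|x| < 1.
  move=> xy1 h; rewrite real_ltNge ?normr_real ?real1 //; apply/negP => x1.
  move: h; set u := `|x| in x1 xy1 *; set v := `|y| in xy1 *.
  have u0 : 0 <= u := normr_ge0 x; have v0 : 0 <= v := normr_ge0 y.
  have v1 : v <= 1.
    by apply: le_trans (ltW xy1); rewrite -{1}[v]mul1r ler_wpM2r.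
  have v2 : 0 <= 1 - v ^+ 2 by rewrite subr_ge0 exprn_ile1.
  have u2 : 0 <= u ^+ 2 - 1 by rewrite subr_ge0 exprn_ege1.
  apply/negP; rewrite -real_leNgt ?normr_real ?rpredB ?real1 ?rpredX ?realM ?ger0_real //.
  have -> : x * (1 - v ^+ 2) + y * (1 - u ^+ 2) = x * (1 - v ^+ 2) - y * (u ^+ 2 - 1) by ring.
  apply: le_trans (lerB_dist _ _); rewrite !normrM (ger0_norm v2) (ger0_norm u2) -/u -/v.
  rewrite -subr_ge0.
  have -> : u * (1 - v ^+ 2) - v * (u ^+ 2 - 1) - (1 - (u * v) ^+ 2) =
    (u - 1) * (1 - v) * (1 - u * v) by ring.
  by rewrite !mulr_ge0 ?subr_ge0 // ltW.
exists a, b; split=> //; first exact: key ab1 def.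
by apply: (key b a); [rewrite mulrC | rewrite addrC [`|b| * _]mulrC].
Qed.

Lemma in_G_roots a b : in_G (a + b) (a * b) -> `|a| < 1 /\ `|b| < 1.
Proof.
move=> [x [y [x1 y1 Es Ep]]].
have key c d : c + d = x + y -> c * d = x * y -> `|c| < 1.
  move=> Hs Hp; have : (c - x) * (c - y) = 0.
    have -> : (c - x) * (c - y) = c ^+ 2 - c * (x + y) + x * y by ring.
    by rewrite -Hs -Hp; ring.
  by move/eqP; rewrite mulf_eq0 !subr_eq0 => /orP[] /eqP ->.
by split; [apply: key Es Ep | apply: (key b a); rewrite 1?addrC 1?mulrC].
Qed.

End Bidisk.

(** * Explicit bounds for polynomials in two variables *)

Section UniformBounds.
Variable K : numClosedFieldType.
Implicit Types (q xi : {poly {poly K}}) (u : {poly K}) (p s z w r : K).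
Local Notation ev p := (map_poly (horner_eval p)).

Lemma ev_horner q (S : {poly K}) p : (q.[S]).[p] = (ev p q).[S.[p]].
Proof. by rewrite -[LHS]/(horner_eval p q.[S]) -horner_map. Qed.

Lemma bivariate_bound q (B : K) : 0 <= B -> exists2 M : K, 0 <= M &
  forall p s, `|p| <= 1 -> `|s| <= B -> `|(ev p q).[s]| <= M.
Proof.
move=> B0; elim/poly_ind: q => [|q c [M M0 HM]].
  by exists 0 => // p s _ _; rewrite map_poly0 horner0 normr0.
have [N N0 HN] := poly_bound c (@ler01 K).
exists (M * B + N); first by rewrite addr_ge0 ?mulr_ge0 // ltW.
move=> p s p1 sB; rewrite rmorphD rmorphM /= map_polyX map_polyC /= hornerD hornerMX hornerC.
apply: le_trans (ler_normD _ _) _; rewrite normrM; apply: lerD; last exact: HN.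
by apply: ler_pM => //; apply: HM.
Qed.

Lemma bivariate_lipschitz q (B : K) : 0 <= B -> exists2 L : K, 0 <= L &
  forall p s t, `|p| <= 1 -> `|s| <= B -> `|t| <= B ->
    `|(ev p q).[s] - (ev p q).[t]| <= L * `|s - t|.
Proof.
move=> B0; elim/poly_ind: q => [|q c [L L0 HL]].
  by exists 0 => // p s t _ _ _; rewrite map_poly0 !horner0 subrr normr0 mul0r.
have [M M0 HM] := bivariate_bound q B0.
exists (L * B + M); first by rewrite addr_ge0 ?mulr_ge0.
move=> p s t p1 sB tB; rewrite rmorphD rmorphM /= map_polyX map_polyC /=.
rewrite !hornerD !hornerMX !hornerC.
set qs := (ev p q).[s]; set qt := (ev p q).[t].
have -> : forall c' : K, qs * s + c' - (qt * t + c') = (qs - qt) * s + qt * (s - t) by move=> c'; ring.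
apply: le_trans (ler_normD _ _) _; rewrite !normrM mulrDl; apply: lerD.
  by rewrite mulrAC; apply: ler_pM => //; apply: HL.
by apply: ler_wpM2r => //; apply: HM.
Qed.

Lemma size_horner_affine q : exists D : nat, forall S : {poly K}, (size S <= 2)%N ->
  (size q.[S] <= D)%N.
Proof.
elim/poly_ind: q => [|q c [D HD]]; first by exists 0 => S _; rewrite horner0 size_poly0.
exists (maxn D.+2 (size c)) => S sS; rewrite hornerD hornerMX hornerC.
apply: leq_trans (size_polyD _ _) _; rewrite geq_max leq_maxr andbT leq_max.
apply/orP; left; apply: leq_trans (size_polyMleq _ _) _.
have := leq_add (HD S sS) sS; lia.
Qed.

(* Harnack's inequality for a polynomial without zeros in the disc. *)
Lemma zerofree_lower_bound u p r D : (forall z, `|z| < 1 -> u.[z] != 0) ->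
  (size u <= D)%N -> `|p| <= r -> r < 1 -> `|u.[0]| * (1 - r) ^+ D <= `|u.[p]|.
Proof.
move=> Hu sD pr r1; have [rs Eu] := closed_field_poly_normal u.
have u0 : lead_coef u != 0.
  rewrite lead_coef_eq0; apply: contraTneq (Hu 0 _) => [->|]; last by rewrite normr0 ltr01.
  by rewrite horner0 eqxx.
have srs : (size rs <= D)%N.
  apply: leq_trans sD; rewrite Eu size_scale // size_prod_XsubC_seq.
  exact: leqnSn.
have rs1 z : z \in rs -> 1 <= `|z|.
  move=> zrs; rewrite real_leNgt ?normr_real ?real1 //; apply/negP => /Hu.
  by rewrite Eu hornerZ mulf_eq0 (negPf u0) /= -/(root _ _) root_prod_XsubC zrs.
have r0 : 0 <= r by apply: le_trans pr.
have d0 : 0 <= 1 - r by rewrite subr_ge0 ltW.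
have d1 : 1 - r <= 1 by rewrite gerBl.
apply: le_trans (_ : `|u.[0]| * (1 - r) ^+ (size rs) <= _).
  by apply: ler_wpM2l => //; apply: ler_wiXn2l.
rewrite Eu !hornerZ !normrM -mulrA; apply: ler_wpM2l => //.
elim: rs rs1 {Eu srs} => [|z rs IHrs] rs1.
  by rewrite !big_nil /= expr0 mulr1 -polyC1 !hornerC.
rewrite !big_cons !hornerM !normrM !hornerXsubC sub0r normrN /= exprS mulrACA.
have z1 : 1 <= `|z| by apply: rs1; rewrite mem_head.
apply: ler_pM; rewrite ?mulr_ge0 ?exprn_ge0 //; last first.
  by apply: IHrs => y yrs; apply: rs1; rewrite inE yrs orbT.
rewrite distrC; apply: le_trans (lerB_dist _ _); rewrite mulrBr mulr1 lerD2l lerN2.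
by apply: le_trans pr _; rewrite ler_peMl.
Qed.

(** The product of | 1 - |z| | over the roots z, times the leading coefficient, takes the place of
    compactness of the circle. *)
Lemma circle_zerofree_lower_bound u : (forall w, `|w| = 1 -> u.[w] != 0) ->
  exists2 d, 0 < d & forall w, `|w| = 1 -> d <= `|u.[w]|.
Proof.
move=> Hu; have [rs Eu] := closed_field_poly_normal u.
have u0 : lead_coef u != 0.
  rewrite lead_coef_eq0; apply: contraTneq (Hu 1 (normr1 _)) => ->.
  by rewrite horner0 eqxx.
exists (`|lead_coef u| * \prod_(z <- rs) `|1 - `|z| |).
  rewrite mulr_gt0 ?normr_gt0 // big_seq prodr_gt0 // => z zrs.
  rewrite normr_gt0 subr_eq0 eq_sym; apply/eqP => z1; have := Hu z z1.
  by rewrite Eu hornerZ mulf_eq0 (negPf u0) /= -/(root _ _) root_prod_XsubC zrs.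
move=> w w1; rewrite [in leRHS]Eu hornerZ normrM horner_prod normr_prod.
apply: ler_wpM2l => //; apply: ler_prod => z _; rewrite normr_ge0 hornerXsubC /=.
by rewrite -{1}w1; apply: ler_dist_dist.
Qed.

End UniformBounds.

(** * The factor with roots in the symmetrized bidisk *)

Section RootSeparation.
Variable K : numClosedFieldType.
Hypothesis geometric : forall x e : K, 0 <= x -> x < 1 -> 0 < e ->
  exists N : nat, forall n, (N <= n)%N -> x ^+ n <= e.
Variable xi : {poly {poly K}}.
Local Notation ev p := (map_poly (horner_eval p)).
(** These are the boundary points of G with |p| < 1. *)
Hypothesis zerofree : forall z1 z2 : K, `|z1| = 1 -> `|z2| < 1 ->
  (ev (z1 * z2) xi).[z1 + z2] != 0.
Implicit Types (p s z w r e : K).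

Lemma ev_neq0 p : `|p| < 1 -> ev p xi != 0.
Proof.
move=> p1; have := zerofree (normr1 _) p1; rewrite mul1r.
by apply: contraNneq => ->; rewrite horner0.
Qed.

Lemma zerofree_boundary w p : `|w| = 1 -> `|p| < 1 -> (ev p xi).[w + p / w] != 0.
Proof.
move=> w1 p1; have w0 := circle_neq0 w1; have := zerofree w1 (_ : `|p / w| < 1).
by rewrite normf_div w1 divr1 mulrC divfK //; apply.
Qed.

Definition boundary_sum w : {poly K} := w%:P + w^-1 *: 'X.

Lemma horner_boundary_sum w p : (boundary_sum w).[p] = w + p / w.
Proof. by rewrite hornerD hornerC hornerZ hornerX mulrC. Qed.

(** At p = 0 the boundary slice is the unit circle, where an explicit bound exists; for each fixed w
    Harnack's inequality in p carries it to |p| <= r. *)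
Lemma boundary_lower_bound r : 0 <= r -> r < 1 -> exists2 d, 0 < d &
  forall p w, `|p| <= r -> `|w| = 1 -> d <= `|(ev p xi).[w + p / w]|.
Proof.
move=> r0 r1; have [d d0 Hd] : exists2 d, 0 < d & forall w, `|w| = 1 -> d <= `|(ev 0 xi).[w]|.
  apply: circle_zerofree_lower_bound => w w1.
  by have := zerofree w1 (_ : `|0| < 1); rewrite mulr0 addr0; apply; rewrite normr0 ltr01.
have [D HD] := size_horner_affine xi.
exists (d * (1 - r) ^+ D); first by rewrite mulr_gt0 // exprn_gt0 // subr_gt0.
move=> p w pr w1; rewrite -horner_boundary_sum -ev_horner.
have sS : (size (boundary_sum w) <= 2)%N.
  apply: leq_trans (size_polyD _ _) _; rewrite geq_max (leq_trans (size_polyC_leq1 _)) //=.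
  by apply: leq_trans (size_scale_leq _ _) _; rewrite size_polyX.
apply: le_trans (zerofree_lower_bound _ (HD _ sS) pr r1).
  apply: ler_wpM2r; first by rewrite exprn_ge0 // subr_ge0 ltW.
  by rewrite ev_horner horner_boundary_sum mul0r addr0; apply: Hd.
by move=> z z1; rewrite ev_horner horner_boundary_sum; apply: zerofree_boundary.
Qed.

(** If |z1| is close to 1, then z1 + z2 is close to the boundary point w + p / w with w = z1 / |z1|.
    There xi is bounded away from 0, and it is Lipschitz in s. *)
Lemma root_gap r : 0 <= r -> r < 1 -> exists x, [/\ 0 < x, x < 1 &
  forall p z1 z2, `|p| <= r -> root (ev p xi) (z1 + z2) -> p = z1 * z2 ->
    `|z1| <= x \/ x^-1 <= `|z1|].
Proof.
move=> r0 r1; have [d d0 Hd] := boundary_lower_bound r0 r1.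
have B0 : 0 <= 4 :> K by rewrite ler0n.
have [L L0 HL] := bivariate_lipschitz xi B0.
have L3 : 0 < L * 3 + d *+ 2 by rewrite ltr_wpDl ?mulr_ge0 ?ler0n // pmulrn_lgt0.
(* Chosen so that h <= 1/2 and 2 L h < d. *)
pose h := d / (L * 3 + d *+ 2); have h0 : 0 < h by rewrite divr_gt0.
have h2 : h <= 2^-1.
  rewrite ler_pdivrMr // -ler_pdivrMl ?invr_gt0 ?ltr0n // invrK mulr_natl lerDr.
  by rewrite mulr_ge0 ?ler0n.
have h1 : h < 1 by apply: le_lt_trans h2 _; rewrite invf_lt1 ?ltr0n // ltr1n.
have p1h : 0 < 1 + h by rewrite addr_gt0.
have dh : L * h *+ 3 + d * h *+ 2 = d by rewrite -[RHS](divfK (lt0r_neq0 L3)) -/h; ring.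
set x := (1 + h)^-1; have x0 : 0 < x by rewrite invr_gt0.
have near1 t : x < t -> t < 1 + h -> `|t - 1| <= h.
  move=> xt th; have t0 : 0 < t := lt_trans x0 xt.
  have tR : t - 1 \is Num.real by rewrite rpredB ?real1 // gtr0_real.
  rewrite real_ler_norml //; apply/andP; split; last by rewrite lerBlDl ltW.
  rewrite lerBrDr; apply: le_trans (ltW xt); rewrite -[x]mul1r ler_pdivlMr //.
  have -> : (- h + 1) * (1 + h) = 1 - h ^+ 2 by ring.
  by rewrite gerBl exprn_ge0 // ltW.
exists x; split=> //; first by rewrite invf_lt1 // ltrDl.
move=> p z1 z2 pr rt Ep; rewrite invrK.
have [le_z|lt_z] := real_leP (normr_real z1) (gtr0_real x0); first by left.
have [le_z|gt_z] := real_leP (gtr0_real p1h) (normr_real z1); first by right.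
exfalso; set rho := `|z1| in lt_z gt_z.
have rho0 : 0 < rho := lt_trans x0 lt_z.
have z10 : z1 != 0 by rewrite -normr_gt0.
pose w := z1 / rho; have w1 : `|w| = 1 by rewrite normf_div normr_id divff // lt0r_neq0.
have w0 := circle_neq0 w1.
have Ez1 : z1 = w * rho by rewrite divfK // lt0r_neq0.
have Ez2 : z2 = p / w / rho by rewrite Ep Ez1; field; rewrite lt0r_neq0 // w0.
have n1 : `|rho - 1| <= h by exact: near1.
have n2 : `|rho^-1 - 1| <= h.
  apply: near1; first by rewrite ltf_pV2 ?posrE.
  by rewrite -[1 + h]invrK ltf_pV2 ?posrE ?invr_gt0.
have p1 : `|p| <= 1 by apply: le_trans pr (ltW r1).
have pw : `|p / w| <= 1 by rewrite normf_div w1 divr1.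
have le2 t : 0 < t -> `|t - 1| <= h -> t <= 2.
  move=> t0 ht; rewrite -(gtr0_norm t0) -(subrK 1 t); apply: le_trans (ler_normD _ _) _.
  by rewrite normr1 -[2]/(1 + 1) lerD2r (le_trans ht) // ltW.
have sB : `|z1 + z2| <= 4.
  have -> : 4 = (1 + 1) + (1 + 1) :> K by ring.
  apply: le_trans (ler_normD _ _) _; apply: lerD.
    exact: le2.
  rewrite Ez2 normrM normfV (gtr0_norm rho0) -[1 + 1]mul1r ler_pM ?invr_ge0 ?(ltW rho0) //.
  by apply: le2; rewrite ?invr_gt0.
have sB' : `|w + p / w| <= 4.
  apply: le_trans (ler_normD _ _) _; apply: le_trans (_ : 1 + 1 <= _); last by rewrite (ler_nat K 2 4).
  by apply: lerD; rewrite ?w1.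
have := Hd p w pr w1; have := HL p _ _ p1 sB' sB.
rewrite (rootP rt) subr0 => /(le_trans _) le_d /le_d {le_d}.
have diff : `|w + p / w - (z1 + z2)| <= h + h.
  have -> : w + p / w - (z1 + z2) = - (w * (rho - 1)) - (p / w) * (rho^-1 - 1).
    by rewrite Ez2 {1}Ez1; ring.
  apply: le_trans (ler_normB _ _) _; rewrite normrN normrM [X in _ + X]normrM w1 mul1r; apply: lerD => //.
  by rewrite -[h]mul1r ler_pM.
move=> le_d; have : d <= L * (h + h) by apply: le_trans le_d _; apply: ler_wpM2l.
move=> le_d2; have : L * (h + h) < d.
  rewrite -dh -subr_gt0.
  have -> : L * h *+ 3 + d * h *+ 2 - L * (h + h) = L * h + d * h *+ 2 by ring.
  by rewrite ltr_wpDl ?(mulr_ge0 L0 (ltW h0)) // pmulrn_lgt0 // mulr_gt0.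
by move/(le_lt_trans le_d2); rewrite ltxx.
Qed.

(** Roots with multiplicity; the leading coefficient may vanish at some p, so the length can
    vary. *)
Definition rootseq p : seq K := sval (closed_field_poly_normal (ev p xi)).

Lemma rootseqE p : ev p xi = lead_coef (ev p xi) *: \prod_(s <- rootseq p) ('X - s%:P).
Proof. exact: svalP (closed_field_poly_normal (ev p xi)). Qed.

Lemma mem_rootseq p s : `|p| < 1 -> (s \in rootseq p) = root (ev p xi) s.
Proof.
move=> p1; rewrite [in RHS]rootseqE rootZ ?root_prod_XsubC // lead_coef_eq0.
exact: ev_neq0.
Qed.

Lemma size_rootseq p : `|p| < 1 -> (size (rootseq p) <= size xi)%N.
Proof.
move=> p1; apply: leq_trans (_ : size (ev p xi) <= _)%N; last exact: size_poly.
rewrite rootseqE size_scale ?lead_coef_eq0 ?ev_neq0 // size_prod_XsubC_seq.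
exact: leqnSn.
Qed.

Definition G_roots p := [seq s <- rootseq p | `[< in_G s p >]].

(* Both sums compute, up to an exponentially small error, contour integrals over the
   circle; the boundary of the slice of [G] at height [p] is the ellipse
   [{w + p / w : |w| = 1}]. *)
Lemma sum_boundary_power n z p l : n.-primitive_root z -> (l.+1.*2 < n)%N ->
  \sum_(i < n) (z ^+ i - p / z ^+ i) * (z ^+ i + p / z ^+ i) ^+ l = 0.
Proof.
(* Up to the factor l + 1 the summand is w d/dw of (w + p / w)^(l + 1) = Y(w) / w^(l + 1), which has
   no constant Fourier coefficient; g is this derivative with the denominator cleared. *)
move=> zP ln; pose Y : {poly K} := ('X^2 + p%:P) ^+ l.+1.
pose g := 'X * Y^`() - Y *+ l.+1.
have sY : (size Y <= (l.+1.*2).+1)%N.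
  apply: leq_trans (size_poly_exp_leq _ _) _.
  by rewrite size_addl ?size_polyXn ?(leq_ltn_trans (size_polyC_leq1 _)) //= mul2n.
have sg : (size g <= n)%N.
  apply: leq_trans ln; apply: leq_trans (size_polyD _ _) _; rewrite size_polyN geq_max.
  apply/andP; split; last by rewrite -scaler_nat; apply: leq_trans (size_scale_leq _ _) _.
  rewrite mulrC; have [->|Y0] := eqVneq Y^`() 0; first by rewrite mul0r size_poly0.
  by rewrite size_mulX //; apply: leq_trans sY; apply: lt_size_deriv; apply: contraNneq Y0 => ->; rewrite derivC.
have := @sum_circle_poly _ g n z 1 l.+1 zP _ sg.
have -> : g`_l.+1 = 0 by rewrite coefB coefXM coefMn coef_deriv /= subrr.
rewrite mul0r mulr0 => /(_ _) E.
have z0 : z != 0 by rewrite circle_neq0 // (root_of_unity_norm zP).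
have ln' : (l.+1 < n)%N by lia.
apply: (mulfI (_ : l.+1%:R != 0 :> K)); first by rewrite pnatr_eq0.
rewrite mulr0 -[RHS](E ln') mulr_sumr; apply: eq_bigr => i _; set w := z ^+ i.
have w0 : w != 0 by rewrite expf_neq0.
have -> : z ^+ (i * (n - l.+1)) = w ^- l.+1.
  apply: (mulIf (expf_neq0 l.+1 w0)); rewrite mulVf ?expf_neq0 // -exprM -exprD -mulnDr subnK 1?ltnW //.
  by rewrite mulnC exprM (prim_expr_order zP) expr1n.
have -> : g.[1 * w] = l.+1%:R * ((w ^+ 2 - p) * (w ^+ 2 + p) ^+ l).
  have Bw : ('X^2 + p%:P).[w] = w ^+ 2 + p by rewrite hornerD hornerXn hornerC.
  have Yw : Y.[w] = (w ^+ 2 + p) ^+ l.+1 by rewrite horner_exp Bw.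
  have Y'w : Y^`().[w] = (w *+ 2) * (w ^+ 2 + p) ^+ l *+ l.+1.
    rewrite /Y deriv_exp derivD derivXn derivC addr0 /= hornerMn hornerM horner_exp Bw.
    by rewrite hornerMn expr1 hornerX.
  rewrite mul1r hornerD hornerN hornerM hornerX hornerMn Yw Y'w [RHS]mulr_natl (exprS _ l).
  by rewrite mulrnAr -mulrnBl; congr (_ *+ _); move: (_ ^+ l) => Bl; ring.
have -> : w - p / w = (w ^+ 2 - p) / w by field.
have -> : w + p / w = (w ^+ 2 + p) / w by field.
rewrite expr_div_n (exprS w l); have wl0 : w ^+ l != 0 by rewrite expf_neq0.
move: (w ^+ l) wl0 ((w ^+ 2 + p) ^+ l) => wl wl0 Bl.
by field; rewrite w0 wl0.
Qed.

Lemma sum_cauchy_kernel n z y : n.-primitive_root z -> y ^+ n != 1 ->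
  \sum_(i < n) y / (z ^+ i - y) = n%:R * (y ^+ n / (1 - y ^+ n)).
Proof.
move=> zP yn; have n0 := prim_order_gt0 zP.
pose s := [seq z ^+ i | i <- index_iota 0 n].
have Es : \prod_(x <- s) ('X - x%:P) = 'X^n - 1.
  by rewrite big_map factor_Xn_sub_1.
have ys : y \notin s.
  by rewrite -root_prod_XsubC Es /root hornerD hornerN hornerXn -polyC1 hornerC subr_eq0.
have := log_deriv_prod_XsubC ys; rewrite Es derivB derivXn derivC subr0.
rewrite hornerMn hornerXn hornerD hornerN hornerXn -polyC1 hornerC big_map big_mkord => E.
have yn1 : 1 - y ^+ n != 0 by rewrite subr_eq0 eq_sym.
have yn2 : y ^+ n - 1 != 0 by rewrite subr_eq0.
transitivity (- y * \sum_(i < n) (y - z ^+ i)^-1).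
  by rewrite mulr_sumr; apply: eq_bigr => i _; rewrite mulNr -mulrN -invrN opprB.
have yE : y ^+ n = y * y ^+ n.-1 by rewrite -exprS prednK.
rewrite -E -mulr_natr; move: yn1 yn2; rewrite yE.
move: (n%:R : K) (y ^+ n.-1) => N t yn1 yn2.
by field; rewrite yn1 yn2.
Qed.

(** The error of the Cauchy average: exponentially close to 0 for |y| < 1 and to -1 for |y| > 1. *)
Let err n y : K := y ^+ n / (1 - y ^+ n).

(** The kernel is w s'(w) / (s(w) - s) for s(w) = w + p / w, and splits as 1 + z1 / (w - z1) + z2 /
    (w - z2). Replacing s(w)^j by s^j costs only terms that average to 0. The result is near s^j if
    both z1 and z2 lie in the disc and near 0 if only one does. *)
Lemma kernel_average n z j z1 z2 : n.-primitive_root z -> (j.*2 < n)%N ->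
    z1 ^+ n != 1 -> z2 ^+ n != 1 ->
  n%:R^-1 * \sum_(i < n) (z ^+ i + z1 * z2 / z ^+ i) ^+ j *
    ((z ^+ i - z1 * z2 / z ^+ i) / (z ^+ i + z1 * z2 / z ^+ i - (z1 + z2))) =
  (z1 + z2) ^+ j * (1 + err n z1 + err n z2).
Proof.
move=> zP jn y1 y2; set p := z1 * z2; set s := z1 + z2.
have n0 : n%:R != 0 :> K by rewrite pnatr_eq0 -lt0n (prim_order_gt0 zP).
pose w i := z ^+ i; pose sw i := w i + p / w i.
have w0 i : w i != 0 by rewrite expf_neq0 // circle_neq0 // (root_of_unity_norm zP).
have wn i : w i ^+ n = 1 by rewrite -exprM mulnC exprM (prim_expr_order zP) expr1n.
have wy i y : y ^+ n != 1 -> w i - y != 0.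
  by move=> yn; rewrite subr_eq0; apply: contraNneq yn => <-; rewrite wn.
have fac i : sw i - s = (w i - z1) * (w i - z2) / w i by rewrite /sw /s /p; field.
have sws i : sw i - s != 0 by rewrite fac !mulf_neq0 ?invr_eq0 ?wy.
have ker i : (w i - p / w i) / (sw i - s) = 1 + z1 / (w i - z1) + z2 / (w i - z2).
  by rewrite fac /p; field; rewrite w0 !wy.
have term i : sw i ^+ j * ((w i - p / w i) / (sw i - s)) =
    s ^+ j * (1 + z1 / (w i - z1) + z2 / (w i - z2)) +
    \sum_(l < j) s ^+ l * ((w i - p / w i) * sw i ^+ (j.-1 - l)).
  have -> : sw i ^+ j = s ^+ j + (sw i - s) * \sum_(l < j) sw i ^+ (j.-1 - l) * s ^+ l.
    by rewrite -subrXX; ring.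
  rewrite mulrDl {1}ker; congr (_ + _).
  rewrite mulrAC [(sw i - s) * _]mulrC divfK // mulr_sumr.
  by apply: eq_bigr => l _; ring.
transitivity (n%:R^-1 * \sum_(i < n) sw i ^+ j * ((w i - p / w i) / (sw i - s))); first by [].
under eq_bigr do rewrite term; rewrite big_split /= [X in _ + X]exchange_big /=.
rewrite [X in _ + X]big1 ?addr0; last first.
  move=> l _; rewrite -mulr_sumr sum_boundary_power ?mulr0 //.
  apply: leq_ltn_trans jn; rewrite leq_double.
  by have := ltn_ord l; case: (j) l => [|j'] l //= lj; rewrite ltnS leq_subr.
rewrite -mulr_sumr mulrCA; congr (_ * _).
rewrite !big_split /= sumr_const card_ord !sum_cauchy_kernel // -/(err n z1) -/(err n z2).
by field.
Qed.

Lemma err_small n x y : 0 <= x -> x ^+ n <= 2^-1 -> `|y| <= x -> `|err n y| <= 2 * x ^+ n.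
Proof.
move=> x0 xn yx.
have yn : `|y ^+ n| <= x ^+ n by rewrite normrX; apply: lerXn2r; rewrite ?nnegrE.
have den : 2^-1 <= `|1 - y ^+ n|.
  apply: le_trans (lerB_dist _ _); rewrite normr1 lerBrDl.
  apply: le_trans (lerD (le_trans yn xn) (lexx _)) _.
  by have -> : 2^-1 + 2^-1 = 1 :> K by field.
rewrite normf_div ler_pdivrMr; last by apply: lt_le_trans den; rewrite invr_gt0 ltr0n.
apply: le_trans yn _; apply: le_trans (_ : 2 * x ^+ n * 2^-1 <= _).
  by rewrite mulrAC mulfV ?pnatr_eq0 // mul1r.
by apply: ler_wpM2l => //; rewrite mulr_ge0 ?exprn_ge0 // ler0n.
Qed.

Lemma err_large n x y : 0 < x -> x ^+ n <= 2^-1 -> x^-1 <= `|y| -> y ^+ n != 1 ->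
  `|1 + err n y| <= 2 / `|y| ^+ n.
Proof.
move=> x0 xn yx yn; have y0 : 0 < `|y| by apply: lt_le_trans yx; rewrite invr_gt0.
have yn0 : 0 < `|y| ^+ n by rewrite exprn_gt0.
have yn' : 1 - y ^+ n != 0 by rewrite subr_eq0 eq_sym.
have -> : 1 + err n y = (1 - y ^+ n)^-1 by rewrite /err; field.
have big : 2 <= `|y| ^+ n.
  apply: le_trans (_ : x^-1 ^+ n <= _).
    by rewrite exprVn -[2]invrK lef_pV2 ?posrE ?invr_gt0 ?ltr0n // exprn_gt0.
  by apply: lerXn2r; rewrite ?nnegrE ?(ltW y0) // invr_ge0 ltW.
have half : `|y| ^+ n / 2 <= `|1 - y ^+ n|.
  rewrite distrC; apply: le_trans (lerB_dist _ _); rewrite normr1 normrX.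
  rewrite lerBrDl -lerBrDr; have -> : `|y| ^+ n - `|y| ^+ n / 2 = `|y| ^+ n / 2 by field.
  by rewrite ler_pdivlMr ?ltr0n // mul1r.
rewrite normfV -[leRHS]invrK lef_pV2 ?posrE ?normr_gt0 //; last first.
  by rewrite invr_gt0 divr_gt0 ?ltr0n.
by rewrite invfM invrK mulrC.
Qed.

(** Since |z1 z2| < 1, at most one of the two is outside the disc. If z2 is, s^j may grow like
    |z2|^j while the error decays like |z2|^-n, whence the exponent n - j. *)
Lemma kernel_error n j x p z1 z2 : (j <= n)%N -> 0 < x -> x < 1 -> x ^+ n <= 2^-1 ->
    `|p| < 1 -> p = z1 * z2 -> z1 ^+ n != 1 -> z2 ^+ n != 1 ->
    `|z1| <= x \/ x^-1 <= `|z1| -> `|z2| <= x \/ x^-1 <= `|z2| ->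
  `|(z1 + z2) ^+ j * (1 + err n z1 + err n z2) -
    (if `[< in_G (z1 + z2) p >] then (z1 + z2) ^+ j else 0)| <= 2 ^+ (j + 2) * x ^+ (n - j).
Proof.
move=> jn x0 x1 xn p1 Ep y1 y2 g1 g2; have x0' := ltW x0.
have main u v : p = u * v -> v ^+ n != 1 -> x^-1 <= `|v| ->
    `|(u + v) ^+ j * (1 + err n u + err n v) -
    (if `[< in_G (u + v) p >] then (u + v) ^+ j else 0)| <= 2 ^+ (j + 2) * x ^+ (n - j).
  move=> Euv vn xv.
  have xi1 : 1 < x^-1 by rewrite invf_gt1.
  have v1 : 1 < `|v| by apply: lt_le_trans xv.
  have v0 : 0 < `|v| by apply: lt_trans v1.
  have -> : `[< in_G (u + v) p >] = false.
    apply/asboolPn; rewrite Euv => /in_G_roots[_ /(lt_trans v1)]; rewrite ltxx //.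
  pose x' := `|v|^-1; have x'0 : 0 <= x' by rewrite invr_ge0.
  have x'x : x' <= x by rewrite -[x]invrK lef_pV2 ?posrE ?invr_gt0.
  have x'n : x' ^+ n <= 2^-1 by apply: le_trans xn; apply: lerXn2r; rewrite ?nnegrE.
  have ux' : `|u| <= x'.
    by rewrite -[x']mul1r ler_pdivlMr // -normrM -Euv ltW.
  rewrite subr0 normrM normrX addrAC -[1 + _ + _]addrA.
  have le_uv : `|u + v| <= 2 * `|v|.
    apply: le_trans (ler_normD _ _) _; rewrite mulr_natl mulr2n lerD2r.
    apply: le_trans ux' _; apply: le_trans (ltW v1).
    by rewrite invf_le1 // ltW.
  have le_err : `|1 + (err n v + err n u)| <= 4 * x' ^+ n.
    rewrite addrA; apply: le_trans (ler_normD _ _) _.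
    have -> : 4 * x' ^+ n = 2 / `|v| ^+ n + 2 * x' ^+ n by rewrite /x' exprVn; ring.
    by apply: lerD; [apply: err_large x0 xn xv vn | apply: err_small].
  apply: le_trans (_ : (2 * `|v|) ^+ j * (4 * x' ^+ n) <= _).
    by apply: ler_pM; rewrite ?exprn_ge0 //; apply: lerXn2r; rewrite ?nnegrE ?mulr_ge0 ?ler0n.
  have -> : (2 * `|v|) ^+ j * (4 * x' ^+ n) = 2 ^+ (j + 2) * x' ^+ (n - j).
    rewrite exprMn -{1}(subnKC jn) !exprD /x' !exprVn.
    have vj : `|v| ^+ j != 0 by rewrite expf_neq0 // lt0r_neq0.
    have vj' : `|v| ^+ (n - j) != 0 by rewrite expf_neq0 // lt0r_neq0.
    move: (`|v| ^+ j) (`|v| ^+ (n - j)) vj vj' => X Y X0 Y0.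
    by field; rewrite X0 Y0.
  by apply: ler_wpM2l; rewrite ?exprn_ge0 ?ler0n //; apply: lerXn2r; rewrite ?nnegrE.
case: g2 => [z2x|]; last exact: main.
case: g1 => [z1x|]; last first.
  have -> : 1 + err n z1 + err n z2 = 1 + err n z2 + err n z1 by ring.
  by rewrite [z1 + z2]addrC; apply: main => //; rewrite mulrC.
have -> : `[< in_G (z1 + z2) p >].
  by apply/asboolP; exists z1, z2; split=> //; apply: le_lt_trans x1.
have -> : (z1 + z2) ^+ j * (1 + err n z1 + err n z2) - (z1 + z2) ^+ j =
  (z1 + z2) ^+ j * (err n z1 + err n z2) by ring.
rewrite normrM normrX exprD -mulrA; apply: ler_pM; rewrite ?exprn_ge0 //.
  apply: lerXn2r; rewrite ?nnegrE ?ler0n //; apply: le_trans (ler_normD _ _) _.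
  by rewrite -[2]/(1 + 1) lerD // (le_trans _ (ltW x1)).
apply: le_trans (_ : 2 ^+ 2 * x ^+ n <= _).
  apply: le_trans (ler_normD _ _) _.
  have -> : 2 ^+ 2 * x ^+ n = 2 * x ^+ n + 2 * x ^+ n by ring.
  by apply: lerD; apply: err_small.
by apply: ler_wpM2l; rewrite ?exprn_ge0 ?ler0n // ler_wiXn2l ?leq_subr // ltW.
Qed.

(** The averaged argument principle is rational in p without poles in the disc, hence analytic; the
    gap around the boundary of G makes its error uniform on |p| <= r. *)
Lemma power_sum_analytic j : disc_analytic (fun p => \sum_(s <- G_roots p) s ^+ j).
Proof.
apply: disc_analytic_lim => r e r0 r1 e0.
have [x [x0 x1 gap]] := root_gap r0 r1.
pose d := size xi.
have half0 : 0 < 2^-1 :> K by rewrite invr_gt0 ltr0n.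
have [N1 HN1] := geometric (ltW x0) x1 half0.
have B0 : 0 < d%:R * 2 ^+ (j + 2) + 1 :> K by rewrite ltr_wpDl ?mulr_ge0 ?exprn_ge0 ?ler0n.
have [N2 HN2] := geometric (ltW x0) x1 (divr_gt0 e0 B0).
have [n [n0 nN1 nN2 jn j2n]] : exists n, [/\ (0 < n)%N, (N1 <= n)%N, (N2 <= n - j)%N,
    (j <= n)%N & (j.*2 < n)%N].
  by clear; exists (N1 + N2 + j.*2 + j).+1; split; lia.
have [z zP] := @prim_root_exists K n n0.
have w1 i : `|z ^+ i| = 1 by rewrite normrX (root_of_unity_norm zP) expr1n.
pose S i := boundary_sum (z ^+ i).
pose g p := n%:R^-1 * \sum_(i < n) (z ^+ i + p / z ^+ i) ^+ j *
    ((z ^+ i - p / z ^+ i) * ((ev p xi)^`().[z ^+ i + p / z ^+ i] / (ev p xi).[z ^+ i + p / z ^+ i])).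
exists g.
  apply: (@eq_disc_analytic _ (fun p => (n%:R^-1)%:P.[p] * \sum_(i < n) (S i ^+ j).[p] *
    (((z ^+ i)%:P - (z ^+ i)^-1 *: 'X).[p] * (xi^`().[S i].[p] * (xi.[S i].[p])^-1)))).
    move=> p _; rewrite hornerC; congr (_ * _); apply: eq_bigr => i _.
    rewrite horner_exp !ev_horner !horner_boundary_sum hornerD hornerN hornerC hornerZ hornerX.
    by rewrite -deriv_map [_^-1 * p]mulrC.
  apply: disc_analytic_mul; first exact: disc_analytic_poly.
  apply: disc_analytic_sum => i.
  apply: disc_analytic_mul; first exact: disc_analytic_poly.
  apply: disc_analytic_mul; first exact: disc_analytic_poly.
  apply: disc_analytic_mul; first exact: disc_analytic_poly.
  apply: (disc_analytic_inv geometric) => p p1.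
  by rewrite ev_horner horner_boundary_sum zerofree_boundary.
move=> p pr; have p1 : `|p| < 1 := le_lt_trans pr r1.
have logd i : (ev p xi)^`().[z ^+ i + p / z ^+ i] / (ev p xi).[z ^+ i + p / z ^+ i] =
    \sum_(s <- rootseq p) (z ^+ i + p / z ^+ i - s)^-1.
  have bs := zerofree_boundary (w1 i) p1.
  rewrite -log_deriv_prod_XsubC; last by rewrite mem_rootseq.
  have [c c0 Er] : exists2 c, c != 0 & ev p xi = c *: \prod_(s <- rootseq p) ('X - s%:P).
    by exists (lead_coef (ev p xi)); [rewrite lead_coef_eq0 ev_neq0 | apply: rootseqE].
  move: bs; rewrite Er derivZ !hornerZ mulf_eq0 negb_or => /andP[_ bs].
  by field; rewrite c0 bs.
have gE : g p = \sum_(s <- rootseq p) n%:R^-1 * \sum_(i < n) (z ^+ i + p / z ^+ i) ^+ j *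
    ((z ^+ i - p / z ^+ i) / (z ^+ i + p / z ^+ i - s)).
  rewrite -mulr_sumr exchange_big /=; congr (_ * _); apply: eq_bigr => i _.
  by rewrite logd mulrA mulr_sumr; apply: eq_bigr => s _; rewrite mulrA.
rewrite distrC gE big_filter [X in _ - X]big_mkcond -sumrB.
apply: le_trans (_ : \sum_(s <- rootseq p) 2 ^+ (j + 2) * x ^+ (n - j) <= _); last first.
  rewrite big_const_seq count_predT iter_addr_0.
  apply: le_trans (_ : (2 ^+ (j + 2) * x ^+ (n - j)) *+ d <= _).
    by apply: ler_wpMn2l; [rewrite mulr_ge0 ?exprn_ge0 ?ler0n // ltW | apply: size_rootseq].
  rewrite -mulr_natl mulrA; apply: le_trans (_ : (d%:R * 2 ^+ (j + 2) + 1) * x ^+ (n - j) <= _).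
    by rewrite mulrDl lerDl mul1r exprn_ge0 // ltW.
  by rewrite mulrC -ler_pdivlMr //; apply: HN2.
rewrite big_seq [leRHS]big_seq; apply: le_trans (ler_norm_sum _ _ _) _.
apply: ler_sum => s; rewrite mem_rootseq // => rs.
have [z1 [z2 [Es Ep]]] := sum_product_roots s p; rewrite Es in rs *.
have g1 := gap p z1 z2 pr rs Ep.
have g2 : `|z2| <= x \/ x^-1 <= `|z2|.
  by apply: (gap p z2 z1 pr); rewrite 1?addrC 1?mulrC.
have xn : x ^+ n <= 2^-1 := HN1 n nN1.
have yn y : `|y| <= x \/ x^-1 <= `|y| -> y ^+ n != 1.
  move=> gy; apply/eqP => /(congr1 Num.norm); rewrite normrX normr1 => /eqP.
  rewrite pexpr_eq1 // => /eqP y1; case: gy; rewrite y1; apply/negP; rewrite -real_ltNge ?real1 ?gtr0_real ?invr_gt0 //.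
  by rewrite invf_gt1.
rewrite Ep kernel_average ?yn //.
by rewrite -Ep; apply: kernel_error => //; exact: yn.
Qed.

Lemma poly_eq0_disc (f : {poly K}) : (forall p, `|p| < 1 -> f.[p] = 0) -> f = 0.
Proof.
move=> Hf; have two0 : 2 != 0 :> K by rewrite pnatr_eq0.
have : f \Po (2^-1 *: 'X) = 0.
  apply: (@circle_poly_eq _ _ _ 1) => [|p p1 _]; first exact: oner_neq0.
  rewrite horner_comp hornerZ hornerX horner0 Hf // normrM p1 mulr1 normfV normr_nat.
  by rewrite invf_lt1 ?ltr0n // ltr1n.
move/(congr1 (fun g => g \Po (2 *: 'X))); rewrite -comp_polyA comp_polyZ comp_polyX scalerA.
by rewrite mulVf // scale1r comp_polyXr comp_poly0.
Qed.

Lemma mem_G_roots p s : `|p| < 1 -> (s \in G_roots p) <-> root (ev p xi) s /\ in_G s p.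
Proof.
move=> p1; rewrite mem_filter mem_rootseq //; split=> [/andP[/asboolP]|[rs /asboolP ->]] //.
Qed.

(** In G one has s = conj s p up to a defect of order 1 - |p|; summed over the roots, this is the
    hypothesis of [reflected_poly]. *)
Lemma G_root_power_defect j p s : in_G s p ->
  `|s ^+ j - p ^+ j * (s ^+ j)^*| <= (j%:R * 2 ^+ j * 2) * (1 - `|p|).
Proof.
move=> sG; have [p1 s2 def] := in_G_lt sG.
have -> : s ^+ j - p ^+ j * (s ^+ j)^* = s ^+ j - (s^* * p) ^+ j.
  by rewrite rmorphXn exprMn mulrC.
have ps2 : `|s^* * p| <= 2.
  by rewrite normrM norm_conjC -[2]mulr1 ler_pM // ltW.
have -> : (j%:R * 2 ^+ j * 2) * (1 - `|p|) = (2 * (1 - `|p|)) * (j%:R * 2 ^+ j) by ring.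
rewrite subrXX normrM; apply: ler_pM => //.
  apply: le_trans (ltW def) _.
  have -> : 1 - `|p| ^+ 2 = (1 + `|p|) * (1 - `|p|) by ring.
  by apply: ler_wpM2r; [rewrite subr_ge0 ltW | rewrite -[2]/(1 + 1) lerD2l ltW].
apply: le_trans (ler_norm_sum _ _ _) _; rewrite -[j in j%:R]card_ord -sumr_const mulr_suml.
apply: ler_sum => l _; rewrite mul1r normrM !normrX.
have [j0|j0] := posnP j; first by case: l; rewrite j0.
apply: le_trans (_ : 2 ^+ (j.-1 - l) * 2 ^+ l <= _).
  by apply: ler_pM; rewrite ?exprn_ge0 //; apply: lerXn2r; rewrite ?nnegrE ?ler0n.
rewrite -exprD subnK; last by rewrite -ltnS prednK.
by apply: ler_weXn2l; rewrite ?leq_pred // ler1n.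
Qed.

Lemma size_G_roots p : `|p| < 1 -> (size (G_roots p) <= size xi)%N.
Proof.
by move=> p1; apply: leq_trans (size_rootseq p1); rewrite size_filter count_size.
Qed.

Lemma power_sum_polynomial j : exists2 c : {poly K}, (size c <= j.+1)%N &
  forall p, `|p| < 1 -> c.[p] = \sum_(s <- G_roots p) s ^+ j.
Proof.
pose B : K := (size xi)%:R * (j%:R * 2 ^+ j * 2).
have C0 : 0 <= j%:R * 2 ^+ j * 2 :> K by rewrite !mulr_ge0 ?exprn_ge0 ?ler0n.
have B0 : 0 <= B by rewrite mulr_ge0 ?ler0n.
have [|c sc cE] := reflected_poly (power_sum_analytic j) B0 (j := j); last by exists c => // p /cE.
move=> p p1; rewrite rmorph_sum mulr_sumr -sumrB /=.
apply: le_trans (ler_norm_sum _ _ _) _.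
apply: le_trans (_ : \sum_(s <- G_roots p) (j%:R * 2 ^+ j * 2) * (1 - `|p|) <= _).
  rewrite big_seq [leRHS]big_seq; apply: ler_sum => s /(mem_G_roots _ p1)[_ sG].
  exact: G_root_power_defect.
rewrite big_const_seq count_predT iter_addr_0 -[leLHS]mulr_natl.
have -> : B * (1 - `|p|) = (size xi)%:R * (j%:R * 2 ^+ j * 2 * (1 - `|p|)) by rewrite /B; ring.
by apply: ler_wpM2r; rewrite ?ler_nat ?size_G_roots // mulr_ge0 // subr_ge0 ltW.
Qed.

(** Over the disc q divides xi fibrewise, so the remainder of the division by the monic q vanishes
    there and hence identically. Over the disc the cofactor h keeps exactly the roots outside G. *)
Lemma G_factorization : exists q h : {poly {poly K}},
  [/\ q \is monic, xi = h * q,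
      forall p, `|p| < 1 -> ev p q = \prod_(s <- G_roots p) ('X - s%:P) &
      forall p s, in_G s p -> (ev p h).[s] != 0].
Proof.
(* The power sum of order 0 is a constant polynomial, so the number of roots in G does not depend on
   p. *)
have [c0 sc0 c0E] := power_sum_polynomial 0.
pose n := size (G_roots 0).
have sn p : `|p| < 1 -> size (G_roots p) = n.
  have n1 : `|0 : K| < 1 by rewrite normr0 ltr01.
  move=> p1; have := c0E p p1; have := c0E 0 n1; rewrite [c0](size1_polyC sc0) !hornerC => ->.
  under eq_bigr do rewrite expr0; under [RHS]eq_bigr do rewrite expr0.
  by rewrite !big_const_seq !count_predT !iter_addr_0 => /eqP; rewrite eqr_nat => /eqP.
have [|q [mq sq qE]] := @poly_of_power_sums K (fun p => `|p| < 1) G_roots n sn.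
  by move=> k; have [c _ cE] := power_sum_polynomial k; exists c.
pose h := Pdiv.CommonRing.rdivp xi q; pose rem := Pdiv.CommonRing.rmodp xi q.
have Exi : xi = h * q + rem by apply: Pdiv.RingMonic.rdivp_eq.
have split_roots p : `|p| < 1 -> ev p xi =
    (lead_coef (ev p xi) *: \prod_(s <- rootseq p | ~~ `[< in_G s p >]) ('X - s%:P)) * ev p q.
  move=> p1; rewrite {1}rootseqE (bigID (fun s => `[< in_G s p >])) /= qE // /G_roots big_filter.
  by rewrite -scalerAl mulrC.
have rem0 : rem = 0.
  apply/polyP => i; rewrite coef0; apply: poly_eq0_disc => p p1.
  rewrite -coef_ev.
  suff -> : ev p rem = 0 by rewrite coef0.
  have dvd : ev p q %| ev p rem.
    have -> : ev p rem = ev p xi - ev p h * ev p q.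
      by rewrite -rmorphM -rmorphB /= {1}Exi addrC addKr.
    by rewrite split_roots // -mulrBl dvdp_mulIr.
  apply/eqP/negPn/negP => rem_neq0.
  have := dvdp_leq rem_neq0 dvd; rewrite size_ev_monic // leqNgt => /negP; apply.
  apply: leq_ltn_trans (size_poly _ _) _.
  by rewrite Pdiv.CommonRing.ltn_rmodp monic_neq0.
rewrite rem0 addr0 in Exi; exists q, h; split=> // p s sG.
have [p1 _ _] := in_G_lt sG.
have -> : ev p h = lead_coef (ev p xi) *: \prod_(s <- rootseq p | ~~ `[< in_G s p >]) ('X - s%:P).
  apply: (mulIf (monic_neq0 (monic_ev p mq))); rewrite -split_roots //.
  by rewrite -rmorphM -Exi.
rewrite hornerZ mulf_neq0 ?lead_coef_eq0 ?ev_neq0 //.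
rewrite -big_filter -/(root _ s) root_prod_XsubC mem_filter.
by apply/negP => /andP[/asboolP].
Qed.

End RootSeparation.

(** * Limits of roots at the circle *)

Section BoundaryRoots.
Variable K : numClosedFieldType.
Implicit Types (p s e : K).
Local Notation ev p := (map_poly (horner_eval p)).

Lemma prod_lower_bound (rs : seq K) s e : 0 <= e ->
  (forall x, x \in rs -> e <= `|s - x|) ->
  e ^+ size rs <= `|(\prod_(x <- rs) ('X - x%:P)).[s]|.
Proof.
move=> e0; elim: rs => [|x rs IHrs] Hrs; first by rewrite big_nil -polyC1 hornerC normr1.
rewrite big_cons hornerM hornerXsubC normrM /= exprS; apply: ler_pM; rewrite ?exprn_ge0 //.
  by apply: Hrs; rewrite mem_head.
by apply: IHrs => y yrs; apply: Hrs; rewrite inE yrs orbT.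
Qed.

(** If every root over p' were farther than e from s, then |q(p', s)| >= e^n, while moving p by d
    changes q by at most L d < e^n. *)
Lemma root_approach (q : {poly {poly K}}) p s e : q \is monic -> `|p| = 1 ->
    root (ev p q) s -> 0 < e -> e < 1 ->
  exists p' s', [/\ `|p'| < 1, `|p' - p| <= e, `|s' - s| <= e, 1 - `|p'| <= e & root (ev p' q) s'].
Proof.
move=> mq p1 rs e0 e1.
have [L L0 HL] := poly_lipschitz q.[s%:P] (@ler01 K).
pose n := (size q).-1.
have L1 : 0 < L + 1 by rewrite ltr_wpDl.
pose d := e ^+ n.+1 / (L + 1); have d0 : 0 < d by rewrite divr_gt0 ?exprn_gt0.
have de : d <= e.
  rewrite ler_pdivrMr // exprS; apply: ler_pM; rewrite ?exprn_ge0 ?(ltW e0) //.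
  by apply: le_trans (exprn_ile1 _ _ _) _; rewrite ?(ltW e0) ?(ltW e1) // lerDr.
have d1 : d < 1 := le_lt_trans de e1.
pose p' := (1 - d) * p.
have np' : `|p'| = 1 - d by rewrite normrM p1 mulr1 gtr0_norm // subr_gt0.
have pp' : `|p' - p| = d.
  have -> : p' - p = - (d * p) by rewrite /p'; ring.
  by rewrite normrN normrM p1 mulr1 gtr0_norm.
exists p'; have [r Er] := closed_field_poly_normal (ev p' q).
rewrite (monicP (monic_ev p' mq)) scale1r in Er.
have szr : size r = n.
  by apply/eqP; rewrite -eqSS -size_prod_XsubC_seq -Er size_ev_monic // prednK // lt0n size_poly_eq0 monic_neq0.
have [/hasP[s' s'r close]|/hasPn far] := boolP (has (fun x => `|x - s| <= e) r).
  exists s'; split=> //; first by rewrite np' gtrBl.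
  - by rewrite pp'.
  - by rewrite np' subKr.
  by rewrite Er root_prod_XsubC.
have : e ^+ n <= `|(ev p' q).[s]|.
  rewrite Er -szr; apply: prod_lower_bound; first exact: ltW.
  move=> x /far; rewrite -real_ltNge ?normr_real ?gtr0_real // => /ltW.
  by rewrite distrC.
have -> : `|(ev p' q).[s]| = `|(q.[s%:P]).[p'] - (q.[s%:P]).[p]|.
  by rewrite !ev_horner !hornerC (rootP rs) subr0.
have /HL/(_ _) h : `|p'| <= 1 by rewrite np' gerBl ltW.
have {}h := h p; rewrite p1 lexx in h; have {}h := h isT.
move/le_trans/(_ h); rewrite pp' => le1.
have : L * d < e ^+ n.
  rewrite mulrA ltr_pdivrMr //; apply: le_lt_trans (_ : (L * 1) * e ^+ n < _).
    rewrite exprS -!mulrA; apply: ler_wpM2l => //; rewrite mul1r.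
    by rewrite ger_pMl ?exprn_gt0 // ltW.
  by rewrite mulr1 mulrC ltr_pM2l ?exprn_gt0 // ltrDl.
by move/(le_lt_trans le1); rewrite ltxx.
Qed.

(** The limit of |s - conj s p| < 1 - |p|^2 and |s| <= 2 along roots approaching from inside the
    disc. *)
Lemma circle_roots (q : {poly {poly K}}) : q \is monic ->
    (forall p s, `|p| < 1 -> root (ev p q) s -> in_G s p) ->
  forall p s, `|p| = 1 -> root (ev p q) s -> s = p * s^* /\ `|s| <= 2.
Proof.
move=> mq qG p s p1 rs.
have app e : 0 < e -> e < 1 -> `|s - s^* * p| <= 6 * e /\ `|s| <= 2 + e.
  move=> e0 e1; have [p' [s' [p'1 pp ss pe rs']]] := root_approach mq p1 rs e0 e1.
  have [_ s2 def] := in_G_lt (qG _ _ p'1 rs').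
  split; last first.
    rewrite -(subrK s' s) addrC; apply: le_trans (ler_normD _ _) _.
    by apply: lerD => //; rewrite distrC.
  have -> : s - s^* * p = (s - s') + (s' - s'^* * p') + s'^* * (p' - p) + (s' - s)^* * p.
    by rewrite rmorphB; ring.
  have -> : 6 * e = e + 2 * e + 2 * e + e by ring.
  apply: le_trans (ler_normD _ _) _; apply: lerD; last by rewrite normrM p1 mulr1 norm_conjC.
  apply: le_trans (ler_normD _ _) _; apply: lerD; last by rewrite normrM norm_conjC ler_pM.
  apply: le_trans (ler_normD _ _) _; apply: lerD; first by rewrite distrC.
  apply: le_trans (ltW def) _.
  have -> : 1 - `|p'| ^+ 2 = (1 + `|p'|) * (1 - `|p'|) by ring.
  apply: ler_pM; [by rewrite addr_ge0 | by rewrite subr_ge0 ltW | | exact: pe].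
  by rewrite -[2]/(1 + 1) lerD2l ltW.
split.
  apply/eqP; rewrite -subr_eq0 mulrC; apply/eqP.
  apply/eqP; rewrite -normr_eq0; apply/negPn/negP => nx.
  set x := `| _ | in nx; have x0 : 0 < x by rewrite lt_def nx normr_ge0.
  pose e := x / (6 * (x + 1)); have x1 : 0 < x + 1 by rewrite addr_gt0.
  have e0 : 0 < e by rewrite divr_gt0 ?mulr_gt0 ?ltr0n.
  have xlt : x < x + 1 by rewrite ltrDl.
  have e1 : e < 1.
    rewrite ltr_pdivrMr ?mulr_gt0 ?ltr0n // mul1r; apply: lt_le_trans xlt _.
    by rewrite ler_peMl ?(ltW x1) // ler1n.
  have [le6 _] := app e e0 e1; have : x <= x / (x + 1).
    apply: le_trans le6 _; suff -> : 6 * e = x / (x + 1) by [].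
    by rewrite /e; field; rewrite lt0r_neq0.
  rewrite ler_pdivlMr // ger_pMr // gerDr => /(lt_le_trans x0).
  by rewrite ltxx.
rewrite real_leNgt ?normr_real ?realn //; apply/negP => lt2.
pose e := (`|s| - 2) / (`|s|); have s0 : 0 < `|s| by apply: lt_trans lt2; rewrite ltr0n.
have e0 : 0 < e by rewrite divr_gt0 // subr_gt0.
have e1 : e < 1 by rewrite ltr_pdivrMr // mul1r gtrBl ltr0n.
have [_] := app e e0 e1; rewrite addrC -lerBlDr; apply/negP.
rewrite -real_ltNge ?rpredB ?realn ?normr_real ?gtr0_real //.
rewrite /e ltr_pdivrMr // ltr_pMr ?subr_gt0 //; apply: lt_trans lt2; rewrite (ltr_nat K 1 2) //.
Qed.

End BoundaryRoots.

(** * Openness and closure of the symmetrized bidisk *)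

Section OpenSet.
Variable K : numClosedFieldType.
Implicit Types (s p z e : K).

Lemma in_G_open s p : in_G s p -> exists2 e, 0 < e &
  forall s' p', `|s - s'| < e -> `|p - p'| < e -> in_G s' p'.
Proof.
move=> sG; have [p1 s2 def] := in_G_lt sG.
pose d := 1 - `|p| ^+ 2 - `|s - s^* * p|; have d0 : 0 < d by rewrite subr_gt0.
have d_le : d <= (1 - `|p|) * 2.
  apply: le_trans (_ : 1 - `|p| ^+ 2 <= _); first by rewrite gerBl.
  have -> : 1 - `|p| ^+ 2 = (1 - `|p|) * (1 + `|p|) by ring.
  by apply: ler_wpM2l; [rewrite subr_ge0 ltW | rewrite -[2]/(1 + 1) lerD2l ltW].
(* Moving by e costs at most 4 e in the defect of s and 2 e in |p|^2, together the slack d. *)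
pose e := d / 6; have e0 : 0 < e by rewrite divr_gt0 ?ltr0n.
have e_lt : e < 1 - `|p|.
  rewrite ltr_pdivrMr ?ltr0n //; apply: le_lt_trans d_le _.
  by rewrite ltr_pM2l ?subr_gt0 // ltr_nat.
exists e => // s' p' ss pp.
have p'1 : `|p'| < 1.
  rewrite -(subrK p p') ; apply: le_lt_trans (ler_normD _ _) _.
  by rewrite -ltrBrDr distrC; apply: lt_trans pp e_lt.
apply: in_G_of_lt => //.
have -> : s' - s'^* * p' = (s - s^* * p) + ((s' - s) - (s' - s)^* * p' - s^* * (p' - p)).
  by rewrite rmorphB; ring.
have le4 : `|(s' - s) - (s' - s)^* * p' - s^* * (p' - p)| < e + e + 2 * e.
  apply: le_lt_trans (ler_normB _ _) _; apply: ltr_leD.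
    apply: le_lt_trans (ler_normB _ _) _; rewrite distrC; apply: ltr_leD => //.
    by rewrite normrM norm_conjC distrC -[e]mulr1 ler_pM // ltW.
  by rewrite normrM norm_conjC ler_pM // distrC ltW.
apply: le_lt_trans (ler_normD _ _) _.
have p2 : `|p'| ^+ 2 <= `|p| ^+ 2 + 2 * e.
  rewrite -lerBlDl.
  have -> : `|p'| ^+ 2 - `|p| ^+ 2 = (`|p'| + `|p|) * (`|p'| - `|p|) by ring.
  have pe : `|p'| - `|p| <= e.
    by apply: le_trans (lerB_dist _ _) _; rewrite distrC ltW.
  apply: le_trans (_ : (`|p'| + `|p|) * e <= _).
    by apply: ler_wpM2l; rewrite ?addr_ge0.
  by apply: ler_wpM2r; [exact: ltW | rewrite -[2]/(1 + 1) lerD // ltW].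
apply: lt_le_trans (_ : `|s - s^* * p| + (e + e + 2 * e) <= _); first by rewrite ltrD2l.
apply: le_trans (_ : 1 - (`|p| ^+ 2 + 2 * e) <= _); last by rewrite lerD2l lerN2.
have Ed : `|s - s^* * p| = 1 - `|p| ^+ 2 - e *+ 6.
  by rewrite /e /d; field.
by rewrite Ed -subr_ge0; suff -> : 1 - (`|p| ^+ 2 + 2 * e) - (1 - `|p| ^+ 2 - e *+ 6 + (e + e + 2 * e)) = 0; [| ring].
Qed.

Lemma in_G_approx z1 z2 : `|z1| <= 1 -> `|z2| <= 1 -> forall e, 0 < e ->
  exists s p, [/\ in_G s p, `|z1 + z2 - s| < e & `|z1 * z2 - p| < e].
Proof.
move=> z11 z21 e e0; have e1 : 0 < e + 1 by rewrite addr_gt0.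
pose d := e / (2 * (e + 1)); have d0 : 0 < d by rewrite divr_gt0 ?mulr_gt0 ?ltr0n.
have d2 : 2 * d < e.
  have -> : 2 * d = e / (e + 1) by rewrite /d; field; rewrite lt0r_neq0.
  by rewrite ltr_pdivrMr // ltr_pMr // ltrDr.
have d1 : d < 1.
  rewrite ltr_pdivrMr ?mulr_gt0 ?ltr0n // mul1r mulrDr; apply: lt_le_trans (_ : 2 * e <= _).
    by rewrite ltr_pMl // (ltr_nat K 1 2).
  by rewrite lerDl mulr1 ler0n.
move: d d0 d2 d1 => d d0 d2 d1.
have t1 : `|1 - d| = 1 - d by rewrite gtr0_norm // subr_gt0.
have lt1 z : `|z| <= 1 -> `|(1 - d) * z| < 1.
  move=> z1'; rewrite normrM t1; apply: le_lt_trans (_ : (1 - d) * 1 < 1).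
    by apply: ler_wpM2l => //; rewrite subr_ge0 ltW.
  by rewrite mulr1 gtrBl.
exists ((1 - d) * z1 + (1 - d) * z2), ((1 - d) * z1 * ((1 - d) * z2)); split.
- by exists ((1 - d) * z1), ((1 - d) * z2); split; rewrite ?lt1.
- have -> : z1 + z2 - ((1 - d) * z1 + (1 - d) * z2) = d * z1 + d * z2 by ring.
  apply: le_lt_trans (ler_normD _ _) _; apply: le_lt_trans d2.
  have -> : 2 * d = d + d by ring.
  by apply: lerD; rewrite normrM (gtr0_norm d0) ler_piMr // ltW.
have -> : z1 * z2 - (1 - d) * z1 * ((1 - d) * z2) = d * (2 - d) * (z1 * z2) by ring.
apply: le_lt_trans d2; rewrite -mulrA normrM (gtr0_norm d0) normrM [2 * d]mulrC.
apply: ler_wpM2l; first exact: ltW.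
have d20 : 0 <= 2 - d by rewrite subr_ge0 ltW // (lt_trans d1) // (ltr_nat K 1 2).
rewrite (ger0_norm d20) -[leRHS]mulr1; apply: ler_pM => //.
  by rewrite gerBl ltW.
by rewrite normrM -[1]mulr1 ler_pM.
Qed.

Lemma in_G_closure_le1 s p : (forall e, 0 < e -> exists s' p',
  [/\ in_G s' p', `|s - s'| < e & `|p - p'| < e]) -> `|p| <= 1.
Proof.
move=> H; rewrite real_leNgt ?normr_real ?real1 //; apply/negP => p1.
have e0 : 0 < `|p| - 1 by rewrite subr_gt0.
have [s' [p' [/in_G_lt[p'1 _ _] _ pp]]] := H _ e0.
have : `|p| < `|p|.
  rewrite -{1}(subrK p' p); apply: le_lt_trans (ler_normD _ _) _.
  by apply: lt_le_trans (ltrD pp p'1) _; rewrite subrK.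
by rewrite ltxx.
Qed.

End OpenSet.

(** * The complex numbers *)

Section ComplexModel.
Variable R : realType.
Local Notation K := R[i].
Local Open Scope classical_set_scope.

Lemma complex_real_part (x : K) : 0 <= x -> x = real_complex R (complex.Re x).
Proof. by move=> x0; rewrite RRe_real // ger0_real. Qed.

Lemma bernoulli (h : R) n : 0 <= h -> 1 + n%:R * h <= (1 + h) ^+ n.
Proof.
move=> h0; elim: n => [|n IHn]; first by rewrite mul0r addr0 expr0.
have h1 : 0 <= 1 + h by rewrite addr_ge0.
rewrite exprS; apply: le_trans (ler_wpM2l h1 IHn).
have -> : (1 + h) * (1 + n%:R * h) = 1 + n.+1%:R * h + n%:R * h ^+ 2 by rewrite mulrS; ring.
by rewrite lerDl mulr_ge0 ?exprn_ge0.
Qed.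

Lemma geometric_real (x e : R) : 0 <= x -> x < 1 -> 0 < e ->
  exists N : nat, forall n, (N <= n)%N -> x ^+ n <= e.
Proof.
move=> x0 x1 e0; have [->|xn0] := eqVneq x 0.
  by exists 1%N => n n0; rewrite expr0n gtn_eqF // ltW.
have xp : 0 < x by rewrite lt_def xn0.
pose h := x^-1 - 1; have h0 : 0 < h by rewrite subr_gt0 invf_gt1.
have [N HN] : exists N : nat, (e * h)^-1 < N%:R.
  by exists (Num.bound (e * h)^-1); apply: archi_boundP; rewrite invr_ge0 mulr_ge0 // ltW.
exists N => n Nn.
have h1 : e^-1 <= (1 + h) ^+ n.
  apply: le_trans (bernoulli n (ltW h0)); apply: le_trans (_ : N%:R * h <= _).
    by move: HN; rewrite invfM ltr_pdivrMr // => /ltW.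
  by rewrite ler_wpDl // ler_wpM2r ?(ltW h0) // ler_nat.
have -> : x = (1 + h)^-1 by rewrite /h addrC subrK invrK.
rewrite exprVn -[e]invrK lef_pV2 ?posrE ?invr_gt0 //.
by rewrite exprn_gt0 // addr_gt0.
Qed.

Lemma geometric_complex (x e : K) : 0 <= x -> x < 1 -> 0 < e ->
  exists N : nat, forall n, (N <= n)%N -> x ^+ n <= e.
Proof.
move=> x0 x1 e0; have := complex_real_part x0; have := complex_real_part (ltW e0).
move: (complex.Re x) (complex.Re e) => a b Ee Ex; move: x0 x1 e0; rewrite {}Ee {}Ex.
rewrite -[1]/(real_complex R 1) -[0]/(real_complex R 0) lecR !ltcR => x0 x1 e0.
have [N HN] := geometric_real x0 x1 e0; exists N => n /HN.
by rewrite -rmorphXn lecR.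
Qed.

Lemma symmetrized_bidiskP (s p : K) : symmetrized_bidisk R (s, p) <-> in_G s p.
Proof.
split=> [[z1 [z2 [h1 h2 [-> ->]]]]|[z1 [z2 [h1 h2 -> ->]]]]; first by exists z1, z2.
by exists z1, z2.
Qed.

Lemma topological_boundaryP (s p : K) :
  topological_boundary (symmetrized_bidisk R) (s, p) <->
  (forall e, 0 < e -> exists s' p', [/\ in_G s' p', `|s - s'| < e & `|p - p'| < e]) /\ ~ in_G s p.
Proof.
split=> [[clo nint]|[app nG]].
  split=> [e e0|sG].
    have [[s' p'] [/symmetrized_bidiskP sG [/= h1 h2]]] :=
      clo (ball ((s, p) : K^o * K^o) e) (nbhsx_ballx _ _ e0).
    by exists s', p'; split.
  apply: nint; have [e e0 He] := in_G_open sG.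
  apply/nbhs_ballP; exists e => //= -[s' p'] [/= h1 h2]; apply/symmetrized_bidiskP.
  exact: He.
split.
  move=> B /nbhs_ballP[e /= e0 HB]; have [s' [p' [sG h1 h2]]] := app e e0.
  exists (s', p'); split; first exact/symmetrized_bidiskP.
  by apply: HB; split.
by move=> /nbhs_singleton/symmetrized_bidiskP.
Qed.

Lemma torus_boundary (z1 z2 : K) : `|z1| = 1 -> `|z2| <= 1 ->
  topological_boundary (symmetrized_bidisk R) (z1 + z2, z1 * z2).
Proof.
move=> h1 h2; apply/topological_boundaryP; split.
  by apply: in_G_approx => //; rewrite h1.
by move/in_G_roots => [+ _]; rewrite h1 ltxx.
Qed.

Lemma zero_setE (xi : {poly {poly K}}) (s p : K) :
  zero_set xi (s, p) <-> (map_poly (horner_eval p) xi).[s] = 0.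
Proof. by rewrite /zero_set /= ev_horner hornerC. Qed.

(** A zero there would be a boundary point of G on V, hence on the distinguished boundary, where |p|
    = 1; but |z1 z2| < 1. *)
Lemma distinguished_zerofree (xi : {poly {poly K}}) (V : set (K * K)) : V = zero_set xi ->
  V `&` topological_boundary (symmetrized_bidisk R) = V `&` distinguished_boundary R ->
  forall z1 z2 : K, `|z1| = 1 -> `|z2| < 1 -> (map_poly (horner_eval (z1 * z2)) xi).[z1 + z2] != 0.
Proof.
move=> -> bd z1 z2 h1 h2; apply/eqP => h.
have : (zero_set xi `&` distinguished_boundary R) (z1 + z2, z1 * z2).
  rewrite -bd; split; first exact/zero_setE.
  by apply: torus_boundary => //; apply: ltW.
move=> [_ [w1 [w2 [hw1 hw2 [_ /(congr1 Num.norm)]]]]].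
by rewrite !normrM h1 hw1 hw2 !mul1r => h3; rewrite h3 ltxx in h2.
Qed.

End ComplexModel.

(** * Numerical contractions *)

Section NumericalRange.
Variables (K : numClosedFieldType) (n : nat).
Implicit Types (F A : 'M[K]_n) (h u v : 'cV[K]_n).
Local Notation ev p := (map_poly (horner_eval p)).

Lemma ev_pencil F (s p : K) :
  (ev p (char_poly (pencil_mx F))).[s] = \det (s%:M - (F^t* + p *: F)).
Proof.
have E : map_mx (horner_eval p) (pencil_mx F) = F^t* + p *: F.
  apply/matrixP=> i j; rewrite /pencil_mx !mxE [LHS]hornerD hornerM hornerX hornerC.
  by rewrite hornerC.
rewrite (@map_char_poly _ _ (horner_eval p)) E -det_evmx; congr (\det _); apply/matrixP=> i j.
by rewrite evmxE !mxE hornerD hornerN hornerMn hornerX hornerC.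
Qed.

Lemma pencil_eigenvector F (s p : K) : \det (F^t* + p *: F - s%:M) = 0 <->
  exists2 h : 'cV[K]_n, h != 0 & (F^t* + p *: F) *m h = s *: h.
Proof.
split=> [/det_eq0_kernel[h h0 /eqP]|[h h0 E]].
  by rewrite mulmxBl mul_scalar_mx subr_eq0 => /eqP; exists h.
apply/eqP; apply: contraNT h0 => dA; set A : 'M[K]_n := F^t* + p *: F - s%:M.
by rewrite -[h](@mulKmx _ _ _ A) ?unitmxE ?unitfE // mulmxBl mul_scalar_mx E subrr mulmx0.
Qed.

Lemma pencil_root F (s p : K) :
  root (ev p (char_poly (pencil_mx F))) s <-> \det (F^t* + p *: F - s%:M) = 0.
Proof.
rewrite /root ev_pencil -opprB -scaleN1r detZ mulf_eq0 signr_eq0 /=.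
by split=> /eqP.
Qed.

Lemma le_Re_norm (x : K) : x + x^* <= `|x| *+ 2.
Proof.
have [h _] := leif_normC_Re_Creal x; have E : x + x^* = 'Re x *+ 2.
  by rewrite ReE -mulr_natr divfK // pnatr_eq0.
rewrite E lerMn2r /=; apply: le_trans h; apply: real_ler_norm; exact: Creal_Re.
Qed.

Lemma pencil_eigenvector_in_G F h (s p : K) :
    (forall v, `|herm_form F v v| <= herm_form 1%:M v v) ->
    `|p| < 1 -> h != 0 -> (F^t* + p *: F) *m h = s *: h ->
  in_G s p \/ exists a, [/\ `|a| = 1, F *m h = a *: h & F^t* *m h = a^* *: h].
Proof.
move=> cF p1 h0 Eh; have N0 := herm_form1_gt0 h0; set N := herm_form 1%:M h h in N0.
have Nn0 : N != 0 by rewrite gt_eqF.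
have [a Ea] : exists a, herm_form F h h = a * N.
  by exists (herm_form F h h / N); rewrite divfK.
have NC : N^* = N by apply/CrealP; rewrite ger0_real // ltW.
have Eac : herm_form (F^t*) h h = a^* * N by rewrite -herm_form_adj Ea rmorphM /= NC.
have formZ c v : herm_form c%:M v v = c * herm_form 1%:M v v.
  by rewrite /herm_form mul_mx_scalar -scalemxAl mxE mulmx1.
have formE (A B : 'M[K]_n) c v : herm_form (A + c *: B) v v = herm_form A v v + c * herm_form B v v.
  by rewrite /herm_form mulmxDr mulmxDl mxE -scalemxAr -scalemxAl [X in _ + X]mxE.
have a1 : `|a| <= 1.
  by have := cF h; rewrite Ea normrM (gtr0_norm N0) -ler_pdivlMr // divff.
have Es : s = a^* + p * a.
  apply: (mulIf Nn0); rewrite mulrDl -mulrA -Eac -Ea -formE.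
  by rewrite /herm_form -mulmxA Eh -scalemxAr mxE /N /herm_form mulmx1.
have p2 : 0 < 1 - `|p| ^+ 2 by rewrite subr_gt0 expr_lt1.
have [a1'|a1'] := boolP (`|a| < 1).
  left; apply: in_G_of_lt => //.
  (* For s = conj a + p a the defect is exactly conj a (1 - |p|^2), so |a| < 1 puts (s, p) in G. *)
  have -> : s - s^* * p = a^* * (1 - `|p| ^+ 2).
    by rewrite Es rmorphD rmorphM /= conjCK normCK; ring.
  by rewrite normrM norm_conjC (gtr0_norm p2) gtr_pMl.
right; have {}a1 : `|a| = 1.
  by apply/eqP; rewrite eq_le a1 real_leNgt ?real1 ?normr_real.
have aa : a * a^* = 1 by rewrite -normCK a1 expr1n.
have a0 := circle_neq0 a1.
pose A := (2%:M + (- a^*) *: F) + (- a) *: F^t*.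
have pA : psd A.
  move=> v; have -> : herm_form A v v =
      herm_form 1%:M v v *+ 2 - (a^* * herm_form F v v + (a^* * herm_form F v v)^*).
    rewrite rmorphM /= conjCK !formE formZ -herm_form_adj; ring.
  rewrite subr_ge0; apply: le_trans (le_Re_norm _) _.
  by rewrite lerMn2r /= normrM norm_conjC a1 mul1r.
have /(psd_ker pA) : herm_form A h h = 0.
  rewrite !formE formZ Eac Ea; have -> : 2 * N + - a^* * (a * N) + - a * (a^* * N) =
    (1 - a * a^*) * N *+ 2 by ring.
  by rewrite aa subrr mul0r mul0rn.
rewrite !mulmxDl mul_scalar_mx -!scalemxAl => E1.
rewrite mulmxDl -scalemxAl in Eh.
have E2 : F^t* *m h = (2 * a^*) *: h - (a^* ^+ 2) *: (F *m h).
  move/eqP: E1; rewrite !scaleNr subr_eq0 => /eqP/esym E1; apply: (scalerI a0).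
  rewrite E1 scalerBr !scalerA expr2 mulrCA aa mulr1 mulrA aa mul1r //.
(* Eliminating the adjoint with the eigenvalue equation makes (p - (conj a)^2) F h a multiple of h;
   the factor is nonzero since |p| < 1 = |a|. *)
have q0 : p - a^* ^+ 2 != 0.
  apply: contraTneq p1 => /eqP; rewrite subr_eq0 => /eqP ->.
  by rewrite normrX norm_conjC a1 expr1n ltxx.
have [c Ec] : exists c, F *m h = c *: h.
  exists ((s - 2 * a^*) / (p - a^* ^+ 2)); apply: (scalerI q0).
  rewrite scalerA mulrC divfK // scalerBl [RHS]scalerBl -Eh E2.
  by rewrite addrAC -addrA addrACA subrr add0r addrC.
have Ec' : c = a.
  apply: (mulIf Nn0); rewrite -Ea /herm_form -mulmxA Ec -scalemxAr mxE.
  by rewrite /N /herm_form mulmx1.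
exists a; split=> //; first by rewrite Ec Ec'.
rewrite E2 Ec Ec' scalerA -scalerBl; congr (_ *: _).
by have -> : 2 * a^* - a^* ^+ 2 * a = 2 * a^* - (a * a^*) * a^* ; [ring | rewrite aa; ring].
Qed.

Lemma herm_form_le_eigenvalues A (c : K) : A^t* = A ->
    (forall u l, u != 0 -> A *m u = l *: u -> l \is Num.real -> l <= c) ->
  forall h, herm_form A h h <= c * herm_form 1%:M h h.
Proof.
move=> hA Hc h; have : A \is hermsymmx by apply/is_hermitianmxP; rewrite expr0 scale1r hA.
move=> /hermitian_normalmx/orthomx_spectralP E.
set P := spectralmx A in E; set d := spectral_diag A in E.
have PU : P \is unitarymx := spectral_unitarymx A.
have AP i : A *m (P^t* *m delta_mx i 0) = d 0 i *: (P^t* *m (delta_mx i 0 : 'cV_n)).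
  rewrite {1}E invmx_unitary // !mulmxA -(mulmxA _ P (P^t*)) (unitarymxP PU) mulmx1.
  rewrite -mulmxA scalemxAr; congr (_ *m _); rewrite mul_diag_mx; apply/matrixP=> j k.
  by rewrite !mxE; case: eqP => [->|]; rewrite ?andbF ?mulr0.
have Pdelta i : P^t* *m (delta_mx i 0 : 'cV_n) != 0.
  apply/eqP => /(congr1 (mulmx P)); rewrite mulmx0 mulmxA (unitarymxP PU) mul1mx.
  by move/matrixP/(_ i 0); rewrite !mxE !eqxx => /eqP; rewrite oner_eq0.
have dc i : d 0 i <= c.
  apply: (Hc (P^t* *m delta_mx i 0)); rewrite ?Pdelta ?AP //.
  pose u : 'cV_n := P^t* *m delta_mx i 0; have Eu : herm_form A u u = d 0 i * herm_form 1%:M u u.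
    by rewrite /herm_form -mulmxA AP -scalemxAr mxE mulmx1.
  have u0 : u != 0 by exact: Pdelta.
  have /lt0r_neq0/mulIf N0 := herm_form1_gt0 u0; apply/CrealP/N0.
  have := herm_form_adj A u u; rewrite hA Eu rmorphM /= herm_form_adj trmx1 map_mx1.
  by [].
pose w := P *m h; have Eh : h = P^t* *m w.
  by rewrite /w -invmx_unitary // mulKmx ?unitarymx_unit.
have -> : herm_form A h h = \sum_i d 0 i * `|w i 0| ^+ 2.
  rewrite /herm_form E invmx_unitary // !mulmxA -ctmxM -mulmxA -/w mxE.
  by apply: eq_bigr => i _; rewrite mul_mx_diag [X in X * _]mxE ctmxE normCK; ring.
have -> : herm_form 1%:M h h = \sum_i `|w i 0| ^+ 2.
  rewrite Eh /herm_form mulmx1 ctmxM trmxCK mulmxA -(mulmxA _ P) (unitarymxP PU) mulmx1 mxE.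
  by apply: eq_bigr => i _; rewrite ctmxE normCK mulrC.
by rewrite mulr_sumr ler_sum // => i _; rewrite ler_wpM2r ?exprn_ge0.
Qed.

(** Rotate by w so that w <F h, h> = |<F h, h>|. If l is an eigenvalue of the Hermitian matrix w F +
    conj w F^t* then w l is one of the pencil at p = w^2, so |l| <= 2. *)
Lemma pencil_contraction F :
    (forall s p h, `|p| = 1 -> h != 0 -> (F^t* + p *: F) *m h = s *: h -> `|s| <= 2) ->
  forall h, `|herm_form F h h| <= herm_form 1%:M h h.
Proof.
move=> HF h; set f := herm_form F h h; have [f0|f0] := eqVneq f 0.
  by rewrite f0 normr0 herm_form1_ge0.
pose w := f^* / `|f|; have w1 : `|w| = 1.
  by rewrite normf_div norm_conjC normr_id divff // normr_eq0.
have wf : w * f = `|f|.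
  by rewrite /w mulrAC [_ * f]mulrC -normCK expr2 mulfK // normr_eq0.
have wfC : w^* * f^* = `|f|.
  by rewrite -[LHS](rmorphM Num.conj) /= wf; apply/CrealP; rewrite normr_real.
have formE (A B : 'M[K]_n) c v : herm_form (A + c *: B) v v = herm_form A v v + c * herm_form B v v.
  by rewrite /herm_form mulmxDr mulmxDl mxE -scalemxAr -scalemxAl [X in _ + X]mxE.
pose A := w *: F + w^* *: F^t*.
have hA : A^t* = A by rewrite ctmxD !ctmxZ trmxCK conjCK addrC.
have EA : herm_form A h h = 2 * `|f|.
  have -> : A = (0 + w *: F) + w^* *: F^t* by rewrite add0r.
  rewrite !formE -herm_form_adj -/f wf wfC /herm_form mulmx0 mul0mx mxE add0r; ring.
suff : herm_form A h h <= 2 * herm_form 1%:M h h by rewrite EA ler_pM2l // ltr0n.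
apply: herm_form_le_eigenvalues => // u l u0 Eu lr.
apply: le_trans (real_ler_norm lr) _; have -> : `|l| = `|w * l| by rewrite normrM w1 mul1r.
apply: (HF _ (w ^+ 2) u) => //; first by rewrite normrX w1 expr1n.
rewrite -scalerA -Eu mulmxDl mulmxDl scalerDr addrC -!scalemxAl !scalerA expr2.
by rewrite -normCK w1 expr1n scale1r.
Qed.

End NumericalRange.

(** * Numerical radius and complete non-unitarity *)

Section Operators.
Variables (R : realType) (d : nat).
Local Notation K := R[i].
Implicit Types (F : 'M[K]_d) (h k : 'cV[K]_d).
Local Open Scope classical_set_scope.
Local Notation normc := ComplexField.Normc.normc.

Lemma cdotE h k : cdot h k = herm_form 1%:M k h.
Proof.
rewrite /cdot dotmxE /herm_form mulmx1 !mxE; apply: eq_bigr => i _.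
by rewrite !mxE mulrC.
Qed.

Lemma cdot_form F h : cdot (F *m h) h = herm_form F h h.
Proof. by rewrite cdotE /herm_form mulmx1 mulmxA. Qed.

Lemma normc_norm (z : K) : `|z| = real_complex R (normc z).
Proof. by []. Qed.

Lemma herm_form_unit_bound F h : herm_form 1%:M h h = 1 ->
  `|herm_form F h h| <= \sum_i \sum_j `|F i j|.
Proof.
move=> h1; have hi i : `|h i 0| <= 1.
  rewrite -(@expr_le1 _ 2) // -h1 /herm_form mulmx1 mxE (bigD1 i) //= ctmxE mulrC -normCK.
  rewrite lerDl sumr_ge0 // => j _; rewrite ctmxE mulrC -normCK exprn_ge0 //.
have -> : herm_form F h h = \sum_i \sum_j (h i 0)^* * F i j * h j 0.
  rewrite /herm_form mxE exchange_big; apply: eq_bigr => j _.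
  by rewrite mxE mulr_suml; apply: eq_bigr => i _; rewrite ctmxE.
apply: le_trans (ler_norm_sum _ _ _) _; apply: ler_sum => i _.
apply: le_trans (ler_norm_sum _ _ _) _; apply: ler_sum => j _.
rewrite !normrM norm_conjC -[leRHS]mulr1; apply: ler_pM => //.
  by rewrite mulr_ge0.
by rewrite ler_piMl.
Qed.

Lemma numerical_contractionP F : numerical_contraction F <->
  forall h, `|herm_form F h h| <= herm_form 1%:M h h.
Proof.
split=> [cF h|HF].
  have [->|h0] := eqVneq h 0; first by rewrite /herm_form !mulmx0 !mxE normr0.
  have N0 := herm_form1_gt0 h0; set N := herm_form 1%:M h h in N0 *.
  have [b [b0 bb]] : exists b : K, 0 < b /\ b * b * N = 1.
    exists (sqrtC N)^-1; rewrite invr_gt0 sqrtC_gt0 -invfM -expr2 sqrtCK mulVf //.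
    by rewrite gt_eqF.
  have bC : b^* = b by apply/CrealP; rewrite ger0_real // ltW.
  have h1 : herm_form 1%:M (b *: h) (b *: h) = 1.
    by rewrite herm_formZl herm_formZr bC mulrA.
  have ub : has_ubound [set normc (cdot (F *m k) k) | k in [set k : 'cV[K]_d | cdot k k = 1]].
    exists (complex.Re (\sum_i \sum_j `|F i j|)) => _ [k /= k1 <-].
    rewrite cdotE in k1; rewrite cdot_form -lecR -normc_norm -complex_real_part.
      exact: herm_form_unit_bound.
    by rewrite sumr_ge0 // => i _; rewrite sumr_ge0.
  have := le_trans (ub_le_sup ub _) cF; move=> /(_ (normc (cdot (F *m (b *: h)) (b *: h)))).
  have h1' : cdot (b *: h) (b *: h) = 1 by rewrite cdotE.
  move=> /(_ (ex_intro2 _ _ (b *: h) h1' erefl)).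
  rewrite -lecR -normc_norm cdot_form herm_formZl herm_formZr bC mulrA normrM.
  rewrite gtr0_norm ?mulr_gt0 // => hb.
  by rewrite -(@ler_pM2l _ (b * b)) ?mulr_gt0 // bb.
rewrite /numerical_contraction /numerical_radius.
set S := (X in sup X); have [[x Sx]|S0] := pselect (S !=set0).
  apply: ge_sup; first by exists x.
  move=> _ [h /= h1 <-]; rewrite -lecR -normc_norm cdot_form.
  by apply: le_trans (HF h) _; rewrite -cdotE h1.
(* There are no unit vectors, as in dimension 0, and [sup] takes its default value 0. *)
rewrite sup_out ?ler01 // => -[] //.
Qed.

Lemma not_completely_nonunitary F h (a : K) : h != 0 -> `|a| = 1 -> F *m h = a *: h ->
  F^t* *m h = a^* *: h -> ~ completely_nonunitary F.
Proof.
move=> h0 a1 Fh Gh; apply; exists <[h]>%VS; split.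
- by rewrite -dimv_eq0 dim_vline h0.
- move=> _ /vlineP[c ->]; rewrite -!scalemxAr Fh Gh; split; apply: memvZ; apply: memvZ; exact: memv_line.
split=> [_ _ /vlineP[c ->] /vlineP[e ->]|_ /vlineP[c ->]].
  rewrite !cdotE -!scalemxAr Fh !herm_formZl !herm_formZr.
  have -> (x y z : K) : x * (a^* * (y * (a * z))) = (a * a^*) * (x * (y * z)) by ring.
  by rewrite -normCK a1 expr1n mul1r.
exists ((c / a) *: h); first by apply: memvZ; exact: memv_line.
by rewrite -scalemxAr Fh scalerA divfK // circle_neq0.
Qed.

(** F has an eigenvector h in the reducing subspace U. As F is isometric on U, the vector F^t* F h -
    h of U is orthogonal to itself, so h is an eigenvector of the adjoint too. *)
Lemma unitary_eigenvector F : ~ completely_nonunitary F ->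
  exists h (a : K), [/\ h != 0, `|a| = 1, F *m h = a *: h & F^t* *m h = a^* *: h].
Proof.
move=> /contrapT[U [U0 red [iso _]]].
have [v vU v0] : exists2 v, v \in U & v != 0 by exists (vpick U); rewrite ?memv_pick ?vpick0.
have [h [a [hU h0 Fh]]] := @stable_eigenvector _ _ F (fun u => u \in U) v
  (fun u c uU => memvB (proj1 (red u uU)) (memvZ c uU)) vU v0.
pose w := F^t* *m (F *m h) - h.
have wU : w \in U by rewrite memvB // (proj2 (red _ _)) // (proj1 (red _ _)).
have w0 : w = 0.
  apply: herm_form1_eq0; have := iso h w hU wU; rewrite !cdotE => E.
  have : herm_form 1%:M (F *m w) (F *m h) - herm_form 1%:M w h = 0 by rewrite E subrr.
  move=> <-; rewrite /herm_form !mulmx1 ctmxM /w mulmxBr -!mulmxA mxE [X in _ + X]mxE //.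
have a1 : `|a| = 1.
  have := iso h h hU hU; rewrite !cdotE Fh herm_formZl herm_formZr mulrA [_ * a]mulrC -normCK.
  have /lt0r_neq0 N0 := herm_form1_gt0 h0; rewrite -[RHS]mul1r => /(mulIf N0)/eqP.
  by rewrite pexpr_eq1 // => /eqP.
exists h, a; split=> //; have a0 := circle_neq0 a1; apply: (scalerI a0).
rewrite scalerA -normCK a1 expr1n scale1r scalemxAr -Fh.
by apply/eqP; rewrite -subr_eq0; apply/eqP.
Qed.

End Operators.

(** * Distinguished varieties and complete non-unitarity *)

Section ForwardDirection.
Variable R : realType.
Local Notation K := R[i].
Local Open Scope classical_set_scope.
Local Notation ev p := (map_poly (horner_eval p)).

(** With a = |z1|^2 and b = |z2|^2, so that a b = 1, the relation s = p conj s forces a = 1 or z1 =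
    a z2; in the second case |s| <= 2 becomes (a - 1)^2 <= 0. *)
Lemma circle_sum_product (s p : K) : `|p| = 1 -> s = p * s^* -> `|s| <= 2 ->
  exists z1 z2 : K, [/\ `|z1| = 1, `|z2| = 1, s = z1 + z2 & p = z1 * z2].
Proof.
have [z1 [z2 [-> ->]]] := sum_product_roots s p.
rewrite rmorphD /= => p1 E s2; set a := `|z1| ^+ 2; set b := `|z2| ^+ 2.
have ab : a * b = 1 by rewrite -exprMn -normrM p1 expr1n.
have a0 : 0 <= a by rewrite exprn_ge0.
suff a1 : a = 1.
  have b1 : b = 1 by rewrite -ab a1 mul1r.
  exists z1, z2; split=> //; apply/eqP; rewrite -(@pexpr_eq1 _ _ 2) //; exact/eqP.
have E1 : z1 * (1 - b) = z2 * (a - 1).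
  apply/eqP; rewrite -subr_eq0.
  have -> : z1 * (1 - b) - z2 * (a - 1) = z1 + z2 - z1 * z2 * (z1^* + z2^*).
    by rewrite /a /b !normCK; ring.
  by rewrite -E subrr.
have : (a - 1) * (z1 - a * z2) = 0.
  have -> : (a - 1) * (z1 - a * z2) = a * (z1 * (1 - b) - z2 * (a - 1)) + z1 * (a * b - 1) by ring.
  by rewrite E1 ab !subrr !mulr0 addr0.
move/eqP; rewrite mulf_eq0 subr_eq0 => /orP[/eqP //|]; rewrite subr_eq0 => /eqP Ez.
have : `|z1 + z2| ^+ 2 <= 2 ^+ 2 by rewrite lerXn2r ?nnegrE // ler0n.
have -> : z1 + z2 = (a + 1) * z2 by rewrite Ez; ring.
have a10 : 0 <= a + 1 by rewrite addr_ge0.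
rewrite normrM (ger0_norm a10) exprMn -/b => h.
have : (a - 1) ^+ 2 <= 0.
  have -> : (a - 1) ^+ 2 = a * ((a + 1) ^+ 2 * b - 2 ^+ 2) - (a + 1) ^+ 2 * (a * b - 1) by ring.
  by rewrite ab subrr mulr0 subr0 mulr_ge0_le0 // subr_le0.
by move=> h2; apply/eqP; rewrite -subr_eq0 -sqrf_eq0 eq_le h2 real_exprn_even_ge0 ?realB ?ger0_real.
Qed.

Section Pencil.
Variables (d : nat) (F : 'M[K]_d).

Lemma determinantal_varietyE : determinantal_variety F = zero_set (char_poly (pencil_mx F)).
Proof.
apply/seteqP; split=> -[s p].
  by move=> /= /(proj2 (pencil_root F s p)) /rootP/zero_setE.
by move=> /zero_setE/rootP/pencil_root.
Qed.

Lemma pencil_root_in_G (s p : K) : numerical_contraction F -> completely_nonunitary F ->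
  `|p| < 1 -> root (ev p (char_poly (pencil_mx F))) s -> in_G s p.
Proof.
move=> /numerical_contractionP cF cnu p1 /pencil_root/pencil_eigenvector[h h0 Eh].
have [//|[a [a1 E1 E2]]] := pencil_eigenvector_in_G cF p1 h0 Eh.
by have := not_completely_nonunitary h0 a1 E1 E2.
Qed.

Lemma monic_root (q : {poly {poly K}}) (p : K) : q \is monic -> (1 < size q)%N ->
  exists s, root (ev p q) s.
Proof.
by move=> mq sq; apply: closed_rootP; rewrite size_ev_monic // gtn_eqF.
Qed.

(** [0 < d] gives the variety a point over p = 0. Over |p| < 1 the variety lies in G, so its
    boundary points have |p| = 1. *)
Lemma distinguished_of_nonunitary : (0 < d)%N -> numerical_contraction F ->
  completely_nonunitary F -> distinguished_variety (determinantal_variety F).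
Proof.
move=> d0 cF cnu; exists (char_poly (pencil_mx F)); rewrite determinantal_varietyE.
have mq := char_poly_monic (pencil_mx F).
have sq : (1 < size (char_poly (pencil_mx F)))%N by rewrite size_char_poly.
have Gq := fun p s => pencil_root_in_G (s := s) (p := p) cF cnu.
split=> //.
  have [s rs] := monic_root 0 mq sq.
  exists (s, 0); split; first exact/zero_setE/rootP.
  by apply/symmetrized_bidiskP/Gq; rewrite ?normr0.
apply/seteqP; split=> -[s p] [Vz].
  move=> /topological_boundaryP[clo nG]; split=> //.
  have rs : root (ev p (char_poly (pencil_mx F))) s by exact/rootP/zero_setE.
  have p1 : `|p| = 1.
    apply/eqP; rewrite eq_le (in_G_closure_le1 clo) real_leNgt ?real1 ?normr_real //.
    by apply/negP => p1; apply: nG; apply: Gq.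
  have [Es s2] := circle_roots mq Gq p1 rs.
  have [z1 [z2 [h1 h2 -> ->]]] := circle_sum_product p1 Es s2.
  by exists z1, z2.
move=> [z1 [z2 [h1 h2 E]]]; split=> //; move: E => [-> ->].
by apply: torus_boundary => //; rewrite h2.
Qed.

(** A joint eigenvector puts (conj a, 0) on the variety: a boundary point of G, as |a| = 1, but off
    the distinguished boundary, where |p| = 1. *)
Lemma nonunitary_of_distinguished : distinguished_variety (determinantal_variety F) ->
  completely_nonunitary F.
Proof.
move=> [xi [_ _ bd]]; apply: contrapT => /unitary_eigenvector[h [a [h0 a1 E1 E2]]].
have : (determinantal_variety F `&` distinguished_boundary R) (a^*, 0).
  rewrite -bd; split.
    by apply/pencil_eigenvector; exists h; rewrite // scale0r addr0.
  have -> : (a^*, 0) = (a^* + 0, a^* * 0) :> K * K by rewrite addr0 mulr0.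
  by apply: torus_boundary; rewrite ?norm_conjC ?normr0 ?ler01.
move=> [_ [z1 [z2 [h1 h2 [_ /(congr1 Num.norm)]]]]].
by rewrite normrM h1 h2 mul1r normr0 => /esym/eqP; rewrite oner_eq0.
Qed.

End Pencil.
End ForwardDirection.

(** * Irreducible components *)

Section Components.
Variable R : realType.
Local Notation K := R[i].
Local Open Scope classical_set_scope.
Local Notation ev p := (map_poly (horner_eval p)).
Implicit Types (V Y A B : set (K * K)) (q f g xi : {poly {poly K}}).
Import Pdiv.Idomain.

Lemma algebraic_zero_set xi : algebraic_set (zero_set xi).
Proof. by exists [set xi]; rewrite bigcap_set1. Qed.

Lemma zero_setM f g : zero_set (f * g) = zero_set f `|` zero_set g.
Proof.
apply/seteqP; split=> z; rewrite /zero_set /= !hornerM.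
  by move/eqP; rewrite mulf_eq0 => /orP[] /eqP; [left|right].
by move=> [] ->; rewrite ?mul0r ?mulr0.
Qed.

Lemma zero_set1 : zero_set 1 = set0 :> set (K * K).
Proof.
apply/seteqP; split=> // z; rewrite /zero_set /= !hornerC.
by move/eqP; rewrite oner_eq0.
Qed.

Lemma zero_set_dvd q f : q \is monic -> q %| f -> zero_set q `<=` zero_set f.
Proof.
by move=> mq /(Pdiv.IdomainMonic.dvdpP mq)[g ->]; rewrite zero_setM; apply: subsetUr.
Qed.

Lemma monic_size_gt1 q z : q \is monic -> zero_set q z -> (1 < size q)%N.
Proof.
move=> mq qz; rewrite ltnNge; apply/negP => sq.
move: mq qz; rewrite (size1_polyC sq) monicE lead_coefC => /eqP ->.
by rewrite zero_set1.
Qed.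

(** The dichotomy is irreducibility of q over K(p). If f and g are coprime to q then u q + v f g =
    c(p) with c nonzero; over a p with c(p) != 0 the monic q has a root, and f g cannot vanish
    there. *)
Lemma irreducible_zero_set q : q \is monic -> (1 < size q)%N ->
  (forall f, coprimep q f \/ q %| f) -> irreducible_set (zero_set q).
Proof.
move=> mq sq dich; split.
  by have [s /rootP rs] := monic_root 0 mq sq; exists (s, 0); apply/zero_setE.
move=> A B [SA ->] [SB ->] qAB.
have [qA|/existsNP[f /not_implyP[Sf qf]]] := pselect (forall f, SA f -> zero_set q `<=` zero_set f).
  by left=> z qz f Sf; apply: qA.
have [qB|/existsNP[g /not_implyP[Sg qg]]] := pselect (forall f, SB f -> zero_set q `<=` zero_set f).
  by right=> z qz g Sg; apply: qB.
have cf : coprimep q f by have [//|/(zero_set_dvd mq)] := dich f.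
have cg : coprimep q g by have [//|/(zero_set_dvd mq)] := dich g.
have : coprimep q (f * g) by rewrite coprimepMr cf.
move=> /coprimep_bezout[u [v [c [c0 E]]]].
have [p _ cp] := circle_nonroot c0.
have [s /rootP rs] := monic_root p mq sq.
have qz : zero_set q (s, p) by exact/zero_setE.
have : zero_set (f * g) (s, p).
  by rewrite zero_setM; have [h|h] := qAB _ qz; [left; apply: h | right; apply: h].
rewrite /zero_set /= => Ez; move: qz cp; rewrite /zero_set /= => Eq.
by rewrite -(hornerC c s%:P) -E hornerD hornerM (hornerM v) hornerD !(hornerM _ _ p) Ez Eq !mulr0 addr0 eqxx.
Qed.

Lemma irreducible_factor Y q : irreducible_set Y -> q \is monic -> Y `<=` zero_set q ->
  exists q', [/\ q' \is monic, (1 < size q')%N, Y `<=` zero_set q',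
    zero_set q' `<=` zero_set q & irreducible_set (zero_set q')].
Proof.
move=> [[z Yz] irrY]; have [N] := ubnP (size q); elim: N q => // N IHN q szN mq Yq.
have sq : (1 < size q)%N := monic_size_gt1 mq (Yq _ Yz).
have [dich|/existsNP[f /not_orP[/negP ncop /negP ndvd]]] :=
  pselect (forall f, coprimep q f \/ q %| f).
  by exists q; split=> //; apply: irreducible_zero_set.
have [q1 [q2 [m1 m2 Eq /andP[_ s1] /andP[_ s2]]]] := monic_split mq ncop ndvd.
have szlt n : (n < size q)%N -> (n < N)%N by move=> h; apply: leq_trans h _; rewrite -ltnS.
rewrite Eq zero_setM in Yq *.
have [h|h] := irrY _ _ (algebraic_zero_set q1) (algebraic_zero_set q2) Yq.
  have [q' [h1 h2 h3 h4 h5]] := IHN q1 (szlt _ s1) m1 h.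
  by exists q'; split=> //; apply: subset_trans h4 _; apply: subsetUl.
have [q' [h1 h2 h3 h4 h5]] := IHN q2 (szlt _ s2) m2 h.
by exists q'; split=> //; apply: subset_trans h4 _; apply: subsetUr.
Qed.

(** By maximality Y is itself the zero set of a monic polynomial, which has a root over every p. *)
Lemma monic_component V Y q : q \is monic -> V = zero_set q -> irreducible_component V Y ->
  forall p : K, exists s : K, Y (s, p).
Proof.
move=> mq -> [_ irrY Yq maxY] p.
have [q' [m' s' Yq' q'q irr']] := irreducible_factor irrY mq Yq.
have <- := maxY _ (algebraic_zero_set q') irr' Yq' q'q.
by have [s /rootP rs] := monic_root p m' s'; exists s; apply/zero_setE.
Qed.

Lemma algebraic_point (v : K * K) : algebraic_set [set v].
Proof.
exists [set 'X - v.1%:P%:P; ('X - v.2%:P)%:P]; apply/seteqP; split=> [_ ->|z H].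
  by move=> xi [] ->; rewrite /zero_set /= ?hornerXsubC ?hornerC ?hornerXsubC subrr ?horner0.
have := H _ (or_introl erefl); have := H _ (or_intror erefl).
rewrite /zero_set /= hornerC hornerXsubC hornerXsubC hornerD hornerN !hornerC.
by move=> /eqP; rewrite subr_eq0 => /eqP E2 /eqP; rewrite subr_eq0 => /eqP E1; case: z v E1 E2 {H} => [a b] [c e] /= -> ->.
Qed.

(* For Zorn's lemma: the Zariski closure of the union of a chain of irreducible sets is
   irreducible. *)
Lemma irreducible_component_through V v : algebraic_set V -> V v ->
  exists2 Y, irreducible_component V Y & Y v.
Proof.
move=> [SV EV] Vv.
pose good Y := [/\ algebraic_set Y, irreducible_set Y, Y `<=` V & Y v].
pose T := {Y | good Y}; pose Rel (a b : T) := `[< sval a `<=` sval b >].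
have [|a b c|a b|C totC|[Y [aY iY YV Yv]] maxY] := @Zorn T Rel.
- by move=> t; apply/asboolP.
- by move=> /asboolP h1 /asboolP h2; apply/asboolP; apply: subset_trans h1 h2.
- by case: a b => [A gA] [B gB] /asboolP h1 /asboolP h2; apply: eq_exist; apply/seteqP.
- have [[Y0 CY0]|C0] := pselect (C !=set0); last first.
    (* The empty chain is bounded by the point v alone. *)
    have gv : good [set v].
      split; [exact: algebraic_point | split | by move=> _ -> | by []]; first by exists v.
      by move=> A B _ _ H; have [h|h] := H v erefl; [left|right] => _ ->.
    by exists (exist _ _ gv) => s Cs; case: C0; exists s.
  pose S := [set xi | forall Y : T, C Y -> sval Y `<=` zero_set xi].
  pose W := \bigcap_(xi in S) zero_set xi.
  have CW (Y : T) : C Y -> sval Y `<=` W by move=> CY z Yz xi Sxi; apply: Sxi CY _ Yz.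
  have SW A : algebraic_set A -> (forall Y : T, C Y -> sval Y `<=` A) -> W `<=` A.
    move=> [SA ->] H z Wz xi SAxi; apply: Wz => Y CY y Yy; exact: H Y CY y Yy xi SAxi.
  have gW : good W.
    split; first by exists S.
    - split; first by exists v; apply: CW CY0 _ _; have [] := svalP Y0.
      move=> A B aA aB WAB.
      have split1 (Y : T) : C Y -> sval Y `<=` A \/ sval Y `<=` B.
        move=> CY; have [_ [_ irr] _ _] := svalP Y; apply: irr => //.
        by apply: subset_trans (CW _ CY) WAB.
      have [allA|/existsNP[Y1 /not_implyP[CY1 nA]]] := pselect (forall Y : T, C Y -> sval Y `<=` A).
        by left; apply: SW.
      have Y1B : sval Y1 `<=` B by have [/nA|] := split1 _ CY1.
      right; apply: SW => // Y CY; have [/asboolP h|/asboolP h] := totC Y Y1 CY CY1.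
        exact: subset_trans h Y1B.
      have [h1|//] := split1 _ CY; case: nA; exact: subset_trans h h1.
    - apply: SW => [|Y CY]; first by exists SV.
      by have [] := svalP Y.
    - by apply: CW CY0 _ _; have [] := svalP Y0.
  by exists (exist _ _ gW) => Y CY; apply/asboolP/CW.
exists Y => //; split=> // Y' aY' iY' YY' Y'V.
have g' : good Y' by split=> //; apply: YY'.
by have /(congr1 sval) := maxY (exist _ _ g') (asboolT YY').
Qed.

End Components.

(** * Components in the bidisk and determinantal representation *)

Section Converse.
Variable R : realType.
Local Notation K := R[i].
Local Open Scope classical_set_scope.
Local Notation ev p := (map_poly (horner_eval p)).

Lemma component_meets_bidisk d (F : 'M[K]_d) (Y : set (K * K)) :
  numerical_contraction F -> completely_nonunitary F ->
  irreducible_component (determinantal_variety F) Y -> Y `&` symmetrized_bidisk R !=set0.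
Proof.
move=> cF cnu compY.
have [s Ys] := monic_component (char_poly_monic _) (determinantal_varietyE F) compY 0.
exists (s, 0); split=> //; apply/symmetrized_bidiskP.
apply: pencil_root_in_G cF cnu _ _; rewrite ?normr0 ?ltr01 //.
apply/rootP/zero_setE; rewrite -determinantal_varietyE.
by have [_ _ YV _] := compY; apply: YV.
Qed.

(** The component through a point of V lies in Z(h) or in Z(q). It meets G, where h has no zero, so
    it lies in Z(q). *)
Lemma distinguished_monic (V : set (K * K)) : distinguished_variety V ->
    (forall Y, irreducible_component V Y -> Y `&` symmetrized_bidisk R !=set0) ->
  exists q, [/\ q \is monic, V = zero_set q &
    forall p s, `|p| < 1 -> root (ev p q) s -> in_G s p].
Proof.
move=> [xi [EV _ bd]] comp.
have zf := distinguished_zerofree EV bd.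
have [q [h [mq Exi Eq hG]]] := G_factorization (@geometric_complex R) zf.
exists q; split=> //; last first.
  move=> p s p1; rewrite Eq // root_prod_XsubC => /(proj1 (mem_G_roots _ _ _)).
  by move=> /(_ zf p1)[].
apply/seteqP; split=> [v Vv|v qv]; last by rewrite EV Exi zero_setM; right.
have [Y compY Yv] : exists2 Y, irreducible_component V Y & Y v.
  by apply: irreducible_component_through => //; rewrite EV; apply: algebraic_zero_set.
have [_ [_ irrY] YV _] := compY.
have [] := irrY _ _ (algebraic_zero_set h) (algebraic_zero_set q).
- by rewrite -zero_setM -Exi -EV.
- move=> Yh; have [[s p] [Ys /symmetrized_bidiskP sG]] := comp Y compY.
  by have /eqP := proj1 (zero_setE _ _ _) (Yh _ Ys); rewrite (negPf (hG _ _ sG)).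
by apply.
Qed.

Lemma determinantal_representation (V : set (K * K)) : distinguished_variety V ->
    (forall Y, irreducible_component V Y -> Y `&` symmetrized_bidisk R !=set0) ->
  exists (d : nat) (F : 'M[K]_d), [/\ (0 < d)%N, numerical_contraction F,
    completely_nonunitary F & V = determinantal_variety F].
Proof.
move=> dV comp; have [q [mq EV qG]] := distinguished_monic dV comp.
have sq : (1 < size q)%N.
  by have [xi [_ [v [Vv _]] _]] := dV; apply: (@monic_size_gt1 _ q v) => //; rewrite -EV.
have circle := circle_roots mq qG.
have [n [F [n0 EF]]] := self_adjoint_pencil mq sq (fun p s p1 rs => proj1 (circle p s p1 rs)).
have VF : V = determinantal_variety F by rewrite determinantal_varietyE EF.
(* Complete non-unitarity follows from V being distinguished. *)
exists n, F; split=> //; last by apply: nonunitary_of_distinguished; rewrite -VF.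
apply/numerical_contractionP/pencil_contraction => s p h p1 h0 Eh.
apply: (proj2 (circle p s p1 _)); rewrite -EF; apply/pencil_root/pencil_eigenvector.
by exists h.
Qed.

End Converse.

Local Open Scope classical_set_scope.
Local Open Scope complex_scope.
Local Open Scope ring_scope.

Theorem theorem1p5 (R : realType) :
  (forall (d : nat) (F : 'M[R[i]]_d), (0 < d)%N -> numerical_contraction F ->
     (distinguished_variety (determinantal_variety F) <->
        completely_nonunitary F) /\
     (completely_nonunitary F ->
        forall Y : set (R[i] * R[i]),
          irreducible_component (determinantal_variety F) Y ->
          Y `&` symmetrized_bidisk R !=set0)) /\
  (forall V : set (R[i] * R[i]),
     distinguished_variety V ->
     (forall Y : set (R[i] * R[i]),
        irreducible_component V Y -> Y `&` symmetrized_bidisk R !=set0) ->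
     exists (d : nat) (F : 'M[R[i]]_d),
       [/\ (0 < d)%N, numerical_contraction F, completely_nonunitary F
         & V = determinantal_variety F]).
Proof.
split; last exact: determinantal_representation.
move=> d F d0 cF; split; last by move=> cnu Y; apply: component_meets_bidisk.
split; first exact: nonunitary_of_distinguished.
exact: distinguished_of_nonunitary.
Qed.
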